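(* For all $a,b\ge1$ and $r=1,\dots,a$, we have $$\mathrm{Ch}\,\mathcal{L}_{(a^b)}^{r,1}=\sum_{\lambda\vdash ab}\left(\sum_{\nu\vdash b}\frac{1}{z_\nu}\sum_{\tau\mid r\ast\nu}\mu_\tau(\nu,r\ast\nu)\,\mathbf{a}_{\lambda,\tau}^{a\ast\nu}\right)s_\lambda(\mathbf{x})$$ and $$\mathrm{Ch}\,\mathcal{L}_{(a^b)}^{r,\epsilon}=\sum_{\lambda\vdash ab}\left(\sum_{\nu\vdash b}\frac{(-1)^{b-\ell(\nu)}}{z_\nu}\sum_{\tau\mid r\ast\nu}\mu_\tau(\nu,r\ast\nu)\,\mathbf{a}_{\lambda,\tau}^{a\ast\nu}\right)s_\lambda(\mathbf{x}),$$ where $\mathbf{a}_{\lambda,\tau}^{a\ast\nu}=\#\{Q\in\mathrm{SYT}(\lambda):\mathbf{maj}_{a\ast\nu}(Q)=\tau\}$.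
   Context: Representations are over $\mathbb{C}$; $\uparrow$ denotes induction. $\mathrm{Ch}$ is the Frobenius characteristic: $\mathrm{Ch}\,S^\lambda=s_\lambda(\mathbf{x})$ for the Specht module $S^\lambda$, extended additively. The wreath product $C_a\wr S_b$ is the set $C_a^b\times S_b$ with product $(g_1,\dots,g_b,\sigma)(h_1,\dots,h_b,\tau)=(g_1h_{\sigma^{-1}(1)},\dots,g_bh_{\sigma^{-1}(b)},\sigma\tau)$, where $C_a=\langle\sigma_a\rangle\le S_a$, $\sigma_a=(1\,2\cdots a)$. It is embedded in $S_{ab}$ by permuting the $b$ consecutive size-$a$ intervals of $\{1,\dots,ab\}$ among themselves and cyclically rotating each independently. Let $\chi_a^r(\sigma_a)=\omega_a^r$ for a fixed primitive $a$th root of unity $\omega_a$. Define one-dimensional representations of $C_a\wr S_b$: $\chi^{r,1}(g_1,\dots,g_b,\sigma)=\prod_i\chi_a^r(g_i)$ and $\chi^{r,\epsilon}(g_1,\dots,g_b,\sigma)=\mathrm{sgn}(\sigma)\prod_i\chi_a^r(g_i)$. Set $\mathcal{L}_{(a^b)}^{r,1}=\chi^{r,1}\uparrow_{C_a\wr S_b}^{S_{ab}}$ and $\mathcal{L}_{(a^b)}^{r,\epsilon}=\chi^{r,\epsilon}\uparrow_{C_a\wr S_b}^{S_{ab}}$. For a partition $\nu=(\nu_1,\dots,\nu_k)$ with $k=\ell(\nu)$ positive parts, $m_i$ of which equal $i$, $z_\nu=\prod_i i^{m_i}m_i!$. For an integer $c\ge 1$, $c\ast\nu=(c\nu_1,\dots,c\nu_k)$.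 For sequences of positive integers of the same length, $\tau\mid\rho$ means $\tau_j\mid\rho_j$ for all $j$. For positive integers $d\mid e$, $f\mid e$, $\mu_f(d,e)=\sum_{g:\ \mathrm{lcm}(f,d)\mid g\mid e}\mu(g/f)$, $\mu$ the number-theoretic Möbius function; for sequences, $\mu_{(f_1,\dots,f_k)}((d_1,\dots,d_k),(e_1,\dots,e_k))=\prod_j\mu_{f_j}(d_j,e_j)$. $\mathrm{SYT}(\lambda)$ is the set of standard Young tableaux of shape $\lambda$; for $Q\in\mathrm{SYT}(\lambda)$ with $\lambda\vdash n$, $\mathrm{Des}(Q)$ is the set of $i\in\{1,\dots,n-1\}$ such that $i+1$ lies in a lower row of $Q$ than $i$ (English notation). For a sequence $\kappa=(\kappa_1,\dots,\kappa_k)$ of positive integers with sum $n$, $\mathbf{maj}_\kappa(Q)\in[\kappa_1]\times\cdots\times[\kappa_k]$ (with $[m]=\{1,\dots,m\}$) has $j$th entry the representative in $[\kappa_j]$, modulo $\kappa_j$, of $\sum(d-n_j)$, summed over $d\in\mathrm{Des}(Q)$ with $n_j<d<n_j+\kappa_j$, where $n_j=\kappa_1+\cdots+\kappa_{j-1}$. *)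

(* Defs.v *)
From HB Require Import structures.
From mathcomp Require Import all_boot all_order all_algebra all_fingroup.
From mathcomp Require Import all_solvable all_field all_character.
From mathcomp Require Import mpoly.

Set Implicit Arguments.
Unset Strict Implicit.
Unset Printing Implicit Defensive.

Import Order.TTheory GRing.Theory Num.Theory.
Local Open Scope ring_scope.

Definition is_part (n : nat) (s : seq nat) : bool :=
  [&& sorted geq s, 0%N \notin s & sumn s == n].

Definition part (n : nat) : finType :=
  {s : n.-bseq 'I_n.+1 | is_part n (map val s)}.

Definition parts (n : nat) (la : part n) : seq nat :=
  map val (val la : n.-bseq 'I_n.+1).

(* Cells are (row, column), both counted from 0, in English notation; a
   partition of n has at most n rows and n columns. *)
Definition cell (n : nat) (la : part n) : finType :=
  {c : 'I_n * 'I_n | c.2 < nth 0 (parts la) c.1}%N.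

Definition row_of (n : nat) (la : part n) (c : cell la) : 'I_n := (val c).1.
Definition col_of (n : nat) (la : part n) (c : cell la) : 'I_n := (val c).2.

(* Entries lie in 'I_N: the mathematical entry of c is (T c).+1. *)
Definition filling (N n : nat) (la : part n) := {ffun cell la -> 'I_N}.

Definition is_ssyt (N n : nat) (la : part n) (T : filling N la) : bool :=
  [forall c, forall d,
     ((row_of c == row_of d) && (col_of c < col_of d) ==> (T c <= T d))
     && ((col_of c == col_of d) && (row_of c < row_of d) ==> (T c < T d))]%N.

Definition is_syt (n : nat) (la : part n) (Q : filling n la) : bool :=
  [forall c, forall d,
     ((row_of c == row_of d) && (col_of c < col_of d) ==> (Q c < Q d))
     && ((col_of c == col_of d) && (row_of c < row_of d) ==> (Q c < Q d))]%N
  && injectiveb Q.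

(* d \in Des(Q), for entries counted from 1 as in the usual convention. *)
Definition des (n : nat) (la : part n) (Q : filling n la) (d : nat) : bool :=
  [exists c, exists c',
     [&& (Q c).+1 == d, (Q c').+1 == d.+1 & row_of c < row_of c']]%N.

(* The representative of m modulo k in {1, .., k}. *)
Definition repr1 (m k : nat) : nat := if (k %| m)%N then k else (m %% k)%N.

Definition maj_block (n : nat) (la : part n) (Q : filling n la)
    (nj kj : nat) : nat :=
  repr1 (\sum_(nj.+1 <= d < nj + kj | des Q d) (d - nj))%N kj.

Definition maj_seq (n : nat) (la : part n) (kappa : seq nat)
    (Q : filling n la) : seq nat :=
  mkseq (fun j => maj_block Q (sumn (take j kappa)) (nth 0%N kappa j))
        (size kappa).

Definition maj_count (n : nat) (la : part n) (kappa tau : seq nat) : nat :=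
  #|[set Q : filling n la | is_syt Q && (maj_seq kappa Q == tau)]|.

Definition schur (N n : nat) (la : part n) : {mpoly algC[N]} :=
  \sum_(T : filling N la | is_ssyt T) \prod_(c : cell la) 'X_(T c).

Section Specht.
Variables (n : nat) (la : part n).

(* A tableau with entries 'I_n, each occurring once, is encoded by the map
   sending an entry to the cell containing it. *)
Definition tableau : finType := {t : {ffun 'I_n -> cell la} | injectiveb t}.

Fact tabl_act_proof (t : tableau) (s : 'S_n) :
  injectiveb [ffun k => val t (s^-1%g k)].
Proof.
apply/injectiveP=> i j; rewrite !ffunE => e.
by apply: (@perm_inj _ s^-1%g); move/injectiveP: (valP t); apply.
Qed.

(* Replace every entry k of t by s k.  Since (s * u)%g is "s, then u", this is
   a right action of 'S_n, i.e. the usual left action for permutations composed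
   from right to left. *)
Definition tabl_act (t : tableau) (s : 'S_n) : tableau :=
  Sub [ffun k => val t (s^-1%g k)] (tabl_act_proof t s).

Lemma tabl_actE t s k : val (tabl_act t s) k = val t (s^-1%g k).
Proof. by rewrite ffunE. Qed.

Lemma tabl_actM t s u : tabl_act t (s * u)%g = tabl_act (tabl_act t s) u.
Proof. by apply/val_inj/ffunP=> k; rewrite !tabl_actE invMg permM. Qed.

(* The row-equivalence class of t, encoded by the row of each entry. *)
Definition rows_of (t : tableau) : {ffun 'I_n -> 'I_n} :=
  [ffun k => row_of (val t k)].

Definition tabloid : finType :=
  {f : {ffun 'I_n -> 'I_n} | [exists t, f == rows_of t]}.

Fact tabloid_of_proof (t : tableau) : [exists u, rows_of t == rows_of u].
Proof. by apply/existsP; exists t. Qed.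

Definition tabloid_of (t : tableau) : tabloid :=
  Sub (rows_of t) (tabloid_of_proof t).

Fact tabloid_act_proof (f : tabloid) (s : 'S_n) :
  [exists t, [ffun k => val f (s^-1%g k)] == rows_of t].
Proof.
have /existsP[t /eqP ft] := valP f; apply/existsP; exists (tabl_act t s).
by apply/eqP/ffunP=> k; rewrite !ffunE ft !ffunE.
Qed.

Definition tabloid_act (f : tabloid) (s : 'S_n) : tabloid :=
  Sub [ffun k => val f (s^-1%g k)] (tabloid_act_proof f s).

Lemma tabloid_actM f s u :
  tabloid_act f (s * u)%g = tabloid_act (tabloid_act f s) u.
Proof. by apply/val_inj/ffunP=> k; rewrite !ffunE invMg permM. Qed.

Lemma tabloid_act1 f : tabloid_act f 1%g = f.
Proof. by apply/val_inj/ffunP=> k; rewrite !ffunE invg1 perm1. Qed.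

Lemma tabloid_of_act t s :
  tabloid_of (tabl_act t s) = tabloid_act (tabloid_of t) s.
Proof. by apply/val_inj/ffunP=> k; rewrite !ffunE. Qed.

Definition tabloid_vec (f : tabloid) : 'rV[algC]_#|tabloid| :=
  delta_mx 0 (enum_rank f).

Definition tabloid_mx (s : 'S_n) : 'M[algC]_#|tabloid| :=
  \matrix_i tabloid_vec (tabloid_act (enum_val i) s).

Lemma tabloid_vecM f s :
  tabloid_vec f *m tabloid_mx s = tabloid_vec (tabloid_act f s).
Proof. by rewrite -rowE rowK enum_rankK. Qed.

Fact tabloid_mx_repr : mx_repr [set: 'S_n] tabloid_mx.
Proof.
split=> [|s u _ _]; apply/row_matrixP=> i.
  by rewrite rowK tabloid_act1 /tabloid_vec enum_valK rowE mulmx1.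
by rewrite row_mul !rowK tabloid_vecM tabloid_actM.
Qed.

(* The permutation module M^la on tabloids. *)
Definition tabloid_repr : mx_representation algC [set: 'S_n] #|tabloid| :=
  MxRepresentation tabloid_mx_repr.

Definition col_stab (t : tableau) (s : 'S_n) : bool :=
  [forall k, col_of (val t (s k)) == col_of (val t k)].

Definition polytabloid (t : tableau) : 'rV[algC]_#|tabloid| :=
  \sum_(s : 'S_n | col_stab t s)
     (-1) ^+ s *: tabloid_vec (tabloid_of (tabl_act t s)).

Lemma polytabloidM t s :
  polytabloid t *m tabloid_mx s = polytabloid (tabl_act t s).
Proof.
rewrite /polytabloid mulmx_suml.
rewrite [RHS](reindex_inj (@conjg_inj _ s)) /=.
have E u k : (s^-1 ((u ^ s) k) = u (s^-1 k))%g by rewrite /conjg !permM permK.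
apply: eq_big => [u|u _].
  apply/forallP/forallP=> h k; first by rewrite !tabl_actE E.
  by have := h (s k); rewrite !tabl_actE E permK.
rewrite -scalemxAl tabloid_vecM -tabloid_of_act odd_permJ -!tabl_actM.
by rewrite -conjgC.
Qed.

(* The row space of this matrix is the Specht module, the span of all
   polytabloids. *)
Definition specht_mx : 'M[algC]_#|tabloid| :=
  (\sum_(t : tableau) <<polytabloid t>>)%MS.

Fact specht_mxmodule : mxmodule tabloid_repr specht_mx.
Proof.
apply/mxmoduleP=> s _; rewrite /specht_mx sumsmxMr; apply/sumsmx_subP=> t _.
rewrite (eqmxMr _ (genmxE _)) /= polytabloidM.
by apply: (sumsmx_sup (tabl_act t s)); rewrite ?genmxE.
Qed.

Definition specht_repr := submod_repr specht_mxmodule.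

Definition specht_char : 'CF([set: 'S_n]) := cfRepr specht_repr.

End Specht.

(* The additive map with Ch S^la = s_la, on the character phi of a
   representation: '[phi, specht_char la] is the multiplicity of S^la.
   Symmetric functions are evaluated in N variables. *)
Definition Ch (N n : nat) (phi : 'CF([set: 'S_n])) : {mpoly algC[N]} :=
  \sum_(la : part n) '[phi, specht_char la] *: schur N la.

(* (0 1 .. a-1) *)
Definition cyc (a : nat) : 'S_a := perm (@ordS_inj a).

Lemma cycXE a k (j : 'I_a) : (cyc a ^+ k)%g j = ((j + k) %% a)%N :> nat.
Proof.
elim: k => [|k IHk]; first by rewrite expg0 perm1 addn0 modn_small.
by rewrite expgSr permM permE /= IHk -addn1 modnDml addn1 addnS.
Qed.

Lemma cycX_eq a k l : (0 < a)%N ->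
  (cyc a ^+ k == cyc a ^+ l)%g = (k == l %[mod a])%N.
Proof.
move=> a0; apply/eqP/eqP=> [/permP/(_ (Ordinal a0))/(congr1 val)|e].
  by rewrite /= !cycXE !add0n.
by apply/permP=> j; apply: val_inj; rewrite /= !cycXE -modnDmr e modnDmr.
Qed.

(* chi_a^r on <[cyc a]>, where the sum has exactly one term. *)
Definition cyc_chi (omega : algC) (a r : nat) (g : 'S_a) : algC :=
  \sum_(k < a | g == (cyc a ^+ k)%g) (omega ^+ r) ^+ k.

Lemma cyc_chiX omega a r k : (0 < a)%N -> omega ^+ a = 1 ->
  cyc_chi omega r (cyc a ^+ k)%g = (omega ^+ r) ^+ k.
Proof.
move=> a0 oa; rewrite /cyc_chi (big_pred1 (Ordinal (ltn_pmod k a0))) /=.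
  by rewrite [in RHS](divn_eq k a) exprD mulnC exprM [_ ^+ r ^+ a]exprAC oa
             !expr1n mul1r.
move=> l; rewrite cycX_eq // (modn_small (ltn_ord l)) eq_sym.
by [].
Qed.

Section Wreath.
Variables (a b : nat).

Definition wreath : finType := ({ffun 'I_b -> 'S_a} * 'S_b)%type.

Definition in_wreath (x : wreath) : bool :=
  [forall i, x.1 i \in <[cyc a]>%g].

(* (g, sigma) (h, tau) = ((g_i h_(sigma^-1 i))_i, sigma tau), all products on
   the right being composed from right to left, hence reversed here. *)
Definition wr_mul (x y : wreath) : wreath :=
  ([ffun i => (y.1 (x.2^-1%g i) * x.1 i)%g], (y.2 * x.2)%g).

Fact pos_proof (i : 'I_b) (j : 'I_a) : (i * a + j < a * b)%N.
Proof.
apply: (@leq_trans (i.+1 * a)%N); first by rewrite mulSn addnC ltn_add2r.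
by rewrite mulnC leq_mul2l ltn_ord orbT.
Qed.

(* The j-th point of the i-th interval of size a, counted from 0. *)
Definition pos (i : 'I_b) (j : 'I_a) : 'I_(a * b) := Ordinal (pos_proof i j).

Fact ord_a_gt0 (y : 'I_(a * b)) : (0 < a)%N.
Proof. by case: a y => [[]|]. Qed.

Fact blk_proof (y : 'I_(a * b)) : (y %/ a < b)%N.
Proof. by rewrite ltn_divLR ?(ord_a_gt0 y) // [(b * a)%N]mulnC. Qed.

Fact off_proof (y : 'I_(a * b)) : (y %% a < a)%N.
Proof. by rewrite ltn_mod (ord_a_gt0 y). Qed.

Definition blk (y : 'I_(a * b)) : 'I_b := Ordinal (blk_proof y).
Definition off (y : 'I_(a * b)) : 'I_a := Ordinal (off_proof y).

Lemma blk_pos i j : blk (pos i j) = i.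
Proof.
apply: val_inj => /=; have a0 : (0 < a)%N by apply: leq_ltn_trans (ltn_ord j).
by rewrite divnMDl // divn_small // addn0.
Qed.

Lemma off_pos i j : off (pos i j) = j.
Proof. by apply: val_inj; rewrite /= modnMDl modn_small. Qed.

Lemma posK y : pos (blk y) (off y) = y.
Proof. by apply: val_inj; rewrite /= -divn_eq. Qed.

Definition wr_fun (x : wreath) (y : 'I_(a * b)) : 'I_(a * b) :=
  pos (x.2 (blk y)) (x.1 (x.2 (blk y)) (off y)).

Fact wr_fun_inj x : injective (wr_fun x).
Proof.
move=> y z e; have eb : blk y = blk z.
  by apply: (@perm_inj _ x.2); move/(congr1 blk): e; rewrite !blk_pos.
have eo : off y = off z.
  by apply: (@perm_inj _ (x.1 (x.2 (blk y))));
     move/(congr1 off): e; rewrite !off_pos eb.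
by rewrite -(posK y) eb eo posK.
Qed.

Definition wr_embed (x : wreath) : 'S_(a * b) := perm (@wr_fun_inj x).

Lemma wr_embedE x i j : wr_embed x (pos i j) = pos (x.2 i) (x.1 (x.2 i) j).
Proof. by rewrite permE /wr_fun blk_pos off_pos. Qed.

Lemma wr_embedM x y : wr_embed (wr_mul x y) = (wr_embed y * wr_embed x)%g.
Proof.
apply/permP=> z; rewrite -(posK z) permM !wr_embedE /= ffunE !permM.
by rewrite permK.
Qed.

Lemma wr_embed_inj : (0 < a)%N -> injective wr_embed.
Proof.
move=> a0 [g s] [h t] e.
have E i j : pos (s i) (g (s i) j) = pos (t i) (h (t i) j).
  by have /permP/(_ (pos i j)) := e; rewrite !wr_embedE.
have st : s = t.
  apply/permP=> i; have := congr1 blk (E i (Ordinal a0)).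
  by rewrite !blk_pos.
congr (_, _) => //; apply/ffunP=> i; apply/permP=> j.
have := congr1 off (E (s^-1%g i) j); rewrite !off_pos.
by rewrite -st permKV.
Qed.

Lemma in_wreathM x y : in_wreath x -> in_wreath y -> in_wreath (wr_mul x y).
Proof.
by move=> /forallP hx /forallP hy; apply/forallP=> i; rewrite ffunE groupM.
Qed.

Definition wr_set : {set 'S_(a * b)} := wr_embed @: [set x | in_wreath x].

Fact wr_group_set : group_set wr_set.
Proof.
apply/group_setP; split.
  apply/imsetP; exists ([ffun=> 1%g], 1%g).
    by rewrite inE; apply/forallP=> i; rewrite ffunE group1.
  by apply/permP=> z; rewrite -(posK z) wr_embedE /= ffunE !perm1.
move=> _ _ /imsetP[x hx ->] /imsetP[y hy ->]; rewrite -wr_embedM.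
by apply: imset_f; move: hx hy; rewrite !inE => hx hy; apply: in_wreathM.
Qed.

Definition wr_group : {group 'S_(a * b)} := Group wr_group_set.

(* chi^{r,1} for eps = false and chi^{r,epsilon} for eps = true. *)
Definition wr_chi (omega : algC) (r : nat) (eps : bool) (x : wreath) : algC :=
  (if eps then (-1) ^+ x.2 else 1) * \prod_i cyc_chi omega r (x.1 i).

(* wr_chi transported along wr_embed; the sum has exactly one term. *)
Definition wr_mx (omega : algC) (r : nat) (eps : bool) (w : 'S_(a * b)) :
    'M[algC]_1 :=
  (\sum_(x : wreath | in_wreath x && (wr_embed x == w)) wr_chi omega r eps x)%:M.

Lemma wr_mxE omega r eps x : (0 < a)%N -> in_wreath x ->
  wr_mx omega r eps (wr_embed x) = (wr_chi omega r eps x)%:M.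
Proof.
move=> a0 hx; rewrite /wr_mx (big_pred1 x) // => y.
by apply/andP/eqP=> [[_ /eqP/wr_embed_inj->]|->].
Qed.

Lemma cyc_chiM omega r (g h : 'S_a) : (0 < a)%N -> omega ^+ a = 1 ->
  g \in <[cyc a]>%g -> h \in <[cyc a]>%g ->
  cyc_chi omega r (g * h)%g = cyc_chi omega r g * cyc_chi omega r h.
Proof.
move=> a0 oa /cycleP[k ->] /cycleP[l ->].
by rewrite -expgD !cyc_chiX // exprD.
Qed.

Lemma wr_chiM omega r eps x y : (0 < a)%N -> omega ^+ a = 1 ->
  in_wreath x -> in_wreath y ->
  wr_chi omega r eps (wr_mul x y) = wr_chi omega r eps x * wr_chi omega r eps y.
Proof.
move=> a0 oa /forallP hx /forallP hy; rewrite /wr_chi mulrACA; congr (_ * _).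
  by case: eps; rewrite ?mulr1 //= odd_permM signr_addb mulrC.
rewrite [X in _ * X](reindex_inj (@perm_inj _ x.2^-1%g)) -big_split /=.
by apply: eq_bigr => i _; rewrite ffunE cyc_chiM // mulrC.
Qed.

Fact wr_mx_repr omega r eps : (0 < a)%N -> omega ^+ a = 1 ->
  mx_repr wr_group (wr_mx omega r eps).
Proof.
move=> a0 oa; split.
  have h1 : in_wreath ([ffun=> 1%g], 1%g).
    by apply/forallP=> i; rewrite ffunE group1.
  have -> : 1%g = wr_embed ([ffun=> 1%g], 1%g).
    by apply/permP=> z; rewrite -(posK z) wr_embedE /= ffunE !perm1.
  rewrite wr_mxE // /wr_chi /= odd_perm1 expr0 if_same mul1r.
  rewrite big1 // => i _; rewrite ffunE.
  by rewrite -(expg0 (cyc a)) cyc_chiX.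
move=> _ _ /imsetP[x + ->] /imsetP[y + ->]; rewrite !inE => hx hy.
rewrite -wr_embedM !wr_mxE ?in_wreathM // wr_chiM // -scalar_mxM mulrC.
by [].
Qed.

Section OneDim.
Variables (omega : algC) (r : nat) (eps : bool).
Hypotheses (a_gt0 : (0 < a)%N) (prim : a.-primitive_root omega).

Definition wr_repr : mx_representation algC wr_group 1 :=
  MxRepresentation (wr_mx_repr r eps a_gt0 (prim_expr_order prim)).

(* The character of the induced representation L_(a^b)^{r,1} (eps = false),
   resp. L_(a^b)^{r,epsilon} (eps = true). *)
Definition L_char : 'CF([set: 'S_(a * b)]) := 'Ind (cfRepr wr_repr).

End OneDim.
End Wreath.

Definition mobius (n : nat) : int :=
  if all (fun p => logn p n == 1%N) (primes n)
  then (-1) ^+ size (primes n) else 0.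

Definition mu_num (f d e : nat) : int :=
  \sum_(g <- divisors e | (lcmn f d %| g)%N) mobius (g %/ f).

Definition mu_seq (f d e : seq nat) : int :=
  \prod_(j < size f) mu_num (nth 0%N f j) (nth 0%N d j) (nth 0%N e j).

Definition star (c : nat) (nu : seq nat) : seq nat := [seq (c * p)%N | p <- nu].

Definition z_part (nu : seq nat) : nat :=
  (\prod_(1 <= i < (sumn nu).+1) (i ^ count_mem i nu * (count_mem i nu)`!))%N.

(* All tau with tau | rho, for rho a sequence of positive integers. *)
Fixpoint divseqs (rho : seq nat) : seq (seq nat) :=
  if rho is m :: rho' then [seq d :: t | d <- divisors m, t <- divseqs rho']
  else [:: [::]].

Lemma mem_divseqs rho tau : 0%N \notin rho ->
  (tau \in divseqs rho) = all2 dvdn tau rho.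
Proof.
elim: rho tau => [|m rho IH] [|d t] //=.
  by move=> _; apply/negbTE/negP=> /allpairsP[[? ?] [_ _]].
rewrite inE negb_or eq_sym -lt0n => /andP[m0 r0].
rewrite -IH //; apply/allpairsP/andP=> [[[d' t'] /= [hd ht [-> ->]]]|[hd ht]].
  by rewrite dvdn_divisors.
by exists (d, t); split=> //=; rewrite -dvdn_divisors.
Qed.

Lemma divseqs_uniq rho : uniq (divseqs rho).
Proof.
elim: rho => //= m rho IH; apply: allpairs_uniq => //.
  exact: divisors_uniq.
by move=> [d t] [d' t'] _ _ /= [-> ->].
Qed.

(* Main.v *)
(** Everything is expressed through words: with n = ab letters, alt v w is the
    sign of the permutation s such that content(w) + s.rho = v (and 0 if there is
    none), and v = lambda + rho.

    - A sign-reversing involution (Pieri rule), applied to one block of the ascent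
      set at a time, shows that summing alt over words with prescribed ascent set
      counts the ballot words of content lambda with that ascent set, that is, the
      standard tableaux of shape lambda with that descent set.
    - The character of S^lambda at g is the sum of alt over the words fixed by g:
      this virtual character psi (Jacobi-Trudi) has norm 1, by Burnside counting of
      biwords.  The sign character of a column stabiliser occurs once in the
      permutation character on words of content lambda and in none of the other
      terms of psi, which forces the Specht character to be irreducible and to
      pair to 1 with psi.  The sum of the letters replaces the dominance order.
    - Frobenius reciprocity then writes the multiplicity of S^lambda as a linear
      functional applied to the generating function of pairs (element of the wreath
      product, fixed word).  This is a sum over 'S_b of traces of products of a
      kernel on words of length a, hence a cycle index: a sum over nu of 1/z_nu
      times a product over the parts m of nu of
      (1/a) sum_(k < a) omega^(rk) p_(am/g)^g, with g = gcd(a, k).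
    - For z a primitive d-th root of unity, the sum of z^maj x^w over words of
      length d is the power sum p_d, by cyclic rotation.  Fourier and Moebius
      inversion turn each factor into the mu-weighted sum over the words of
      length am with given major index modulo am. *)

Require Import Defs.
From HB Require Import structures.
From mathcomp Require Import all_boot all_order all_algebra all_fingroup.
From mathcomp Require Import all_solvable all_field all_character.
From mathcomp Require Import mpoly.

Set Implicit Arguments.
Unset Strict Implicit.
Unset Printing Implicit Defensive.

Import Order.TTheory GRing.Theory Num.Theory.
Local Open Scope ring_scope.

(** * Alternating sums over words with bounded ascent set *)

(** For v = lambda + rho, [alt v] gives the values on monomials of the functional sending p to the
    coefficient of x^v in a_rho p, where a_rho is the Vandermonde alternant. On symmetric p it reads
    off the coefficient of the Schur function of lambda. Letters double as row indices, so n letters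
    serve all partitions of n, whatever the number of variables of [schur]. The words with ascents
    inside a set D are generated by a product of complete symmetric functions, and Pieri's rule
    removes one factor at a time. An exact ascent set gives no such product, hence the detour
    through subsets followed by a triangular inversion. Ascents of words stand for descents of
    tableaux because the word of a tableau lists row indices, which grow downwards. The sum over
    'S_b is evaluated without cycle types: a marked point absorbs its cycle one point at a time,
    which yields the recursion satisfied by the cycle index. *)

Definition asc (w : seq nat) (d : nat) : bool :=
  [&& 0 < d, d < size w & nth 0 w d.-1 < nth 0 w d]%N.

Definition asc_sub (D : pred nat) (w : seq nat) : bool :=
  all (fun d => asc w d ==> D d) (iota 0 (size w)).

Lemma asc_subP (D : pred nat) w :
  reflect (forall d, asc w d -> D d) (asc_sub D w).
Proof.
apply: (iffP allP) => [h d ad | h d _]; last exact/implyP/h.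
apply: (implyP (h d _)) => //; rewrite mem_iota add0n leq0n /=.
by case/and3P: ad.
Qed.

Lemma nth_catD (u y : seq nat) k : nth 0%N (u ++ y) (size u + k) = nth 0%N y k.
Proof. by rewrite nth_cat ltnNge leq_addr addKn. Qed.

(** The border position [size u] lies in D, so it imposes nothing; inside y every ascent is
    forbidden, which means that y is weakly decreasing. *)
Lemma asc_sub_cat (D : pred nat) (u y : seq nat) :
  (size u == 0)%N || D (size u) ->
  (forall d, size u < d < size u + size y -> ~~ D d)%N ->
  asc_sub D (u ++ y) = asc_sub D u && sorted geq y.
Proof.
move=> Du Dn; apply/asc_subP/andP=> [h | [hu hy] d].
  split.
    apply/asc_subP=> d /and3P[d0 du a]; apply: h; rewrite /asc d0 size_cat.
    rewrite !nth_cat du (leq_ltn_trans (leq_pred d) du) a andbT.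
    by rewrite ltn_addr.
  apply/(sortedP 0%N) => i iy; rewrite /geq /= leqNgt; apply/negP=> lt.
  have /Dn/negP : (size u < size u + i.+1 < size u + size y)%N.
    by rewrite ltn_add2l iy addnS ltnS leq_addr.
  apply; apply: h; rewrite addnS /asc size_cat -addnS ltn_add2l iy addnS /=.
  by rewrite -addnS !nth_catD lt.
rewrite /asc size_cat => /and3P[d0 dn].
case: (ltngtP d (size u)) => [du|du|e].
- rewrite !nth_cat du (leq_ltn_trans (leq_pred d) du) => a.
  by apply: (asc_subP _ _ hu); rewrite /asc d0 du.
- have [k ek] : exists k, d = (size u + k.+1)%N.
    by exists (d - (size u).+1)%N; rewrite -addSnnS subnKC.
  move: dn; rewrite ek addnS /= -addnS ltn_add2l !nth_catD => dn.
  by move/(sortedP 0%N)/(_ _ dn): hy; rewrite /geq /= leqNgt => /negP.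
by move=> _; move: Du; rewrite -e => /orP[/eqP d00|//]; rewrite d00 in d0.
Qed.

(** m is the largest element of D below n, or 0 if there is none. *)
Lemma last_block (D : pred nat) (n : nat) : (0 < n)%N ->
  exists m k, [/\ n = m + k, 0 < k, (m == 0) || D m
    & forall d, m < d < m + k -> ~~ D d]%N.
Proof.
elim: n => // n IH _.
have [Dn|nD] := boolP (D n); first exists n, 1%N.
  rewrite Dn orbT addn1; split=> // d /andP[h1 h2].
  by move: (leq_trans h1 h2); rewrite ltnn.
have [n0|/IH[m [k [e k0 Dm Dk]]]] := posnP n.
  by exists 0%N, 1%N; rewrite n0; split=> // d; case: d.
exists m, k.+1; rewrite addnS -e; split=> // d.
rewrite ltnS andbC leq_eqVlt => /andP[/orP[/eqP->//|h1] h2].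
by apply: Dk; rewrite h2 -e.
Qed.

Lemma big_tuple_cat (R : Type) (idx : R) (op : Monoid.com_law idx) (T : finType)
    m k (P : pred (seq T)) (F : seq T -> R) :
  \big[op/idx]_(w : (m + k).-tuple T | P w) F w =
  \big[op/idx]_(x : m.-tuple T) \big[op/idx]_(y : k.-tuple T | P (x ++ y)) F (x ++ y).
Proof.
pose h (p : m.-tuple T * k.-tuple T) := cat_tuple p.1 p.2.
have s1 (w : (m + k).-tuple T) : size (take m w) == m.
  by rewrite size_takel // size_tuple leq_addr.
have s2 (w : (m + k).-tuple T) : size (drop m w) == k.
  by rewrite size_drop size_tuple addKn.
rewrite pair_big_dep /= (reindex h) //.
exists (fun w => (Tuple (s1 w), Tuple (s2 w))) => [[x y] _|w _] /=.
  by congr (_, _); apply: val_inj; rewrite /= ?take_size_cat ?drop_size_cat ?size_tuple.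
by apply: val_inj; rewrite /= cat_take_drop.
Qed.

Lemma sum_ind (R : pzRingType) (I : finType) (P : pred I) (F : I -> R) :
  \sum_(i | P i) F i = \sum_i (P i)%:R * F i.
Proof. by rewrite big_mkcond; apply: eq_bigr => i _; rewrite mulr_natl mulrb. Qed.

Section Pieri.

Variable l : nat.
Implicit Types (w y : seq 'I_l) (s t : 'S_l) (i j : 'I_l).

Definition rho i : nat := (l - i.+1)%N.

Lemma rho_inj : injective rho.
Proof.
move=> i j; rewrite /rho => e; apply: val_inj; apply: succn_inj.
by rewrite -(subKn (ltn_ord i)) -(subKn (ltn_ord j)) e.
Qed.

Lemma ltn_rho i j : (i < j)%N -> (rho j < rho i)%N.
Proof. by move=> ij; rewrite /rho ltn_sub2l // (leq_ltn_trans _ (ltn_ord j)). Qed.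

(* The sign of the unique s, if any, with content w + s.rho = v. *)
Definition alt (v : 'I_l -> nat) w : algC :=
  \sum_(s : 'S_l | [forall i, count_mem i w + rho (s i) == v i]%N) (-1) ^+ s.

Lemma alt_perm v w w' : perm_eq w w' -> alt v w = alt v w'.
Proof.
move=> /seq.permP e; apply: eq_bigl => s; by apply: eq_forallb => i; rewrite e.
Qed.

(** The pointwise premise on v' stands in for function extensionality. *)
Definition antisym (F : ('I_l -> nat) -> algC) :=
  forall (v v' : 'I_l -> nat) t, (forall i, v' i = v (t i)) ->
    F v' = (-1) ^+ t * F v.

Lemma alt_nil_antisym : antisym (fun v => alt v [::]).
Proof.
move=> v v' t e; rewrite /alt big_distrr (reindex_inj (mulgI t)) /=.
apply: eq_big => [s|s _]; last by rewrite odd_permM signr_addb.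
apply/forallP/forallP=> h i; last by rewrite e permM.
by have := h (t^-1%g i); rewrite permM e permKV.
Qed.

Definition geo i j : bool := (j <= i)%N.

Lemma sorted_geo y : sorted geo y = sorted geq (map val y).
Proof. by rewrite sorted_map. Qed.

Lemma geo_trans : transitive geo.
Proof. by move=> i j k h1 h2; apply: leq_trans h2 h1. Qed.

Lemma geo_anti : antisymmetric geo.
Proof. by move=> i j; rewrite /geo andbC => /anti_leq/val_inj. Qed.

Lemma geo_total : total geo.
Proof. by move=> i j; rewrite /geo leq_total. Qed.

Lemma sum_count w : (\sum_i count_mem i w = size w)%N.
Proof.
elim: w => [|x w IH] /=; first by rewrite big1.
rewrite big_split /= IH -[RHS]add1n; congr (_ + _)%N.
rewrite (bigD1 x) //= eqxx big1 ?addn0 // => i; by rewrite eq_sym => /negPf->.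
Qed.

Lemma eq_count_perm w w' : (forall i, count_mem i w = count_mem i w') -> perm_eq w w'.
Proof. by move=> e; apply/allP=> i _ /=; rewrite e. Qed.

(** A content has exactly one weakly decreasing arrangement; its length is the total of c. *)
Lemma card_sorted_content (c : 'I_l -> nat) k :
  #|[pred y : k.-tuple 'I_l | sorted geo y & [forall i, count_mem i y == c i]]|
    = (\sum_i c i == k)%N.
Proof.
have [e|ne] := eqVneq; last first.
  apply: eq_card0 => y; rewrite !inE; apply/negP=> /andP[_ /forallP h].
  move/negP: ne; apply; rewrite -(size_tuple y) -sum_count; apply/eqP.
  by apply: eq_bigr => i _; rewrite (eqP (h i)).
pose y0 := sort geo (flatten [seq nseq (c i) i | i <- enum 'I_l]).
have cy0 i : count_mem i y0 = c i.
  rewrite count_sort count_flatten -map_comp sumnE big_map big_enum /=.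
  rewrite (bigD1 i) //= big1 ?addn0 ?count_nseq /= ?eqxx ?mul1n // => j ji.
  by rewrite count_nseq /= (negPf ji).
have sy0 : size y0 == k by rewrite -sum_count -e; apply/eqP/eq_bigr.
apply: (@eq_card1 _ (Tuple sy0)) => y; rewrite !inE.
apply/andP/eqP=> [[ys /forallP h]|->]; last first.
  split; first exact: (sort_sorted geo_total).
  by apply/forallP=> i /=; rewrite cy0.
apply: val_inj; apply: (sorted_eq geo_trans geo_anti) => //.
  exact: (sort_sorted geo_total).
by apply: eq_count_perm => i /=; rewrite cy0 (eqP (h i)).
Qed.

(** With u = kappa + rho, v = lambda + rho and u <= v, this says lambda_(i+1) <= kappa_i: the skew
    shape lambda/kappa is a horizontal strip. *)
Definition interlace (u v : 'I_l -> nat) : bool :=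
  [forall i : 'I_l, forall j : 'I_l, (j == i.+1 :> nat) ==> (v j < u i)]%N.

Section Cancel.
Variables (M : nat) (v : 'I_l -> nat) (F : ('I_l -> nat) -> algC).
Hypothesis v_dec : forall i j, (i < j)%N -> (v j <= v i)%N.
Hypothesis F_anti : antisym F.
Implicit Types (u : {ffun 'I_l -> 'I_M}) (p : 'I_l * 'I_l).

(** p = (i, i+1) is the first adjacent pair violating [interlace]. Minimality makes the pair unique,
    so that the involution finds it again after the swap. *)
Let clash u p :=
  [&& p.2 == p.1.+1 :> nat, u p.1 <= v p.2 &
    [forall i : 'I_l, forall j : 'I_l, (i < p.1) && (j == i.+1 :> nat) ==> (v j < u i)]]%N.

Let swap p u : {ffun 'I_l -> 'I_M} := [ffun i => u (tperm p.1 p.2 i)].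

Let flip u := if [pick p | clash u p] is Some p then swap p u else u.

Let clash_uniq u p q : clash u p -> clash u q -> p = q.
Proof.
case: p q => [i i'] [j j'] /and3P[/= /eqP ei ui /forallP hi].
case/and3P=> /= /eqP ej uj /forallP hj.
have ij : i = j.
  apply: val_inj; case: (ltngtP i j) => // lt.
    by have /forallP/(_ i') := hj i; rewrite lt ei eqxx ltnNge ui.
  by have /forallP/(_ j') := hi j; rewrite lt ej eqxx ltnNge uj.
by congr (_, _) => //; apply: val_inj; rewrite /= ei ej ij.
Qed.

Let le_v u := [forall i : 'I_l, u i <= v i]%N.

Let tperm_off p i : p.2 = p.1.+1 :> nat -> (i < p.1)%N -> tperm p.1 p.2 i = i.
Proof.
move=> e lt; rewrite tpermD // eq_sym -val_eqE; first by rewrite ltn_eqF.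
by rewrite ltn_eqF //= e ltnW.
Qed.

(** Both u_i and u_(i+1) are at most v_(i+1) <= v_i, so the swap preserves u <= v and the violation
    at i. The conditions at earlier indices involve only untouched values of u. *)
Let swap_clash u p : le_v u -> clash u p -> clash (swap p u) p && le_v (swap p u).
Proof.
move=> /forallP uv /and3P[/eqP e up /forallP hp].
have lt12 : (p.1 < p.2)%N by rewrite e.
apply/andP; split.
  apply/and3P; rewrite e ffunE tpermL uv; split=> //.
  apply/forallP=> i; apply/forallP=> j; apply/implyP=> ij; rewrite ffunE tperm_off //.
    by have /forallP/(_ j)/implyP := hp i; apply.
  by case/andP: ij.
apply/forallP=> i; rewrite ffunE; case: tpermP => [->|->|] //.
by apply: leq_trans (uv _) (v_dec lt12).
Qed.

Let swapK p : involutive (swap p).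
Proof. by move=> u; apply/ffunP=> i; rewrite !ffunE tpermK. Qed.

Let flip_clash u p : clash u p -> flip u = swap p u.
Proof.
move=> cp; rewrite /flip; case: pickP => [q cq|/(_ p)]; last by rewrite cp.
by rewrite (clash_uniq cp cq).
Qed.

Let interlace_clash u : ~~ interlace (fun i => u i) v -> exists p, clash u p.
Proof.
rewrite negb_forall => /existsP[i0 h0].
have ex : exists i : nat, [exists k : 'I_l, (k == i :> nat) &&
    ~~ [forall j : 'I_l, (j == k.+1 :> nat) ==> (v j < u k)%N]].
  by exists i0; apply/existsP; exists i0; rewrite eqxx.
case/ex_minnP: ex => i /existsP[k /andP[/eqP <-]].
rewrite negb_forall => /existsP[j]; rewrite negb_imply -leqNgt => /andP[jk le] mn.
exists (k, j); rewrite /clash /= jk le /=.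
apply/forallP=> i1; apply/forallP=> j1; apply/implyP=> /andP[lt j1e].
apply/negPn/negP=> nlt; move: lt; rewrite ltnNge => /negP; apply.
apply: mn; apply/existsP; exists i1; rewrite eqxx negb_forall.
by apply/existsP; exists j1; rewrite negb_imply j1e nlt.
Qed.

Let clash_interlace u p : clash u p -> ~~ interlace (fun i => u i) v.
Proof.
case/and3P=> e le _; rewrite negb_forall; apply/existsP; exists p.1.
by rewrite negb_forall; apply/existsP; exists p.2; rewrite negb_imply e -leqNgt.
Qed.

(** [flip] is an involution on the u that do not interlace and changes the sign of F, so their sum
    equals its opposite. This also covers the fixed points u_i = u_(i+1). *)
Lemma sum_interlace k :
  \sum_(u | le_v u && (\sum_i u i + k == \sum_i v i)%N) F (fun i => u i) =
  \sum_(u | [&& le_v u, (\sum_i u i + k == \sum_i v i)%N & interlace (fun i => u i) v]) F (fun i => u i).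
Proof.
rewrite (bigID (fun u => interlace (fun i => u i) v)) /=.
set good := (X in X + _ = _); set bad := (X in _ + X = _).
suff -> : bad = 0 by rewrite addr0; apply: eq_bigl => u; rewrite andbA.
pose P u := [&& le_v u, (\sum_i u i + k == \sum_i v i)%N & ~~ interlace (fun i => u i) v].
have Pflip u : P u -> [/\ P (flip u), flip (flip u) = u & F (fun i => flip u i) = - F (fun i => u i)].
  case/and3P=> uv us /interlace_clash[p cp]; rewrite (flip_clash cp).
  have /andP[cp' uv'] := swap_clash uv cp.
  rewrite (flip_clash cp') swapK; split=> //.
    apply/and3P; split=> //; last exact: clash_interlace cp'.
    rewrite -(eqP us) (reindex_inj (@perm_inj _ (tperm p.1 p.2))) /=.
    by apply/eqP; congr (_ + _)%N; apply: eq_bigr => i _; rewrite ffunE tpermK.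
  rewrite (F_anti (v := fun i => u i) (t := tperm p.1 p.2)) => [|i]; last by rewrite ffunE.
  rewrite odd_tperm -val_eqE /= (_ : _ != _) ?expr1 ?mulN1r //.
  by case/and3P: cp => /eqP-> _ _; rewrite neq_ltn ltnSn.
have badP : bad = \sum_(u | P u) F (fun i => u i) by apply: eq_bigl => u; rewrite -andbA.
have : bad = - bad.
  rewrite badP {1}(reindex_onto flip flip) => [|u /Pflip[] //].
  rewrite -sumrN; apply: eq_big => [u|u /andP[Pfu /eqP e]].
    apply/andP/idP=> [[/Pflip[+ _ _] /eqP e]|/Pflip[-> -> _] //].
    by rewrite e.
  by have [] := Pflip u; rewrite // -e; case: (Pflip _ Pfu).
by move/eqP; rewrite eq_sym eqNr => /eqP.
Qed.

End Cancel.

Definition altsum n (D : pred nat) (v : 'I_l -> nat) : algC :=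
  \sum_(w : n.-tuple 'I_l | asc_sub D (map val w)) alt v w.

Definition block (D : pred nat) m k : Prop :=
  ((m == 0) || D m)%N /\ (forall d, m < d < m + k -> ~~ D d)%N.

Lemma asc_sub_block (D : pred nat) m k (x : m.-tuple 'I_l) (y : k.-tuple 'I_l) :
  block D m k ->
  asc_sub D (map val (x ++ y)) = asc_sub D (map val x) && sorted (@geo) y.
Proof.
case=> Dm Dk; rewrite map_cat asc_sub_cat ?size_map ?size_tuple //.
by rewrite sorted_geo.
Qed.

(** Appending y subtracts its content from v. At most one u contributes; the condition u <= v
    excludes the values produced by truncated subtraction, and M only makes the range of u
    finite. *)
Lemma alt_cat M (v : 'I_l -> nat) (x y : seq 'I_l) : (forall i, v i < M)%N ->
  alt v (x ++ y) = \sum_(u : {ffun 'I_l -> 'I_M} |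
     [forall i, count_mem i y == v i - u i]%N && [forall i, u i <= v i]%N)
     alt (fun i => u i) x.
Proof.
move=> vM; have [/forallP le|] := boolP [forall i, count_mem i y <= v i]%N.
  have bd i : (v i - count_mem i y < M)%N.
    by apply: leq_ltn_trans (leq_subr _ _) (vM i).
  rewrite (big_pred1 [ffun i => Ordinal (bd i)]) => [|u].
    apply: eq_bigl => s; apply: eq_forallb => i; rewrite ffunE /= count_cat.
    by rewrite addnAC -[in LHS](subnK (le i)) eqn_add2r.
  apply/andP/eqP=> [[/forallP h1 /forallP h2]|->].
    apply/ffunP=> i; apply: val_inj; rewrite ffunE /=.
    by rewrite (eqP (h1 i)) subKn.
  by split; apply/forallP=> i; rewrite ffunE /= ?leq_subr ?subKn.
rewrite negb_forall => /existsP[i]; rewrite -ltnNge => lt.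
rewrite [RHS]big_pred0 => [|u]; last first.
  apply/negP=> /andP[/forallP/(_ i)/eqP e _].
  by move: lt; rewrite e ltnNge leq_subr.
rewrite /alt big_pred0 // => s; apply/negP=> /forallP/(_ i)/eqP e.
by move: lt; rewrite -e count_cat addnAC ltnNge leq_addl.
Qed.

Lemma sum_sorted_content k (u v : 'I_l -> nat) :
  \sum_(y : k.-tuple 'I_l)
    (sorted (@geo) y && ([forall i, count_mem i y == v i - u i]%N &&
       [forall i, u i <= v i]%N))%:R =
  ([forall i, u i <= v i]%N && (\sum_i u i + k == \sum_i v i)%N)%:R :> algC.
Proof.
have [/forallP le|_] := boolP [forall i, u i <= v i]%N; last first.
  by rewrite big1 // => y _; rewrite !andbF.
rewrite -natr_sum; congr _%:R.
transitivity (#|[pred y : k.-tuple 'I_l | sorted (@geo) y &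
    [forall i, count_mem i y == v i - u i]%N]|).
  rewrite -sum1_card [RHS]big_mkcond; apply: eq_bigr => y _.
  by rewrite inE andbT; case: (_ && _).
rewrite card_sorted_content /= sumnB //.
have le' : (\sum_i u i <= \sum_i v i)%N by apply: leq_sum.
by rewrite -(eqn_add2l (\sum_i u i)%N) subnKC // eq_sym.
Qed.

(** The last block is an arbitrary weakly decreasing word of length k, so it acts as multiplication
    by the complete symmetric function h_k. *)
Lemma altsum_rec M (D : pred nat) m k v : (forall i, v i < M)%N -> block D m k ->
  altsum (m + k) D v = \sum_(u : {ffun 'I_l -> 'I_M} |
     [forall i : 'I_l, u i <= v i]%N && (\sum_i u i + k == \sum_i v i)%N)
       altsum m D (fun i => u i).
Proof.
move=> vM blk; rewrite /altsum.
rewrite (big_tuple_cat _ m k (fun w => asc_sub D (map val w)) (alt v)) /=.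
transitivity (\sum_(u : {ffun 'I_l -> 'I_M}) \sum_(x : m.-tuple 'I_l) \sum_(y : k.-tuple 'I_l)
    ((sorted (@geo) y && ([forall i, count_mem i y == v i - u i]%N &&
       [forall i, u i <= v i]%N)))%:R * ((asc_sub D (map val x))%:R * alt (fun i => u i) x)).
  rewrite exchange_big; apply: eq_bigr => x _ /=.
  rewrite exchange_big sum_ind; apply: eq_bigr => y _ /=.
  rewrite (alt_cat _ _ vM) sum_ind asc_sub_block // big_distrr; apply: eq_bigr => u _ /=.
  rewrite !mulrA -!natrM !mulnb; congr (_%:R * _); congr nat_of_bool.
  by rewrite [RHS]andbC !andbA.
rewrite [RHS]sum_ind; apply: eq_bigr => u _; rewrite big_distrr [RHS]sum_ind /=.
apply: eq_bigr => x _; rewrite -big_distrl /= sum_sorted_content.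
by rewrite mulrCA.
Qed.

Lemma altsum0 (D : pred nat) v : altsum 0 D v = alt v [::].
Proof. by rewrite /altsum (big_pred1 [tuple]) // => w; rewrite (tuple0 w) /= eqxx. Qed.

(** Relabelling letters does not preserve ascents, so the words cannot be permuted directly. The
    recursion over blocks is symmetric in the coordinates and carries the sign down to the empty
    word. *)
Lemma altsum_antisym n (D : pred nat) : antisym (altsum n D).
Proof.
elim/ltn_ind: n => n IH v v' t e.
have [->|/(last_block D)[m [k [en k0 Dm Dk]]]] := posnP n.
  rewrite !altsum0; exact: alt_nil_antisym.
have blk : block D m k by split.
pose M := (\sum_i v i).+1.
have vM i : (v i < M)%N by rewrite ltnS (bigD1 i) //= leq_addr.
have v'M i : (v' i < M)%N by rewrite e.
rewrite en !(@altsum_rec M) // big_distrr /=.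
pose h (u : {ffun 'I_l -> 'I_M}) := [ffun i => u (t i)].
rewrite (reindex h) /=; last first.
  exists (fun u : {ffun 'I_l -> 'I_M} => [ffun i => u (t^-1%g i)]) => u _.
    by apply/ffunP=> i; rewrite !ffunE permKV.
  by apply/ffunP=> i; rewrite !ffunE permK.
apply: eq_big => [u|u _]; last first.
  by apply: IH => [|i]; rewrite ?ffunE // en -[X in (X < _)%N]addn0 ltn_add2l.
congr (_ && _).
  apply/forallP/forallP=> h1 i; last by rewrite ffunE e.
  by have := h1 (t^-1%g i); rewrite ffunE e permKV.
rewrite [in RHS](reindex_inj (@perm_inj _ t)) [X in _ = (_ == X)](reindex_inj (@perm_inj _ t)) /=.
congr (_ + _ == _)%N; first by apply: eq_bigr => i _; rewrite ffunE.
by apply: eq_bigr => i _; rewrite e.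
Qed.

Definition ballot (w : seq 'I_l) : bool :=
  [forall k : 'I_(size w).+1, forall i : 'I_l, forall j : 'I_l,
     (i < j) ==> (count_mem j (take k w) <= count_mem i (take k w))]%N.

Definition fits (v : 'I_l -> nat) (w : seq 'I_l) : bool :=
  ballot w && [forall i, count_mem i w + rho i == v i]%N.

Lemma ballotP w :
  reflect (forall k i j, (i < j)%N -> (count_mem j (take k w) <= count_mem i (take k w))%N)
          (ballot w).
Proof.
apply: (iffP forallP) => [h k i j ij|h k]; last first.
  by apply/forallP=> i; apply/forallP=> j; apply/implyP/h.
have [kw|wk] := leqP k (size w).
  by have /forallP/(_ i)/forallP/(_ j)/implyP/(_ ij) := h (Ordinal (kw : (k < (size w).+1)%N)).
rewrite (take_oversize (ltnW wk)).
by have /forallP/(_ i)/forallP/(_ j)/implyP/(_ ij) := h ord_max; rewrite take_size.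
Qed.

Lemma adjacent_geq (c : 'I_l -> nat) :
  (forall i j, j = i.+1 :> nat -> c j <= c i)%N ->
  forall i j, (i < j)%N -> (c j <= c i)%N.
Proof.
move=> h i j; have [m] := ubnP j; elim: m j => // m IH j jm ij.
have j'l : (j.-1 < l)%N by apply: leq_ltn_trans (leq_pred j) (ltn_ord j).
have j0 : (0 < j)%N by apply: leq_ltn_trans ij.
have := h (Ordinal j'l) j; rewrite /= prednK // => /(_ erefl) le1.
move: ij; rewrite -(prednK j0) ltnS leq_eqVlt => /orP[/eqP e|lt].
  by rewrite (_ : i = Ordinal j'l) //; apply: val_inj.
by apply: leq_trans le1 (IH (Ordinal j'l) _ lt); rewrite /= -ltnS prednK.
Qed.

Lemma mono_perm1 (s : 'S_l) : (forall i j, i < j -> s i < s j)%N -> s = 1%g.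
Proof.
have ge (t : 'S_l) : (forall i j, i < j -> t i < t j)%N -> forall i, (i <= t i)%N.
  move=> h i; have [m] := ubnP i; elim: m i => // m IH i im.
  have [->//|i0] := posnP i.
  have i'l : (i.-1 < l)%N by apply: leq_ltn_trans (leq_pred i) (ltn_ord i).
  have lt : (Ordinal i'l < i)%N by rewrite /= prednK.
  rewrite -(prednK i0); apply: leq_ltn_trans (h _ _ lt); apply: (IH (Ordinal i'l)).
  by rewrite -ltnS /= prednK.
move=> h; have h' i j : (i < j -> s^-1%g i < s^-1%g j)%N.
  move=> ij; rewrite ltnNge leq_eqVlt; apply/negP=> /orP[/eqP/val_inj/perm_inj e|/h].
    by rewrite e ltnn in ij.
  by rewrite !permKV ltnNge ltnW.
apply/permP=> i; rewrite perm1; apply: val_inj; apply: anti_leq.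
rewrite (ge _ h) andbT leqNgt; apply/negP=> lt.
by have := ge _ h' (s i); rewrite permK leqNgt lt.
Qed.

(** Since v is strictly decreasing, s.rho = v forces s to be increasing, hence the identity. *)
Lemma alt_nil v : (forall i j, i < j -> v j < v i)%N ->
  alt v [::] = [forall i, rho i == v i]%:R.
Proof.
move=> vdec; have [/forallP e|ne] := boolP [forall i, rho i == v i].
  rewrite /alt (big_pred1 1%g) ?odd_perm1 // => s.
  apply/forallP/eqP=> [h|-> i]; last by rewrite perm1 /= add0n.
  by apply/permP=> i; rewrite perm1; apply: rho_inj; rewrite (eqP (e i)) -(eqP (h i)).
rewrite /alt big_pred0 // => s; apply/negP=> /forallP h.
have s1 : s = 1%g.
  apply: mono_perm1 => i j /vdec; rewrite -(eqP (h i)) -(eqP (h j)) /= !add0n.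
  by rewrite /rho => lt; rewrite ltnNge; apply/negP=> le; move: lt; rewrite ltnNge leq_sub2l.
by move/negP: ne; apply; apply/forallP=> i; have := h i; rewrite s1 perm1 add0n.
Qed.

Lemma sorted_geo_split j y : sorted (@geo) y ->
  exists2 p, all (fun i => j <= i)%N (take p y) & all (fun i => i < j)%N (drop p y).
Proof.
elim: y => [|z y IH] ys; first by exists 0%N.
have [jz|zj] := leqP j z.
  by have [p h1 h2] := IH (path_sorted ys); exists p.+1 => //=; rewrite jz.
exists 0%N => //; rewrite drop0 /= zj /=.
apply: sub_all (order_path_min (@geo_trans) ys) => i; rewrite /geo => le.
exact: leq_ltn_trans le zj.
Qed.

(** The only possible u is v minus the content of y, that is, the content of x plus rho. A weakly
    decreasing y reads large letters first, so the critical prefix for i and i+1 contains every i+1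
    of y and no i; there the ballot condition is interlacing. *)
Lemma fits_cat M (v : 'I_l -> nat) (x y : seq 'I_l) :
  (forall i, v i < M)%N -> (forall i j, i < j -> v j < v i)%N -> sorted (@geo) y ->
  fits v (x ++ y) = (\sum_(u : {ffun 'I_l -> 'I_M} |
     [forall i : 'I_l, count_mem i y == v i - u i] && [forall i : 'I_l, u i <= v i])
     (fits (fun i => u i) x && interlace (fun i => u i) v))%N :> nat.
Proof.
move=> vM vdec ys.
have [/forallP le|] := boolP [forall i, count_mem i y <= v i]%N; last first.
  rewrite negb_forall => /existsP[i]; rewrite -ltnNge => lt.
  rewrite [RHS]big_pred0 => [|u]; last first.
    apply/negP=> /andP[/forallP/(_ i)/eqP e _].
    by move: lt; rewrite e ltnNge leq_subr.
  suff -> : fits v (x ++ y) = false by [].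
  apply/negP=> /andP[_ /forallP/(_ i)/eqP e].
  by move: lt; rewrite -e count_cat addnAC ltnNge leq_addl.
have bd i : (v i - count_mem i y < M)%N.
  by apply: leq_ltn_trans (leq_subr _ _) (vM i).
rewrite (big_pred1 [ffun i => Ordinal (bd i)]) => [|u]; last first.
  apply/andP/eqP=> [[/forallP h1 /forallP h2]|->].
    apply/ffunP=> i; apply: val_inj; rewrite ffunE /=.
    by rewrite (eqP (h1 i)) subKn.
  by split; apply/forallP=> i; rewrite ffunE /= ?leq_subr ?subKn.
congr nat_of_bool; rewrite /fits.
have -> : [forall i, count_mem i (x ++ y) + rho i == v i]%N =
          [forall i, count_mem i x + rho i == [ffun i => Ordinal (bd i)] i]%N.
  apply: eq_forallb => i; rewrite ffunE /= count_cat.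
  by rewrite addnAC -[in LHS](subnK (le i)) eqn_add2r.
rewrite -!andbA andbC [RHS]andbCA; case: forallP => //= h.
have cx i : (count_mem i x + rho i = v i - count_mem i y)%N.
  by rewrite (eqP (h i)) ffunE.
have cv i : (count_mem i x + rho i + count_mem i y = v i)%N by rewrite cx subnK.
apply/ballotP/andP=> [b|[/ballotP b /forallP il] k].
  split.
    apply/ballotP=> k i j ij; have := b (minn k (size x)) i j ij.
    by rewrite takel_cat ?geq_minr // take_min take_size.
  apply/forallP=> i; apply/forallP=> j; apply/implyP=> /eqP ij; rewrite ffunE /=.
  (* p cuts y just after its last letter that is at least j. *)
  have [p /allP hp /allP hd] := sorted_geo_split j ys.
  have lt : (i < j)%N by rewrite ij.
  have := b (size x + p)%N i j lt.
  rewrite take_cat ltnNge leq_addr /= addKn !count_cat.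
  have -> : count_mem i (take p y) = 0%N.
    apply/count_memPn/negP=> /hp; by rewrite leqNgt lt.
  have <- : count_mem j y = count_mem j (take p y).
    rewrite -{1}(cat_take_drop p y) count_cat (count_memPn (_ : j \notin drop p y)) ?addn0 //.
    by apply/negP=> /hd; rewrite ltnn.
  rewrite addn0 -cx -cv => le1; rewrite addnAC.
  by apply: leq_ltn_trans (leq_add le1 (leqnn _)) _; rewrite ltn_add2l ltn_rho.
(* Conversely, a prefix reaching into y has at most as many j as the whole word, and interlacing
   bounds this by the number of i in x alone. *)
apply: adjacent_geq => i j ij.
have lt : (i < j)%N by rewrite ij.
have := takel_cat; rewrite take_cat; case: ltnP => [_ _|_ _]; first exact: b.
have /forallP/(_ j)/implyP := il i; rewrite ij => /(_ (eqxx _)).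
rewrite ffunE /= -cx -cv (_ : rho i = (rho j).+1); last first.
  by rewrite /rho ij subnSK // -ij.
rewrite addnAC addnS ltnS leq_add2r => le1.
rewrite !count_cat; apply: leq_trans (leq_addr _ _); apply: leq_trans le1.
by rewrite leq_add2l -{2}(cat_take_drop (k - size x) y) count_cat leq_addr.
Qed.

(** Both sides obey the same recursion on the last block: Pieri's rule after cancellation on the
    left, the splitting of ballot words on the right. *)
Lemma altsum_fits n (D : pred nat) v : (forall i j, i < j -> v j < v i)%N ->
  altsum n D v =
  #|[pred w : n.-tuple 'I_l | asc_sub D (map val w) && fits v w]|%:R.
Proof.
elim/ltn_ind: n v => n IH v vdec.
have [->|/(last_block D)[m [k [en k0 Dm Dk]]]] := posnP n.
  rewrite altsum0 alt_nil // -sum1_card big_mkcond (big_pred1 [tuple]) /=.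
    rewrite !inE /=; congr _%:R; rewrite /fits.
    have -> : ballot [::] by apply/ballotP.
    by congr nat_of_bool.
  by move=> w; apply/esym/eqP/tuple0.
have blk : block D m k by split.
pose M := (\sum_i v i).+1.
have vM i : (v i < M)%N by rewrite ltnS (bigD1 i) //= leq_addr.
have vle i j : (i < j)%N -> (v j <= v i)%N by move/vdec/ltnW.
rewrite en (altsum_rec vM blk) (@sum_interlace M v _ vle (@altsum_antisym m D)).
(* Interlacing makes u strictly decreasing, since u_j <= v_j <= v_(i+1) < u_i for i < j; the
   induction hypothesis therefore applies to u. *)
have IHu (u : {ffun 'I_l -> 'I_M}) : [forall i, u i <= v i]%N ->
    interlace (fun i => u i) v -> altsum m D (fun i => u i) =
    #|[pred w : m.-tuple 'I_l | asc_sub D (map val w) && fits (fun i => u i) w]|%:R.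
  move=> /forallP uv /forallP il; apply: IH => [|i j ij].
    by rewrite en -[X in (X < _)%N]addn0 ltn_add2l.
  have i'l : (i.+1 < l)%N by apply: leq_ltn_trans ij _.
  have /forallP/(_ (Ordinal i'l))/implyP/(_ (eqxx _)) := il i.
  apply: leq_ltn_trans; apply: leq_trans (uv j) _.
  move: ij; rewrite leq_eqVlt => /orP[/eqP e|lt]; last exact: vle.
  by rewrite (_ : j = Ordinal i'l) //; apply: val_inj.
rewrite -sum1_card (big_tuple_cat _ m k
  (fun w => (asc_sub D (map val w) && fits v w)) (fun=> 1%N)) /= natr_sum.
transitivity (\sum_(u : {ffun 'I_l -> 'I_M}) \sum_(x : m.-tuple 'I_l) \sum_(y : k.-tuple 'I_l)
    ((sorted (@geo) y && ([forall i, count_mem i y == v i - u i]%N &&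
       [forall i, u i <= v i]%N)))%:R * (((asc_sub D (map val x)) && fits (fun i => u i) x)
        && interlace (fun i => u i) v)%:R : algC).
  rewrite sum_ind; apply: eq_bigr => u _.
  under [RHS]eq_bigr do rewrite -big_distrl /= sum_sorted_content.
  rewrite -big_distrr /= andbA.
  have [lev|_] := boolP [forall i : 'I_l, u i <= v i]%N; last by rewrite !mul0r.
  case: (_ == _); last by rewrite !mul0r.
  rewrite !mul1r /=; have [il|_] := boolP (interlace _ v); last first.
    by rewrite mul0r big1 // => x _; rewrite andbF.
  rewrite mul1r IHu // -sum1_card natr_sum big_mkcond; apply: eq_bigr => x _.
  by rewrite inE andbT; case: (_ && _).
rewrite exchange_big; apply: eq_bigr => x _ /=.
rewrite exchange_big natr_sum [RHS]sum_ind; apply: eq_bigr => y _ /=.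
rewrite asc_sub_block // mulr1; have [ys|_] /= := boolP (sorted _ y); last first.
  by rewrite andbF big1 // => u _; rewrite mul0r.
rewrite andbT; have [_|_] := boolP (asc_sub _ _); last first.
  by rewrite big1 // => u _; rewrite mulr0.
by rewrite /= (fits_cat x vM vdec ys) natr_sum [RHS]sum_ind.
Qed.

End Pieri.

(** Sums over A i contained in D determine the sums over A i = D, by induction on the size of D; any
    function of A i is a combination of the latter. *)
Lemma sum_exact_subset (I T : finType) (A : I -> {set T}) (g h : I -> algC) :
  (forall D : {set T}, \sum_(i | A i \subset D) g i = \sum_(i | A i \subset D) h i) ->
  forall f : {set T} -> algC, \sum_i f (A i) * g i = \sum_i f (A i) * h i.
Proof.
move=> sub f.
have split_sub (D : {set T}) (k : I -> algC) : \sum_(i | A i \subset D) k i =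
    \sum_(i | A i == D) k i + \sum_(B : {set T} | B \proper D) \sum_(i | A i == B) k i.
  rewrite (bigID (fun i => A i == D)) /=; congr (_ + _).
    by apply: eq_bigl => i; case: eqP => [->|]; rewrite ?subxx ?andbF.
  rewrite (partition_big A (fun B : {set T} => B \proper D)) => [|i].
    apply: eq_bigr => B BD; apply: eq_bigl => i; case: (eqVneq (A i) B) => [->|]; rewrite ?andbF //.
    by move: BD; rewrite properEneq andbC => ->.
  by rewrite properEneq andbC.
have ex (D : {set T}) : \sum_(i | A i == D) g i = \sum_(i | A i == D) h i.
  have [m] := ubnP #|D|; elim: m D => // m IH D Dm.
  have := sub D; rewrite !split_sub.
  rewrite [X in _ + X = _](eq_bigr (fun B => \sum_(i | A i == B) h i)); first by move/addIr.
  by move=> B BD; apply: IH; rewrite -ltnS (leq_trans _ Dm) // ltnS proper_card.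
have part (k : I -> algC) : \sum_i f (A i) * k i = \sum_(D : {set T}) f D * \sum_(i | A i == D) k i.
  rewrite (partition_big A predT) //=; apply: eq_bigr => D _.
  by rewrite big_distrr; apply: eq_bigr => i /eqP->.
by rewrite !part; apply: eq_bigr => D _; rewrite ex.
Qed.

Lemma nth_word l n (w : n.-tuple 'I_l) (k : 'I_n) : nth 0%N (map val w) k = tnth w k.
Proof. by rewrite (nth_map (tnth w k)) ?size_tuple // -tnth_nth. Qed.

Definition ascset n (w : seq nat) : {set 'I_n} := [set d : 'I_n | asc w d].

Lemma ascset_sub l n (w : n.-tuple 'I_l) (D : {set 'I_n}) :
  (ascset n (map val w) \subset D) =
  asc_sub [pred d | [exists x in D, val x == d]] (map val w).
Proof.
apply/subsetP/asc_subP => [h d ad|h x]; last first.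
  by rewrite inE => /h/existsP[y /andP[yD /eqP/val_inj<-]].
have dn : (d < n)%N by case/and3P: ad => _; rewrite size_map size_tuple.
apply/existsP; exists (Ordinal dn); rewrite eqxx andbT; apply: h.
by rewrite inE.
Qed.

(** [altsum_fits] is the case of the indicator of being contained in D; triangularity extends it to
    every statistic of the ascent set. *)
Lemma sum_alt_fits l n (v : 'I_l -> nat) (f : {set 'I_n} -> algC) :
  (forall i j : 'I_l, i < j -> v j < v i)%N ->
  \sum_(w : n.-tuple 'I_l) f (ascset n (map val w)) * alt v w =
  \sum_(w : n.-tuple 'I_l | fits v w) f (ascset n (map val w)).
Proof.
move=> vdec; rewrite [RHS]sum_ind.
under [RHS]eq_bigr do rewrite mulrC.
apply: (@sum_exact_subset _ _ (fun w : n.-tuple 'I_l => ascset n (map val w))) => D.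
under eq_bigl do rewrite ascset_sub.
under [RHS]eq_bigl do rewrite ascset_sub.
rewrite [LHS](altsum_fits _ _ vdec) -sum1_card natr_sum big_mkcond [RHS]big_mkcond /=.
by apply: eq_bigr => w _; rewrite inE; case: (asc_sub _ _) => //=; case: fits.
Qed.

(** * Standard tableaux and ballot words *)

Section Tableaux.

Variables (n : nat) (la : part n).
Implicit Types (Q : filling n la) (c d : cell la) (w : n.-tuple 'I_n).

Definition lam (i : nat) : nat := nth 0%N (parts la) i.

Lemma parts_sorted : sorted geq (parts la).
Proof. by have /and3P[] := valP la. Qed.

Lemma sumn_parts : sumn (parts la) = n.
Proof. by have /and3P[_ _ /eqP] := valP la. Qed.

Lemma size_parts : (size (parts la) <= n)%N.
Proof. by rewrite size_map size_bseq. Qed.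

Lemma lam_dec (i j : nat) : (i <= j)%N -> (lam j <= lam i)%N.
Proof.
move=> ij; have [js|sj] := ltnP j (size (parts la)); last by rewrite /lam nth_default.
have tr : transitive geq by move=> x y z h1 h2; apply: leq_trans h2 h1.
have := sorted_leq_nth tr (fun x => leqnn x) 0%N parts_sorted; apply=> //.
by rewrite inE (leq_ltn_trans ij).
Qed.

Lemma sum_lam : (\sum_(i < n) lam i)%N = n.
Proof.
rewrite -[RHS]sumn_parts sumnE (big_nth 0%N) big_mkord.
rewrite (big_ord_widen _ _ size_parts) [RHS]big_mkcond; apply: eq_bigr => i _.
by case: ltnP => // h; rewrite /lam nth_default.
Qed.

Lemma lam_le (i : 'I_n) : (lam i <= n)%N.
Proof. by rewrite -[X in (_ <= X)%N]sum_lam (bigD1 i) //= leq_addr. Qed.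

Definition vla (i : 'I_n) : nat := (lam i + rho i)%N.

Lemma vla_dec (i j : 'I_n) : (i < j)%N -> (vla j < vla i)%N.
Proof.
move=> ij; rewrite /vla.
by apply: leq_ltn_trans (leq_add (lam_dec (ltnW ij)) (leqnn _)) _; rewrite ltn_add2l ltn_rho.
Qed.

Lemma card_row (i : 'I_n) : #|[pred c : cell la | row_of c == i]| = lam i.
Proof.
have jn (j : 'I_(lam i)) : (j < n)%N by apply: leq_trans (ltn_ord j) (lam_le i).
have jc (j : 'I_(lam i)) : ((i, Ordinal (jn j)).2 < nth 0 (parts la) (i, Ordinal (jn j)).1)%N.
  exact: (ltn_ord j).
pose h (j : 'I_(lam i)) : cell la := exist _ (i, Ordinal (jn j)) (jc j).
have hinj : injective h.
  by move=> j j' /(congr1 (fun c => col_of c : nat)) /= /val_inj.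
rewrite -[RHS]card_ord -(card_codom hinj); apply: eq_card => c; rewrite !inE.
apply/eqP/codomP => [e|[j ->]] //.
case: c e => [[i' j] /= lt] e; rewrite /row_of /= in e; move: lt; rewrite e => lt.
by exists (Ordinal lt); apply: val_inj; congr (_, _); apply: val_inj.
Qed.

Lemma card_cell : #|cell la| = n.
Proof.
rewrite -[RHS]sum_lam -sum1_card (partition_big (@row_of n la) predT) //=.
by apply: eq_bigr => i _; rewrite -card_row -sum1_card.
Qed.

Lemma cell_eq c d : row_of c = row_of d -> col_of c = col_of d -> c = d.
Proof.
by case: c d => [[i j] lt] [[i' j'] lt'] /= e1 e2; apply: val_inj; congr (_, _).
Qed.

Lemma cell_lt c : (col_of c < lam (row_of c))%N.
Proof. exact: (valP c). Qed.

Lemma cell_exists (i j : 'I_n) : (j < lam i)%N -> exists2 c : cell la, row_of c = i & col_of c = j.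
Proof. by move=> lt; exists (exist _ (i, j) lt). Qed.

Lemma count_takeE l m (w : m.-tuple 'I_l) k (i : 'I_l) :
  count_mem i (take k w) = #|[pred x : 'I_m | (x < k)%N && (tnth w x == i)]|.
Proof.
rewrite -sum1_card -sum1_count big_mkcond /= (big_nth i).
have sw : (size (take k w) <= m)%N by rewrite size_take_min size_tuple geq_minr.
rewrite big_mkord (big_ord_widen m (fun x => if nth i (take k w) x == i then 1 else 0)%N sw).
rewrite big_mkcond [RHS]big_mkcond /=; apply: eq_bigr => x _.
rewrite inE size_take_min size_tuple leq_min ltn_ord andbT; case: ltnP => //= xk.
by rewrite nth_take // (tnth_nth i); case: eqP.
Qed.

Lemma count_tupleE l m (w : m.-tuple 'I_l) (i : 'I_l) :
  count_mem i w = #|[pred x : 'I_m | tnth w x == i]|.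
Proof.
rewrite -{1}(take_size w) size_tuple count_takeE; apply: eq_card => x.
by rewrite !inE ltn_ord.
Qed.

(** The default letter [k] never occurs for a standard tableau: an injective filling of the n cells
    takes every value. *)
Definition row_word Q : n.-tuple 'I_n :=
  [tuple oapp (@row_of n la) k [pick c | Q c == k] | k < n].

(** The cell in row i and column j receives the position of the occurrence of i preceded by exactly
    j others. The default value is only reached by words lacking that occurrence. *)
Definition word_filling w : filling n la :=
  [ffun c => odflt (row_of c) [pick k : 'I_n |
     (tnth w k == row_of c) && (count_mem (row_of c) (take k w) == col_of c)%N]].

Lemma inj_fillingK Q : injective Q -> exists2 Qi, cancel Q Qi & cancel Qi Q.
Proof.
move=> Qinj; have bij : bijective Q.
  by apply: inj_card_bij => //; rewrite card_cell card_ord.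
by case: bij => Qi h1 h2; exists Qi.
Qed.

Lemma row_wordE Q Qi : cancel Q Qi -> cancel Qi Q ->
  forall k, tnth (row_word Q) k = row_of (Qi k).
Proof.
move=> h1 h2 k; rewrite tnth_mktuple; case: pickP => [c /eqP <-|/(_ (Qi k))] /=.
  by rewrite h1.
by rewrite h2 eqxx.
Qed.

Lemma is_sytP Q : reflect [/\ injective Q,
    forall c d, row_of c = row_of d -> (col_of c < col_of d)%N -> (Q c < Q d)%N
  & forall c d, col_of c = col_of d -> (row_of c < row_of d)%N -> (Q c < Q d)%N]
  (is_syt Q).
Proof.
apply: (iffP andP) => [[/forallP h /injectiveP Qinj]|[Qinj hr hc]]; split=> //.
- by move=> c d e lt; have /forallP/(_ d)/andP[/implyP-> //] := h c; rewrite e eqxx.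
- by move=> c d e lt; have /forallP/(_ d)/andP[_ /implyP-> //] := h c; rewrite e eqxx.
- apply/forallP=> c; apply/forallP=> d; apply/andP; split; apply/implyP=> /andP[/eqP e lt].
    exact: hr.
  exact: hc.
exact/injectiveP.
Qed.

Section FromTableau.
Variables (Q : filling n la) (Qi : 'I_n -> cell la).
Hypotheses (Q_syt : is_syt Q) (QK : cancel Q Qi) (QiK : cancel Qi Q).

Let Qrow := let: And3 _ h _ := is_sytP Q Q_syt in h.
Let Qcol := let: And3 _ _ h := is_sytP Q Q_syt in h.

Let count_prefix k i :
  count_mem i (take k (row_word Q)) = #|[pred c | (Q c < k)%N && (row_of c == i)]|.
Proof.
rewrite count_takeE -(card_image (can_inj QK)); apply: eq_card => x; rewrite inE.
rewrite (row_wordE QK QiK); apply/idP/imageP=> [h|[c h ->]].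
  by exists (Qi x); rewrite ?inE ?QiK.
by rewrite QK.
Qed.

(** For the ballot condition, a cell of row j with entry below k has above it, in row i of the same
    column, a cell with a smaller entry. *)
Lemma row_word_fits : fits vla (row_word Q).
Proof.
apply/andP; split; last first.
  apply/forallP=> i; rewrite /vla eqn_add2r -[X in count_mem _ X](take_size (row_word Q)).
  rewrite size_tuple count_prefix -card_row; apply/eqP/eq_card => c.
  by rewrite !inE ltn_ord.
apply/ballotP=> k i j ij; rewrite !count_prefix.
have up (c : cell la) : row_of c = j -> exists2 d : cell la, row_of d = i & col_of d = col_of c.
  move=> e; apply: cell_exists; apply: leq_trans (cell_lt c) _.
  by rewrite e lam_dec // ltnW.
pose h (c : cell la) := odflt c [pick d : cell la | (row_of d == i) && (col_of d == col_of c)].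
have hP c : row_of c = j -> row_of (h c) = i /\ col_of (h c) = col_of c.
  move=> /up[d e1 e2]; rewrite /h; case: pickP => [d' /andP[/eqP -> /eqP ->] //|/(_ d)].
  by rewrite e1 e2 !eqxx.
rewrite -(@card_in_imset _ _ h); last first.
  move=> c d; rewrite !inE => /andP[_ /eqP ec] /andP[_ /eqP ed] e.
  have [_ cc] := hP _ ec; have [_ cd] := hP _ ed.
  by apply: cell_eq; rewrite ?ec ?ed // -cc -cd e.
apply: subset_leq_card; apply/subsetP=> d /imsetP[c]; rewrite !inE => /andP[ck /eqP ec] ->.
have [e1 e2] := hP _ ec; rewrite e1 eqxx andbT; apply: ltn_trans ck.
by apply: Qcol; rewrite ?e1 ?ec.
Qed.

Lemma row_wordK : word_filling (row_word Q) = Q.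
Proof.
(* The cells of the row of c whose entry is smaller than Q c are those to its left. *)
have col_count c : count_mem (row_of c) (take (Q c) (row_word Q)) = col_of c.
  rewrite count_prefix -[RHS](card_ord (col_of c)).
  have ex (j : 'I_(col_of c)) : exists d : cell la, (row_of d == row_of c) && (col_of d == j :> nat).
    have jn : (j < n)%N by apply: ltn_trans (ltn_ord j) (ltn_ord _).
    have [d e1 e2] := @cell_exists (row_of c) (Ordinal jn) (ltn_trans (ltn_ord j) (cell_lt c)).
    by exists d; rewrite e1 e2 !eqxx.
  pose h j := xchoose (ex j).
  have hP j : row_of (h j) = row_of c /\ col_of (h j) = j :> nat.
    by have /andP[/eqP e1 /eqP e2] := xchooseP (ex j).
  have hinj : injective h.
    by move=> j j' e; apply: val_inj => /=; rewrite -(proj2 (hP j)) -(proj2 (hP j')) e.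
  rewrite -(card_codom hinj); apply: eq_card => d; rewrite inE.
  apply/andP/codomP=> [[lt /eqP e]|[j ->]]; last first.
    by rewrite (hP j).1 eqxx; split=> //; apply: Qrow; rewrite ?(hP j).1 ?(hP j).2.
  have lt' : (col_of d < col_of c)%N.
    rewrite ltnNge leq_eqVlt; apply/negP=> /orP[/eqP e'|lt'].
      by move: lt; rewrite (cell_eq e (esym (val_inj e'))) ltnn.
    by have := Qrow (esym e) lt'; rewrite ltnNge ltnW.
  exists (Ordinal lt'); apply: cell_eq; first by rewrite (hP _).1.
  by apply: val_inj => /=; rewrite (proj2 (hP (Ordinal lt'))).
apply/ffunP=> c; rewrite ffunE; case: pickP => [k /andP[/eqP e1 /eqP e2]|/(_ (Q c))] /=.
  rewrite -[k]QiK; congr (Q _); apply: cell_eq; first by rewrite -e1 (row_wordE QK QiK).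
  apply: val_inj; rewrite /= -e2 -[in RHS]e1 (row_wordE QK QiK) -[in take k _](QiK k).
  by rewrite col_count.
by rewrite (row_wordE QK QiK) QK col_count !eqxx.
Qed.

Lemma des_asc (d : nat) : des Q d = asc (map val (row_word Q)) d.
Proof.
apply/existsP/and3P=> [[c /existsP[c' /and3P[/eqP e1 /eqP e2 lt]]]|[d0 + lt]].
  have dn : (d < n)%N by move: e2 => [<-].
  have e1' : d.-1 = Q c by rewrite -e1.
  have e2' : d = Q c' by case: e2.
  split; [by rewrite -e1 | by rewrite size_map size_tuple |].
  by rewrite e1' e2' !nth_word !(row_wordE QK QiK) !QK.
rewrite size_map size_tuple => dn.
have d'n : (d.-1 < n)%N by apply: leq_ltn_trans (leq_pred d) dn.
exists (Qi (Ordinal d'n)); apply/existsP; exists (Qi (Ordinal dn)).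
rewrite !QiK /= prednK // !eqxx /=; move: lt.
rewrite -[d.-1]/(val (Ordinal d'n)) -[X in (_ < nth _ _ X)%N]/(val (Ordinal dn)).
by rewrite !nth_word !(row_wordE QK QiK).
Qed.

End FromTableau.

Section FromWord.
Variable w : n.-tuple 'I_n.
Hypothesis w_content : forall i, count_mem i w = lam i.

Let cnt k i := count_mem i (take k w).

Let cnt_mono k k' i : (k <= k')%N -> (cnt k i <= cnt k' i)%N.
Proof.
move=> le; rewrite /cnt !count_takeE; apply: subset_leq_card; apply/subsetP=> x.
by rewrite !inE => /andP[lt ->]; rewrite (leq_trans lt).
Qed.

Let cntS (k : 'I_n) i : cnt k.+1 i = (cnt k i + (tnth w k == i))%N.
Proof.
by rewrite /cnt (take_nth i) ?size_tuple // -cats1 count_cat /= addn0 -tnth_nth.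
Qed.

(** The column is the number of earlier occurrences of the same letter; the content hypothesis keeps
    it inside the row. *)
Let cell_of (k : 'I_n) : {c : cell la | row_of c = tnth w k & col_of c = cnt k (tnth w k) :> nat}.
Proof.
have lt : (cnt k (tnth w k) < lam (tnth w k))%N.
  rewrite -w_content -[X in (_ < count_mem _ X)%N](take_size w) size_tuple.
  apply: leq_trans (cnt_mono _ (ltn_ord k)).
  by rewrite cntS eqxx addn1.
have ltn : (cnt k (tnth w k) < n)%N by apply: leq_trans lt (lam_le _).
by exists (exist _ (tnth w k, Ordinal ltn) lt).
Qed.

Let cw k := s2val (cell_of k).
Let cw_row k : row_of (cw k) = tnth w k. Proof. exact: (s2valP (cell_of k)). Qed.
Let cw_col k : col_of (cw k) = cnt k (tnth w k) :> nat. Proof. exact: (s2valP' (cell_of k)). Qed.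

Let cw_inj : injective cw.
Proof.
move=> k k' e; apply: val_inj.
have e1 : tnth w k = tnth w k' by rewrite -!cw_row e.
have e2 : cnt k (tnth w k) = cnt k' (tnth w k') by rewrite -!cw_col e.
wlog le : k k' e e1 e2 / (k <= k')%N => [h|].
  by have [/h->//|/ltnW/h->] := leqP k k'.
move: le; rewrite leq_eqVlt => /orP[/eqP //|lt].
by have := cnt_mono (tnth w k) lt; rewrite cntS eqxx addn1 e2 e1 ltnn.
Qed.

Let word_fillingE c k : (word_filling w c == k) = (cw k == c).
Proof.
have bij : bijective cw by apply: inj_card_bij => //; rewrite card_cell card_ord.
case: bij => ci h1 h2; rewrite -(h2 c) (inj_eq cw_inj) ffunE.
set k0 := ci c; case: pickP => [k' /andP[/eqP e1 /eqP e2]|/(_ k0)] /=; last first.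
  by rewrite !cw_row cw_col /cnt !eqxx.
suff -> : k' = k0 by rewrite eq_sym.
apply: cw_inj; apply: cell_eq; first by rewrite cw_row e1.
by apply: val_inj => /=; rewrite -e2 cw_col e1.
Qed.

Let word_fillingK k : word_filling w (cw k) = k.
Proof. by apply/eqP; rewrite word_fillingE. Qed.

Let cwK c : cw (word_filling w c) = c.
Proof. by apply/eqP; rewrite -word_fillingE. Qed.

Lemma word_filling_syt : ballot w -> is_syt (word_filling w).
Proof.
move=> /ballotP wb.
apply/is_sytP; split; first exact: can_inj cwK.
  move=> c d; rewrite -[c]cwK -[d]cwK; move: (word_filling w c) (word_filling w d) => k k'.
  rewrite !word_fillingK !cw_row !cw_col => ->; rewrite !ltnNge; apply: contraNN.
  exact: cnt_mono.
move=> c d; rewrite -[c]cwK -[d]cwK; move: (word_filling w c) (word_filling w d) => k k'.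
rewrite !word_fillingK !cw_row => /(congr1 val) /=; rewrite !cw_col => e lt.
rewrite ltnNge leq_eqVlt; apply/negP=> /orP[/eqP/val_inj ek|lt'].
  by rewrite ek ltnn in lt.
(* If k' < k, the prefix through k' contains the lower letter once more than the common column
   index, whereas the upper letter has occurred at most that often before k. *)
have := wb k'.+1 _ _ lt.
rewrite -/(cnt _ _) -/(cnt _ _) cntS eqxx addn1 -e; apply/negP; rewrite -ltnNge ltnS.
exact: cnt_mono.
Qed.

Lemma word_fillingK' : row_word (word_filling w) = w.
Proof.
by apply: eq_from_tnth => k; rewrite (row_wordE cwK word_fillingK) cw_row.
Qed.

(** Only the content matters here, so the tableau obtained need not be standard; this serves to
    identify tabloids with words. *)
Lemma content_cells : exists2 f : 'I_n -> cell la,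
  injective f & forall k, row_of (f k) = tnth w k.
Proof. by exists cw. Qed.

End FromWord.

Lemma sum_syt (R : nmodType) (F : n.-tuple 'I_n -> R) :
  \sum_(Q : filling n la | is_syt Q) F (row_word Q) =
  \sum_(w : n.-tuple 'I_n | fits vla w) F w.
Proof.
rewrite (reindex_onto word_filling row_word) => [|Q Qs]; last first.
  have [Qinj _ _] := is_sytP Q Qs; have [Qi h1 h2] := inj_fillingK Qinj.
  exact: (row_wordK Qs h1 h2).
apply: eq_big => [w|w /andP[_ /eqP->]//].
apply/andP/idP=> [[ws /eqP <-]|wf].
  have [Qinj _ _] := is_sytP _ ws; have [Qi h1 h2] := inj_fillingK Qinj.
  exact: (row_word_fits ws h1 h2).
have /andP[wb /forallP wc] := wf.
have wc' i : count_mem i w = lam i by apply/eqP; rewrite -(eqn_add2r (rho i)) wc.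
by rewrite word_fillingK' // word_filling_syt.
Qed.

End Tableaux.

(** * The Frobenius character formula *)

Section PermutationCharacter.

Variables (gT : finGroupType) (X : finType) (act : X -> gT -> X).
Hypotheses (act1 : forall x, act x 1%g = x)
  (actM : forall x g h, act x (g * h)%g = act (act x g) h).

Definition action_mx (g : gT) : 'M[algC]_#|X| :=
  \matrix_i delta_mx 0 (enum_rank (act (enum_val i) g)).

Lemma action_mx_repr : mx_repr [set: gT] action_mx.
Proof.
split=> [|g h _ _]; apply/row_matrixP=> i.
  by rewrite rowK act1 enum_valK rowE mulmx1.
by rewrite row_mul !rowK -rowE rowK enum_rankK actM.
Qed.

Definition action_char : 'CF([set: gT]) :=
  cfRepr (MxRepresentation action_mx_repr).

Lemma action_charE g : action_char g = #|[pred x | act x g == x]|%:R.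
Proof.
rewrite cfunE inE mulr1n /mxtrace -[in RHS]sum1_card natr_sum [RHS]big_mkcond /=.
rewrite (reindex _ (onW_bij _ (@enum_rank_bij X))); apply: eq_bigr => x _.
by rewrite !mxE enum_rankK eqxx /= inE (inj_eq enum_rank_inj) eq_sym; case: eqP.
Qed.

End PermutationCharacter.

Section WordCharacter.

Variables (n : nat) (T : finType).
Implicit Types (w : n.-tuple T) (g h : 'S_n).

Definition word_act w g : n.-tuple T := [tuple tnth w (g^-1%g k) | k < n].

Definition word_fix g w : bool := [forall k, tnth w (g k) == tnth w k].

Lemma word_actE w g k : tnth (word_act w g) k = tnth w (g^-1%g k).
Proof. by rewrite tnth_mktuple. Qed.

Lemma word_fixE g w : word_fix g w = (word_act w g == w).
Proof.
apply/forallP/eqP=> [h|e k]; last by rewrite -{1}e word_actE permK.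
by apply: eq_from_tnth => k; rewrite word_actE -{2}(permKV g k) (eqP (h _)).
Qed.

Lemma perm_word_act w g : perm_eq (word_act w g) w.
Proof. by apply/tuple_permP; exists g^-1%g. Qed.

Variable C : pred (n.-tuple T).
Hypothesis C_perm : forall w w', perm_eq w w' -> C w = C w'.

Fact word_act_proof (x : {w | C w}) g : C (word_act (val x) g).
Proof. by rewrite (C_perm (perm_word_act _ _)) (valP x). Qed.

Definition word_sub_act (x : {w | C w}) g : {w | C w} :=
  exist _ (word_act (val x) g) (word_act_proof x g).

Fact word_sub_act1 x : word_sub_act x 1%g = x.
Proof.
by apply: val_inj; apply: eq_from_tnth => k; rewrite word_actE invg1 perm1.
Qed.

Fact word_sub_actM x g h :
  word_sub_act x (g * h)%g = word_sub_act (word_sub_act x g) h.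
Proof.
by apply: val_inj; apply: eq_from_tnth => k; rewrite !word_actE invMg permM.
Qed.

Definition word_char : 'CF([set: 'S_n]) := action_char word_sub_act1 word_sub_actM.

Lemma word_charE g : word_char g = #|[pred w | C w && word_fix g w]|%:R.
Proof.
rewrite action_charE; congr _%:R; rewrite -(card_image val_inj).
apply: eq_card => w; rewrite inE; apply/imageP/andP=> [[x + ->]|[Cw wf]].
  by rewrite inE => /eqP e; rewrite (valP x) word_fixE -{2}e eqxx.
exists (exist _ w Cw) => //; rewrite inE; apply/eqP/val_inj/eqP.
by rewrite -word_fixE.
Qed.

Lemma word_char_char : word_char \is a character.
Proof. exact: cfRepr_char. Qed.

End WordCharacter.

Section SortedOrbits.

Variables (n : nat) (T : finType) (key : T -> nat).
Hypothesis key_inj : injective key.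
Implicit Types (p q : n.-tuple T).

Let le x y := (key x <= key y)%N.

Let le_trans : transitive le.
Proof. by move=> x y z; apply: leq_trans. Qed.

Let le_anti : antisymmetric le.
Proof. by move=> x y /anti_leq/key_inj. Qed.

Let le_total : total le.
Proof. by move=> x y; apply: leq_total. Qed.

(* Every orbit of 'S_n on words contains exactly one sorted word. *)
Lemma sum_fixed_sorted (f : n.-tuple T -> algC) :
  (forall p q, perm_eq p q -> f p = f q) ->
  \sum_(g : 'S_n) \sum_(p | word_fix g p) f p =
  n`!%:R * \sum_(p : n.-tuple T | sorted le p) f p.
Proof.
move=> f_perm.
pose h p (s : 'S_n) : n.-tuple T := [tuple tnth p (s k) | k < n].
have fh p s : f (h p s) = f p by apply/f_perm/tuple_permP; exists s.
transitivity (\sum_(p : n.-tuple T | sorted le p) \sum_(s : 'S_n) \sum_(q | q == h p s) f q); last first.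
  rewrite big_distrr; apply: eq_bigr => p _ /=.
  under eq_bigr do rewrite big_pred1_eq fh.
  by rewrite sumr_const card_Sn mulr_natl.
rewrite (exchange_big_dep predT) //=.
under [RHS]eq_bigr do rewrite (exchange_big_dep predT) //=.
rewrite [RHS](exchange_big_dep predT) //=; apply: eq_bigr => q _.
have sz : size (sort le q) == n by rewrite size_sort size_tuple.
have /tuple_permP[s0 es0] : perm_eq q (Tuple sz) by rewrite perm_sym perm_sort.
have q0 : q = h (Tuple sz) s0 by apply: val_inj.
rewrite (bigD1 (Tuple sz)) /=; last by rewrite andbT; apply: sort_sorted.
rewrite [X in _ + X]big1 ?addr0 => [|p /andP[/andP[ps _] ne]]; last first.
  rewrite big_pred0 // => s; apply/eqP=> e; case/negP: ne; apply/eqP/val_inj.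
  apply: (sorted_eq le_trans le_anti) => //; first exact: sort_sorted.
  rewrite /= perm_sym perm_sort perm_sym; apply/tuple_permP.
  exists s^-1%g; congr val; apply: eq_from_tnth => k.
  by rewrite e !tnth_mktuple permKV.
(* The rearrangements of the sorted word that produce q form the coset through s0 of the stabiliser
   of q. *)
rewrite [RHS](reindex_inj (mulIg s0)) /=; apply: eq_bigl => g.
apply/forallP/eqP=> [fx|e k].
  rewrite {1}q0; apply: eq_from_tnth => k.
  by rewrite -q0 -(eqP (fx k)) {1}q0 !tnth_mktuple permM.
by rewrite {2}e {1}q0 !tnth_mktuple permM.
Qed.

End SortedOrbits.

(** * The virtual character psi and its norm *)

Section FrobeniusFormula.

Variables (n : nat) (la : part n).
Implicit Types (z w : n.-tuple 'I_n) (g s : 'S_n).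

Definition jump (z : seq nat) : pred nat := fun d => nth 0%N z d.-1 != nth 0%N z d.

(** Lexicographic order, reversed on the second letter: a biword is sorted when z is weakly
    increasing and w weakly decreases along each constant run of z. The ascents of w are then jumps
    of z. *)
Let bikey (x : 'I_n * 'I_n) : nat := (x.1 * n + rev_ord x.2)%N.

Let bikey_le (x y : 'I_n * 'I_n) :
  (bikey x <= bikey y)%N = (x.1 < y.1)%N || (x.1 == y.1) && (y.2 <= x.2)%N.
Proof.
have lt (a b : 'I_n * 'I_n) : (a.1 < b.1)%N -> (bikey a < bikey b)%N.
  move=> ab; apply: (@leq_trans (a.1.+1 * n)%N).
    by rewrite /bikey mulSn [X in (_ < X)%N]addnC ltn_add2l ltn_ord.
  by apply: leq_trans (leq_addr _ _); rewrite leq_mul2r ab orbT.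
have [xy|yx|e] := ltngtP x.1 y.1.
- by rewrite ltnW ?lt.
- by rewrite leqNgt lt //= -val_eqE gtn_eqF.
- by rewrite (val_inj e) eqxx /bikey (val_inj e) leq_add2l /= leq_sub2lE.
Qed.

Let bikey_inj : injective bikey.
Proof.
move=> [x1 x2] [y1 y2] e.
have := bikey_le (x1, x2) (y1, y2); have := bikey_le (y1, y2) (x1, x2).
rewrite e leqnn /= -!val_eqE /=; case: ltngtP => //= /val_inj -> h1 h2.
by congr (_, _); apply/val_inj/anti_leq; rewrite -h1 -h2.
Qed.

Let biword z w : n.-tuple ('I_n * 'I_n) := [tuple (tnth z k, tnth w k) | k < n].

Let biword_bij : bijective (fun p => biword p.1 p.2).
Proof.
exists (fun q : n.-tuple ('I_n * 'I_n) => ([tuple (tnth q k).1 | k < n], [tuple (tnth q k).2 | k < n])).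
  by move=> [z w]; congr (_, _); apply: eq_from_tnth => k; rewrite !tnth_mktuple.
by move=> q; apply: eq_from_tnth => k; rewrite !tnth_mktuple -surjective_pairing.
Qed.

Let biword_fix g z w : word_fix g (biword z w) = word_fix g z && word_fix g w.
Proof.
apply/forallP/andP=> [h|[/forallP h1 /forallP h2] k].
  by split; apply/forallP=> k; have := h k; rewrite !tnth_mktuple => /eqP[/eqP ? /eqP ?].
by rewrite !tnth_mktuple (eqP (h1 k)) (eqP (h2 k)).
Qed.

Let biword_sorted z w : sorted (fun x y => bikey x <= bikey y)%N (biword z w) =
  sorted leq (map val z) && asc_sub (jump (map val z)) (map val w).
Proof.
have stepP (k k' : 'I_n) : k' = k.+1 :> nat -> forall x0,
    nth x0 (biword z w) k = (tnth z k, tnth w k) /\ nth x0 (biword z w) k.+1 = (tnth z k', tnth w k').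
  by move=> e x0; rewrite -e -!tnth_nth !tnth_mktuple.
have ne (k : 'I_n) : ('I_n * 'I_n)%type by exact: (k, k).
have [n0|n0] := posnP n.
  have s0 (m : nat) (T : Type) (t : m.-tuple T) : m = 0%N -> tval t = [::].
    by move=> e; apply: size0nil; rewrite size_tuple.
  by rewrite (s0 _ _ (biword z w) n0) (s0 _ _ z n0) (s0 _ _ w n0).
pose x0 := ne (Ordinal n0).
apply/(sortedP x0)/andP=> [h|[/(sortedP 0%N) hz /asc_subP hw] i].
  have h' (k k' : 'I_n) : k' = k.+1 :> nat -> (tnth z k < tnth z k')%N ||
      (tnth z k == tnth z k') && (tnth w k' <= tnth w k)%N.
    move=> e; have := h k; rewrite size_tuple -e ltn_ord => /(_ isT).
    by have [-> ] := stepP _ _ e x0; rewrite -e => ->; rewrite bikey_le.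
  split.
    apply/(sortedP 0%N) => i; rewrite size_map size_tuple => lt.
    have := h' (Ordinal (ltnW lt)) (Ordinal lt) erefl.
    rewrite -[X in nth _ _ X]/(val (Ordinal (ltnW lt))) -[X in (_ <= nth _ _ X)%N]/(val (Ordinal lt)) !nth_word.
    by case/orP=> [/ltnW //|/andP[/eqP -> _]].
  apply/asc_subP=> [[//|d]] /and3P[_]; rewrite size_map size_tuple /= => lt.
  have := h' (Ordinal (ltnW lt)) (Ordinal lt) erefl.
  rewrite /jump /= -![nth _ _ d]/(nth _ _ (val (Ordinal (ltnW lt)))) -![nth _ _ d.+1]/(nth _ _ (val (Ordinal lt))) !nth_word.
  by case/orP=> [ltz _|/andP[_ ge]]; [rewrite ltn_eqF | rewrite ltnNge ge].
rewrite size_tuple => lt.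
have [-> ->] := stepP (Ordinal (ltnW lt)) (Ordinal lt) erefl x0.
have := hz i; rewrite size_map size_tuple => /(_ lt); have := hw i.+1.
rewrite /asc size_map size_tuple lt /jump /=.
rewrite -![nth _ _ i]/(nth _ _ (val (Ordinal (ltnW lt)))) -![nth _ _ i.+1]/(nth _ _ (val (Ordinal lt))) !nth_word.
rewrite bikey_le /= [(tnth z _ <= _)%N]leq_eqVlt -val_eqE /= => hh /orP[/eqP e|->//].
move: hh; rewrite (val_inj e) eqxx ltnn /=.
by case: leqP => // _ /(_ isT).
Qed.

(** For a fixed upper word z, the lower words of sorted biwords are those with ascents among the
    jumps of z, and [altsum_fits] evaluates their alternating sum. *)
Lemma sum_psi_word (C : pred (n.-tuple 'I_n)) :
  (forall w w', perm_eq w w' -> C w = C w') ->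
  \sum_(g : 'S_n) (\sum_(w | word_fix g w) alt (vla la) w) *
      #|[pred z | C z && word_fix g z]|%:R =
  n`!%:R * \sum_(z : n.-tuple 'I_n | C z && sorted leq (map val z))
     #|[pred w : n.-tuple 'I_n | asc_sub (jump (map val z)) (map val w) & fits (vla la) w]|%:R.
Proof.
move=> C_perm.
pose pz (p : n.-tuple ('I_n * 'I_n)) : n.-tuple 'I_n := [tuple (tnth p k).1 | k < n].
pose pw (p : n.-tuple ('I_n * 'I_n)) : n.-tuple 'I_n := [tuple (tnth p k).2 | k < n].
have pzK z w : pz (biword z w) = z by apply: eq_from_tnth => k; rewrite !tnth_mktuple.
have pwK z w : pw (biword z w) = w by apply: eq_from_tnth => k; rewrite !tnth_mktuple.
pose f p := (C (pz p))%:R * alt (vla la) (pw p).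
have f_perm (p q : n.-tuple ('I_n * 'I_n)) : perm_eq p q -> f p = f q.
  move=> /tuple_permP[s e]; rewrite /f; congr (_%:R * _).
    congr nat_of_bool; apply/C_perm/tuple_permP; exists s; congr val.
    apply: eq_from_tnth => k; rewrite !tnth_mktuple.
    by rewrite (_ : p = [tuple tnth q (s i) | i < n]) ?tnth_mktuple //; apply: val_inj.
  apply: alt_perm; apply/tuple_permP; exists s; congr val.
  apply: eq_from_tnth => k; rewrite !tnth_mktuple.
  by rewrite (_ : p = [tuple tnth q (s i) | i < n]) ?tnth_mktuple //; apply: val_inj.
have bwsum (P : pred (n.-tuple ('I_n * 'I_n))) (F : n.-tuple ('I_n * 'I_n) -> algC) :
   \sum_(p | P p) F p = \sum_z \sum_(w | P (biword z w)) F (biword z w).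
  by rewrite pair_big_dep (reindex _ (onW_bij _ biword_bij)).
transitivity (\sum_(g : 'S_n) \sum_(p | word_fix g p) f p).
  apply: eq_bigr => g _; rewrite bwsum -sum1_card natr_sum mulrC big_distrl /= big_mkcond.
  apply: eq_bigr => z _; rewrite inE mul1r.
  under [RHS]eq_bigl do rewrite biword_fix.
  case: (word_fix g z); last by rewrite andbF big_pred0.
  rewrite andbT.
  rewrite /f; under [RHS]eq_bigr do rewrite pzK pwK; rewrite -big_distrr /=.
  by case: (C z); rewrite ?mul1r ?mul0r.
rewrite (sum_fixed_sorted bikey_inj f_perm); congr (_ * _).
rewrite bwsum [RHS]big_mkcond; apply: eq_bigr => z _ /=.
under eq_bigl do rewrite biword_sorted.
under eq_bigr do rewrite /f pzK pwK.
rewrite -big_distrr /=; case: (C z); last by rewrite mul0r.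
rewrite mul1r; case: (sorted _ _); last by rewrite big_pred0.
by rewrite -(altsum_fits _ _ (@vla_dec _ la)).
Qed.

Let sorted_geq_nth z (i j : nat) : sorted leq (map val z) -> (i <= j < n)%N ->
  (nth 0%N (map val z) i <= nth 0%N (map val z) j)%N.
Proof.
move=> zs /andP[ij jn]; apply: (sorted_leq_nth leq_trans leqnn 0%N zs) => //;
  by rewrite inE size_map size_tuple // (leq_ltn_trans ij).
Qed.

(** Analogue of the fact that row i of a semistandard tableau has entries at least i. If w_k = x +
    1, the ballot condition provides an earlier letter x. At an ascent z jumps, so z_k exceeds the
    value of z at that letter, which is at least x; otherwise w_k <= w_(k-1) <= z_(k-1) <= z_k. *)
Lemma fits_le_sorted z w : sorted leq (map val z) ->
  asc_sub (jump (map val z)) (map val w) -> fits (vla la) w ->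
  forall k, (tnth w k <= tnth z k)%N.
Proof.
move=> zs /asc_subP wz /andP[/ballotP wb _] k; rewrite -!nth_word.
have [m] := ubnP (val k); elim: m k => // m IH k km.
have prev (x : 'I_n) : tnth w k = x.+1 :> nat -> exists2 k' : 'I_n, (k' < k)%N & tnth w k' = x.
  move=> e; have lt : (x < tnth w k)%N by rewrite e.
  have := wb k.+1 x (tnth w k) lt; rewrite !count_takeE.
  have : (0 < #|[pred y : 'I_n | (y < k.+1)%N && (tnth w y == tnth w k)]|)%N.
    by apply/card_gt0P; exists k; rewrite inE ltnSn eqxx.
  move=> h1 h2; have /card_gt0P[k'] := leq_trans h1 h2.
  rewrite inE ltnS leq_eqVlt => /andP[/orP[/eqP/val_inj ek|lt'] /eqP ew]; last by exists k'.
  by move: lt; rewrite -ek ew ltnn.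
case wk: (nth 0%N (map val w) k) => [//|x]; rewrite nth_word in wk.
have xn : (x < n)%N by apply: ltn_trans (ltn_ord (tnth w k)); rewrite wk.
have [k' lt' ew] := prev (Ordinal xn) wk.
have k0 : (0 < k)%N by apply: leq_ltn_trans lt'.
have pn : (k.-1 < n)%N by apply: leq_ltn_trans (leq_pred k) (ltn_ord k).
have [/wz jk|na] := boolP (asc (map val w) k).
  have le1 : (x <= nth 0 (map val z) k')%N.
    have -> : x = nth 0%N (map val w) k' by rewrite nth_word ew.
    by apply: IH; apply: leq_trans lt' _; rewrite -ltnS.
  have le2 : (nth 0 (map val z) k' <= nth 0 (map val z) k.-1)%N.
    by apply: sorted_geq_nth; rewrite // pn -ltnS prednK // lt'.
  apply: leq_ltn_trans (leq_trans le1 le2) _; rewrite ltn_neqAle; apply/andP; split=> //.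
  by apply: sorted_geq_nth; rewrite // leq_pred ltn_ord.
move: na; rewrite /asc k0 size_map size_tuple ltn_ord /= -leqNgt nth_word wk => le1.
apply: leq_trans le1 _; apply: (@leq_trans (nth 0 (map val z) k.-1)%N).
  by apply: (IH (Ordinal pn)); rewrite /= -ltnS prednK // -ltnS.
by apply: sorted_geq_nth; rewrite // leq_pred ltn_ord.
Qed.

Definition has_content s z : bool := [forall i, count_mem i z + rho (s i) == vla la i]%N.

Lemma has_content_perm s z z' : perm_eq z z' -> has_content s z = has_content s z'.
Proof. by move=> /seq.permP e; apply: eq_forallb => i; rewrite e. Qed.

(** The same equation without truncated subtraction, as rho i = n - 1 - i. *)
Lemma has_contentP s z :
  reflect (forall i, count_mem i z + i = lam la i + s i)%N (has_content s z).
Proof.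
have E i (c d : nat) : (c + rho (s i) == d + rho i)%N = (c + i == d + s i)%N.
  rewrite -(eqn_add2r (s i).+1) -addnA subnK // -(eqn_add2r i.+1) [RHS]eq_sym eq_sym.
  rewrite -addnA [((s i).+1 + _)%N]addnC addnA -[(d + rho i + _)%N]addnA subnK //.
  by rewrite -addnA -[(c + n + _)%N]addnA ![(n + _)%N]addnC !addnA eqn_add2r !addnS eqSS eq_sym.
apply: (iffP forallP) => h i; last by rewrite /vla E h.
by apply/eqP; rewrite -E; apply: h.
Qed.

Lemma fits_content w : fits (vla la) w = ballot w && has_content 1 w.
Proof. by congr (_ && _); apply: eq_forallb => i; rewrite perm1. Qed.

Lemma sum_letters z : (\sum_k tnth z k = \sum_(i < n) i * count_mem i z)%N.
Proof.
rewrite (partition_big (tnth z) predT) //=; apply: eq_bigr => i _.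
rewrite count_tupleE -sum1_card big_distrr /=; apply: eq_big => // k /eqP->.
by rewrite muln1.
Qed.

(** Equality case of the rearrangement inequality, from 2 i s(i) <= i^2 + s(i)^2 summed over i. *)
Lemma perm_sum_sqr s : (\sum_(i < n) i * i <= \sum_(i < n) i * s i)%N -> s = 1%g.
Proof.
move=> le.
have := leqif_sum (fun (i : 'I_n) (_ : true) => nat_Cauchy i (s i)).
have -> : (\sum_(i < n) (i ^ 2 + s i ^ 2) = \sum_(i < n) 2 * (i * i))%N.
  have e : (\sum_(i < n) s i ^ 2 = \sum_(i < n) i ^ 2)%N.
    by rewrite [RHS](reindex_inj (@perm_inj _ s)).
  rewrite big_split /= e -big_split.
  by apply: eq_bigr => i _; rewrite mulnn mul2n -addnn.
rewrite -!big_distrr /= => -[le1]; rewrite eqn_leq le1 leq_mul2l le orbT => /esym/forallP h.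
by apply/permP=> i; rewrite perm1; apply/esym/val_inj/eqP/h.
Qed.

(** Weighting the equation of [has_contentP] by i and summing shows that z has a smaller letter sum
    than a word of content lambda, strictly unless s = 1. *)
Lemma content_letters s z w : has_content s z -> has_content 1 w ->
  (\sum_k tnth z k + \sum_(i < n) i * i = \sum_k tnth w k + \sum_(i < n) i * s i)%N.
Proof.
move=> /has_contentP hz /has_contentP hw; rewrite !sum_letters -!big_split /=.
apply: eq_bigr => i _; rewrite -!mulnDr hz; congr (_ * (_ + _))%N.
by have := hw i; rewrite perm1 => /addIn.
Qed.

(** The pairs (z, w) play the role of semistandard tableaux of shape lambda and content that of z.
    From w <= z letterwise and [content_letters] follow s = 1 and equal letter sums, hence w = z:
    the Kostka number of lambda with itself is 1. *)
Lemma card_fits_sorted s :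
  \sum_(z : n.-tuple 'I_n | has_content s z && sorted leq (map val z))
     #|[pred w : n.-tuple 'I_n | asc_sub (jump (map val z)) (map val w) & fits (vla la) w]|%:R
  = (s == 1%g)%:R :> algC.
Proof.
have key z w : sorted leq (map val z) -> has_content s z ->
    asc_sub (jump (map val z)) (map val w) -> fits (vla la) w -> s = 1%g /\ w = z.
  move=> zs zc wz wf; have le := fits_le_sorted zs wz wf.
  have /andP[_ wc] : ballot w && has_content 1 w by rewrite -fits_content.
  have e := content_letters zc wc.
  have le' : (\sum_k tnth w k <= \sum_k tnth z k)%N by apply: leq_sum => k _; apply: le.
  have s1 : s = 1%g.
    by apply: perm_sum_sqr; rewrite -(leq_add2l (\sum_k tnth w k)) -e leq_add2r.
  split=> //; move: e; rewrite s1; under [X in _ = (_ + X)%N]eq_bigr do rewrite perm1.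
  move/addIn => e; have := leqif_sum (fun (k : 'I_n) (_ : true) => leqif_eq (le k)).
  case=> _; rewrite e eqxx => /esym/forallP h; apply: eq_from_tnth => k.
  exact/val_inj/eqP/h.
have [s1|ne] := eqVneq s 1%g; last first.
  rewrite big1 // => z /andP[zc zs]; rewrite eq_card0 // => w; rewrite inE.
  by apply/negP=> /andP[wz wf]; have [e _] := key z w zs zc wz wf; rewrite e eqxx in ne.
have : (0 < #|[pred y : n.-tuple 'I_n | sorted (@geo n) y & [forall i, count_mem i y == lam la i]]|)%N.
  by rewrite card_sorted_content sum_lam eqxx.
case/card_gt0P=> y; rewrite inE => /andP[ys /forallP yc].
pose z0 : n.-tuple 'I_n := rev_tuple y.
have z0s : sorted leq (map val z0) by rewrite sorted_map /= rev_sorted.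
have z0c : has_content 1 z0.
  by apply/has_contentP=> i; rewrite perm1 /= count_rev (eqP (yc i)).
have uniq_z z : has_content 1 z -> sorted leq (map val z) -> z = z0.
  move=> /has_contentP zc zs; apply/val_inj; apply: (inj_map val_inj).
  apply: (sorted_eq leq_trans anti_leq) => //; apply: perm_map; apply: eq_count_perm => i.
  by have := zc i; have /has_contentP/(_ i) := z0c; rewrite perm1 => <- /addIn.
(* In an increasing word, once some j has been read every i < j has been read as well, and lambda_j
   <= lambda_i. *)
have z0b : ballot z0.
  apply/ballotP=> k i j ij.
  have : sorted leq (map val (take k z0 ++ drop k z0)) by rewrite cat_take_drop.
  rewrite (sorted_pairwise leq_trans) map_cat pairwise_cat.
  case/and3P=> /allrelP al _ _.
  have [->//|] := posnP (count_mem j (take k z0)); rewrite -has_count has_pred1 => jz.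
  have iz : count_mem i (drop k z0) = 0%N.
    apply/count_memPn/negP=> iz.
    by have := al _ _ (map_f val jz) (map_f val iz); rewrite leqNgt ij.
  have c0 x : count_mem x z0 = lam la x by rewrite /= count_rev (eqP (yc x)).
  have <- : count_mem i z0 = count_mem i (take k z0).
    by rewrite -{1}(cat_take_drop k z0) count_cat iz addn0.
  rewrite c0; apply: leq_trans (lam_dec la (ltnW ij)); rewrite -c0.
  by rewrite -{2}(cat_take_drop k z0) count_cat leq_addr.
have z0f : fits (vla la) z0 by rewrite fits_content z0b z0c.
have z0a : asc_sub (jump (map val z0)) (map val z0).
  by apply/asc_subP=> d /and3P[_ _ lt]; rewrite /jump ltn_eqF.
rewrite (big_pred1 z0) => [|z]; last first.
  by apply/andP/eqP=> [[zc zs]|->]; [apply: uniq_z; rewrite -?s1 | rewrite s1].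
congr _%:R; apply: (@eq_card1 _ z0) => w; rewrite !inE.
apply/andP/eqP=> [[wz wf]|->//].
by have [] := key z0 w z0s _ wz wf; rewrite ?s1.
Qed.

Definition content_char s : 'CF([set: 'S_n]) := word_char (@has_content_perm s).

(* Jacobi-Trudi: the alternating sum of the permutation characters on the
   words of content (la + rho) - s.rho. *)
Definition psi : 'CF([set: 'S_n]) := \sum_(s : 'S_n) (-1) ^+ s *: content_char s.

Lemma psiE g : psi g = \sum_(w | word_fix g w) alt (vla la) w.
Proof.
rewrite sum_cfunE /alt (exchange_big_dep predT) //=; apply: eq_bigr => s _.
rewrite cfunE word_charE -sum1_card natr_sum big_distrr /=.
by apply: eq_big => [w|w _]; rewrite ?inE ?mulr1 // andbC.
Qed.

Lemma cfdot_psi_content s : '[psi, content_char s] = (s == 1%g)%:R.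
Proof.
rewrite -card_fits_sorted cfdotE cardsT card_Sn.
have := sum_psi_word (@has_content_perm s) => e.
rewrite (eq_bigl xpredT) => [|g]; last by rewrite inE.
rewrite (eq_bigr (fun g => (\sum_(w | word_fix g w) alt (vla la) w) *
      #|[pred z | has_content s z && word_fix g z]|%:R)); last first.
  by move=> g _; rewrite psiE word_charE rmorph_nat.
by rewrite e mulrA mulVf ?mul1r // pnatr_eq0 -lt0n fact_gt0.
Qed.

Lemma cfnorm_psi : '[psi] = 1.
Proof.
rewrite {2}/psi cfdot_sumr (bigD1 1%g) //= big1 => [|s ne].
  by rewrite odd_perm1 expr0 scale1r cfdot_psi_content eqxx addr0.
by rewrite cfdotZr cfdot_psi_content (negPf ne) mulr0.
Qed.

End FrobeniusFormula.

(** * Characters of Specht modules *)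

(** In a rank factorisation A = C R of an idempotent, R C is the identity of size the rank, and it
    has the same trace. *)
Lemma mxtrace_idempotent (F : fieldType) m (A : 'M[F]_m) :
  A *m A = A -> \tr A = (\rank A)%:R.
Proof.
move=> AA; have e : row_base A *m col_base A = 1%:M.
  apply: (row_free_inj (row_base_free A)); rewrite mul1mx.
  have cf : row_full (col_base A) by apply: col_base_full.
  apply: (row_full_inj cf); rewrite mulmxA mulmxA mulmx_base -mulmxA.
  by rewrite mulmx_base AA.
by rewrite -[in LHS](mulmx_base A) mxtrace_mulC e mxtrace1.
Qed.

(** A differs from the initial segment of size h by as many elements >= h as there are missing
    elements < h; each such exchange adds at least 1 to the sum. *)
Lemma sum_small_le n (A : {set 'I_n}) :
  (\sum_(j < n | j < #|A|) j + #|[set x in A | #|A| <= x]| <= \sum_(x in A) x)%N.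
Proof.
set h := #|A|; pose B := [set j : 'I_n | (j < h)%N].
have hn : (h <= n)%N by rewrite -[n]card_ord max_card.
have cB : #|B| = h.
  rewrite -sum1_card (eq_bigl (fun j : 'I_n => (j < h)%N)) => [|j]; last by rewrite inE.
  by rewrite -(big_ord_widen _ (fun _ => 1%N) hn) sum_nat_const card_ord muln1.
have eAB : #|A :\: B| = #|B :\: A|.
  by apply/eqP; rewrite -(eqn_add2l #|A :&: B|) cardsID setIC cardsID cB.
have -> : [set x in A | (h <= x)%N] = A :\: B.
  by apply/setP=> x; rewrite !inE -leqNgt; apply: andbC.
rewrite (eq_bigl (fun j => j \in B)) => [|j]; last by rewrite inE.
rewrite (big_setID A) /= [X in (_ <= X)%N](big_setID B) /= setIC -addnA leq_add2l.
apply: (@leq_trans (\sum_(i in A :\: B) h)%N); last first.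
  by apply: leq_sum => i; rewrite !inE -leqNgt => /andP[].
rewrite sum_nat_const eAB -sum_nat_const -sum1_card -big_split /=.
by apply: leq_sum => i; rewrite !inE addn1 => /andP[].
Qed.

Lemma down_closed_card n (P : pred 'I_n) :
  (forall i j : 'I_n, (i <= j)%N -> P j -> P i) ->
  forall j : 'I_n, P j = (j < #|P|)%N.
Proof.
move=> dP j.
have cs (k : nat) : (k <= n)%N -> #|[pred i : 'I_n | (i < k)%N]| = k.
  move=> kn; rewrite -sum1_card -(big_ord_widen _ (fun _ => 1%N) kn).
  by rewrite sum_nat_const card_ord muln1.
have [Pj|nP] := boolP (P j).
  rewrite -[X in (X <= _)%N](cs j.+1 (ltn_ord j)); symmetry; apply: subset_leq_card.
  by apply/subsetP=> i; rewrite !inE ltnS => /dP; apply.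
apply/esym/negbTE; rewrite -leqNgt -[X in (_ <= X)%N](cs j (ltnW (ltn_ord j))).
apply: subset_leq_card; apply/subsetP=> i Pi; rewrite !inE ltnNge.
by apply: contraNN nP => /dP; apply.
Qed.

(** * The sign character of a column stabiliser *)

Section Specht.

Variables (n : nat) (la : part n) (t : tableau la).
Implicit Types (s g : 'S_n) (w : n.-tuple 'I_n).

Let T k : cell la := val t k.

Let T_inj : injective T.
Proof. exact/injectiveP/(valP t). Qed.

Let T_inv : exists2 Ti : cell la -> 'I_n, cancel T Ti & cancel Ti T.
Proof.
have [Ti h1 h2] : bijective T by apply: inj_card_bij => //; rewrite card_cell card_ord.
by exists Ti.
Qed.

Definition colstab : {set 'S_n} := [set s | col_stab t s].

Definition colinj w : bool :=
  [forall k, forall k', (col_of (T k) == col_of (T k')) && (tnth w k == tnth w k') ==> (k == k')].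

(** For a character phi, the multiplicity of the sign character of the column stabiliser in the
    restriction of phi. *)
Definition sign_mult (phi : 'S_n -> algC) : algC :=
  (\sum_(s in colstab) (-1) ^+ s * phi s) / #|colstab|%:R.

Lemma colstabP s : reflect (forall k, col_of (T (s k)) = col_of (T k)) (s \in colstab).
Proof. by rewrite inE; apply: (iffP forallP) => h k; apply/eqP; rewrite h. Qed.

Lemma colstab1 : 1%g \in colstab.
Proof. by apply/colstabP=> k; rewrite perm1. Qed.

Lemma colstabM s g : s \in colstab -> (s * g \in colstab)%g = (g \in colstab).
Proof.
move=> /colstabP sC; apply/colstabP/colstabP=> h k; last by rewrite permM h sC.
by have := h (s^-1%g k); rewrite permM permKV => ->; rewrite -{2}(permKV s k) sC.
Qed.

Lemma card_colstab_gt0 : (0 < #|colstab|)%N.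
Proof. by apply/card_gt0P; exists 1%g; apply: colstab1. Qed.

(** If two letters of a column agree, their transposition fixes w and the signs cancel in pairs;
    otherwise only the identity fixes w. *)
Lemma sign_sum_fix w :
  \sum_(s in colstab | word_fix s w) (-1) ^+ s = (colinj w)%:R :> algC.
Proof.
have [/forallP ci|] := boolP (colinj w).
  rewrite (big_pred1 1%g) ?odd_perm1 // => s.
  apply/andP/eqP=> [[/colstabP sC /forallP sw]|->]; last first.
    by split; [apply: colstab1 | apply/forallP=> k; rewrite perm1].
  apply/permP=> k; rewrite perm1; apply/eqP.
  by have /forallP/(_ k)/implyP := ci (s k); rewrite sC eqxx sw; apply.
rewrite negb_forall => /existsP[k]; rewrite negb_forall => /existsP[k'].
rewrite negb_imply => /andP[/andP[/eqP ec /eqP ew] ne].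
have uC : tperm k k' \in colstab.
  by apply/colstabP=> i; case: tpermP => [->|->|].
have uw : word_fix (tperm k k') w.
  by apply/forallP=> i; case: tpermP => [->|->|] //; rewrite ew.
set S := LHS; suff : S = - S by move/eqP; rewrite eq_sym eqNr => /eqP.
rewrite /S [LHS](reindex_inj (mulgI (tperm k k'))) -sumrN /=.
apply: eq_big => [s|s _]; last by rewrite odd_permM odd_tperm ne signr_addb mulN1r.
rewrite colstabM //; congr (_ && _); apply/forallP/forallP=> h i.
  by have := h (tperm k k' i); rewrite permM tpermK => /eqP ->; rewrite (eqP (forallP uw i)).
by rewrite permM (eqP (h _)); apply: (forallP uw).
Qed.

Lemma sign_mult_word (C : pred (n.-tuple 'I_n)) (CP : forall w w', perm_eq w w' -> C w = C w') :
  sign_mult (word_char CP) = #|[pred w | C w && colinj w]|%:R / #|colstab|%:R.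
Proof.
congr (_ / _); rewrite -sum1_card natr_sum [RHS]big_mkcond /=.
under eq_bigr do rewrite word_charE -sum1_card natr_sum big_distrr /=.
rewrite (exchange_big_dep predT) //=; apply: eq_bigr => w _.
under eq_bigr do rewrite mulr1.
under eq_bigl do rewrite [w \in _]inE /=.
rewrite inE; case: (C w) => /=; last by rewrite big_pred0 // => s; rewrite andbF.
by rewrite sign_sum_fix; case: colinj.
Qed.

Definition row_word_t : n.-tuple 'I_n := [tuple row_of (T k) | k < n].

Lemma row_word_content : has_content la 1 row_word_t.
Proof.
have [Ti TK TiK] := T_inv.
apply/has_contentP=> i; rewrite perm1 count_tupleE -card_row -(card_image T_inj).
congr (_ + _)%N; apply: eq_card => c; rewrite inE; apply/imageP/idP=> [[k]|e].
  by rewrite inE tnth_mktuple => e ->.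
by exists (Ti c); rewrite ?inE ?tnth_mktuple TiK.
Qed.

(* Letters in a column are distinct, so their sum is at least the sum of the
   row indices of that column, with a defect for every letter outside of the shape. *)
Lemma colinj_sum w : colinj w ->
  (\sum_k row_of (T k) + #|[pred k | lam la (tnth w k) <= col_of (T k)]| <= \sum_k tnth w k)%N.
Proof.
move=> /forallP ci; have [Ti TK TiK] := T_inv.
rewrite (partition_big (fun k => col_of (T k)) predT) //=.
rewrite [X in (_ <= X)%N](partition_big (fun k => col_of (T k)) predT) //=.
rewrite -sum1_card [X in (_ + X)%N](partition_big (fun k => col_of (T k)) predT) //=.
rewrite -big_split /=; apply: leq_sum => c _.
pose A := [set tnth w k | k in [pred k | col_of (T k) == c]].
have w_inj : {in [pred k | col_of (T k) == c] &, injective (tnth w)}.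
  move=> k k'; rewrite !inE => /eqP e1 /eqP e2 e3; apply/eqP.
  by have /forallP/(_ k')/implyP := ci k; rewrite e1 e2 e3 !eqxx; apply.
have r_inj : {in [pred k | col_of (T k) == c] &, injective (fun k => row_of (T k))}.
  by move=> k k'; rewrite !inE => /eqP e1 /eqP e2 e3; apply/T_inj/cell_eq; rewrite // e1.
have A_sum (F : 'I_n -> nat) : (\sum_(k | col_of (T k) == c) F (tnth w k) = \sum_(x in A) F x)%N.
  by rewrite big_imset.
have rE : [set row_of (T k) | k in [pred k | col_of (T k) == c]] = [set j : 'I_n | (c < lam la j)%N].
  apply/setP=> j; rewrite inE; apply/imsetP/idP=> [[k + ->]|lt].
    by rewrite inE => /eqP <-; apply: cell_lt.
  by have [d e1 e2] := cell_exists lt; exists (Ti d); rewrite ?inE TiK ?e1 ?e2.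
have cA : #|A| = #|[pred j : 'I_n | (c < lam la j)%N]|.
  by rewrite card_in_imset // -(card_in_imset r_inj) rE cardsE.
(* Column c occupies exactly the first #|A| rows, so a letter falls outside of the shape when it is
   at least #|A|. *)
have hP (j : 'I_n) : (c < lam la j)%N = (j < #|A|)%N.
  rewrite cA -(down_closed_card (P := [pred j : 'I_n | (c < lam la j)%N])) //.
  by move=> i j' le; rewrite !inE => lt; apply: leq_trans lt (lam_dec la le).
rewrite (A_sum (fun x => x)).
have -> : (\sum_(k | col_of (T k) == c) row_of (T k) = \sum_(j < n | j < #|A|) j)%N.
  rewrite (eq_bigr (fun k => nat_of_ord (row_of (T k)))) //.
  rewrite -(big_imset (fun j : 'I_n => nat_of_ord j) r_inj) rE.
  by apply: eq_bigl => j; rewrite inE hP.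
apply: leq_trans (sum_small_le A); rewrite leq_add2l.
rewrite (eq_bigl (fun k => (col_of (T k) == c) && (lam la (tnth w k) <= col_of (T k))%N)); last first.
  by move=> k; rewrite inE andbC.
rewrite -sum1_card big_mkcondr [X in (_ <= X)%N](eq_bigl (fun x => (x \in A) && (#|A| <= x)%N)).
  rewrite [X in (_ <= X)%N]big_mkcondr /= -A_sum; apply: leq_sum => k /eqP ->.
  by rewrite [(lam _ _ <= _)%N]leqNgt hP -leqNgt.
by move=> x; rewrite inE.
Qed.

Lemma sum_row_word_t w s : has_content la s w ->
  (\sum_k tnth w k + \sum_(i < n) i * i = \sum_k row_of (T k) + \sum_(i < n) i * s i)%N.
Proof.
move=> ws; rewrite (content_letters ws row_word_content); congr (_ + _)%N.
by apply: eq_bigr => k _; rewrite tnth_mktuple.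
Qed.

(** A word with distinct letters in each column has letter sum at least that of the row indices; for
    s != 1 the content makes the sum smaller. *)
Lemma card_colinj s : s != 1%g -> #|[pred w | has_content la s w && colinj w]| = 0%N.
Proof.
move=> ne; apply: eq_card0 => w; rewrite inE; apply/negP=> /andP[ws wc].
case/eqP: ne; apply: perm_sum_sqr; rewrite -(leq_add2l (\sum_k row_of (T k))).
rewrite -(sum_row_word_t ws) leq_add2r; apply: leq_trans (colinj_sum wc).
exact: leq_addr.
Qed.

(** For content lambda the letter sums agree, so [colinj_sum] has no defect and every letter lies in
    the shape. The word then sends each cell to a cell of its own column, which defines a column
    permutation. *)
Lemma card_colinj1 : #|[pred w | has_content la 1 w && colinj w]| = #|colstab|.
Proof.
have [Ti TK TiK] := T_inv.
pose h s : n.-tuple 'I_n := [tuple row_of (T (s k)) | k < n].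
have h_inj : {in colstab &, injective h}.
  move=> s s' /colstabP sC /colstabP sC' e; apply/permP=> k; apply: T_inj.
  apply: cell_eq; last by rewrite sC sC'.
  by have := congr1 (fun w => tnth w k) e; rewrite !tnth_mktuple.
rewrite -(card_in_imset h_inj); apply: eq_card => w; rewrite inE.
apply/andP/imsetP=> [[w1 wc]|[s /colstabP sC ->]]; last first.
  split.
    have e : perm_eq (h s) row_word_t.
      apply/tuple_permP; exists s; congr val; apply: eq_from_tnth => k.
      by rewrite !tnth_mktuple.
    by rewrite (has_content_perm la 1 e) row_word_content.
  apply/forallP=> k; apply/forallP=> k'; apply/implyP=> /andP[/eqP e1].
  rewrite !tnth_mktuple => /eqP e2; apply/eqP/(@perm_inj _ s)/T_inj/cell_eq => //.
  by rewrite !sC.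
have shape k : (col_of (T k) < lam la (tnth w k))%N.
  rewrite ltnNge; apply/negP=> le.
  have := colinj_sum wc; have := sum_row_word_t w1.
  under [X in _ = (_ + X)%N -> _]eq_bigr do rewrite perm1.
  move/addIn => ->; rewrite -[X in (_ <= X)%N]addn0 leq_add2l leqn0.
  by apply/negP; rewrite -lt0n; apply/card_gt0P; exists k.
have ex k : exists c : cell la, (row_of c == tnth w k) && (col_of c == col_of (T k)).
  by have [c e1 e2] := cell_exists (shape k); exists c; rewrite e1 e2 !eqxx.
pose f k := Ti (xchoose (ex k)).
have fr k : row_of (T (f k)) = tnth w k by rewrite TiK; have /andP[/eqP] := xchooseP (ex k).
have fc k : col_of (T (f k)) = col_of (T k) by rewrite TiK; have /andP[_ /eqP] := xchooseP (ex k).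
have f_inj : injective f.
  move=> k k' e; apply/eqP; move/forallP/(_ k)/forallP/(_ k')/implyP: wc; apply.
  by rewrite -(fc k) -(fc k') -!fr e !eqxx.
exists (perm f_inj); first by apply/colstabP=> k; rewrite permE fc.
by apply: eq_from_tnth => k; rewrite tnth_mktuple permE fr.
Qed.

Lemma sign_mult_content s : sign_mult (content_char la s) = (s == 1%g)%:R.
Proof.
rewrite sign_mult_word; have [->|ne] := eqVneq.
  by rewrite card_colinj1 divff // pnatr_eq0 -lt0n card_colstab_gt0.
by rewrite card_colinj // mul0r.
Qed.

Section SignIdempotent.
Variables (m : nat) (rG : mx_representation algC [set: 'S_n] m).

(** The idempotent onto the sign-isotypic part for the column stabiliser. Its trace is [sign_mult],
    which is thus a rank and hence a natural number. *)
Definition sign_mx : 'M[algC]_m :=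
  #|colstab|%:R^-1 *: \sum_(s in colstab) (-1) ^+ s *: rG s.

Let cne : #|colstab|%:R != 0 :> algC.
Proof. by rewrite pnatr_eq0 -lt0n card_colstab_gt0. Qed.

Lemma sign_mx_idem : sign_mx *m sign_mx = sign_mx.
Proof.
rewrite /sign_mx -scalemxAl mulmx_suml; congr (_ *: _).
transitivity (\sum_(s in colstab) #|colstab|%:R^-1 *: (\sum_(g in colstab) (-1) ^+ g *: rG g)).
  apply: eq_bigr => s sC; rewrite -scalemxAl -scalemxAr scalerA mulrC -scalerA; congr (_ *: _).
  rewrite mulmx_sumr scaler_sumr [RHS](reindex_inj (mulgI s)) /=.
  apply: eq_big => [g|g _]; first by rewrite colstabM.
  by rewrite -scalemxAr scalerA odd_permM signr_addb repr_mxM ?inE.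
by rewrite sumr_const -scaler_nat scalerA mulfV // scale1r.
Qed.

Lemma sign_mult_repr : sign_mult (cfRepr rG) = (\rank sign_mx)%:R.
Proof.
rewrite -(mxtrace_idempotent sign_mx_idem) /sign_mx linearZ linear_sum /= mulrC.
congr (_ * _); apply: eq_bigr => s _; rewrite linearZ /= cfunE inE mulr1n.
by [].
Qed.

Lemma sign_mx_neq0 (A : 'M_m) :
  \sum_(s in colstab) (-1) ^+ s * \tr (A *m rG s) != 0 -> (0 < \rank sign_mx)%N.
Proof.
rewrite lt0n mxrank_eq0; apply: contraNneq => e.
have e' : \sum_(s in colstab) (-1) ^+ s *: rG s = 0.
  by apply: (scalerI (invr_neq0 cne)); rewrite -/sign_mx e scaler0.
rewrite (eq_bigr (fun s => \tr (A *m ((-1) ^+ s *: rG s)))); last first.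
  by move=> s _; rewrite -scalemxAr linearZ.
by rewrite -linear_sum -mulmx_sumr e' mulmx0 linear0.
Qed.

End SignIdempotent.

End Specht.

(** * The Specht character equals psi *)

Section SpechtCharacter.

Variables (n : nat) (la : part n).
Implicit Types (s g h : 'S_n) (t : tableau la).

Local Notation rG := (tabloid_repr la).
Local Notation tau := (cfRepr rG).
Local Notation chi := (specht_char la).

(** A tabloid, listing the row of each entry, is a word of content lambda. *)
Lemma tabloid_charE : tau = content_char la 1.
Proof.
apply/cfunP=> g; rewrite word_charE.
transitivity (#|[pred f : tabloid la | tabloid_act f g == f]|%:R : algC).
  rewrite -(action_charE (@tabloid_act1 n la) (@tabloid_actM n la)).
  by rewrite !cfunE.
congr _%:R; pose h (f : tabloid la) : n.-tuple 'I_n := [tuple val f k | k < n].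
have hE f k : tnth (h f) k = val f k by rewrite tnth_mktuple.
have h_inj : injective h.
  by move=> f f' e; apply/val_inj/ffunP=> k; rewrite -!hE e.
rewrite -(card_image h_inj); apply: eq_card => w; rewrite inE.
apply/imageP/andP=> [[f + ->]|[w1 /forallP wf]].
  rewrite inE => /eqP fg; split.
    have /existsP[t /eqP ft] := valP f.
    suff -> : h f = row_word_t t by apply: row_word_content.
    by apply: eq_from_tnth => k; rewrite hE ft ffunE tnth_mktuple.
  apply/forallP=> k; rewrite !hE -{1}fg ffunE permK; exact: eqxx.
have w1' i : count_mem i w = lam la i.
  by have /has_contentP/(_ i) := w1; rewrite perm1 => /addIn.
have [f f_inj fE] := content_cells w1'.
have tP : injectiveb [ffun k => f k].
  by apply/injectiveP=> k k'; rewrite !ffunE => /f_inj.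
have wP : [exists t : tableau la, [ffun k => tnth w k] == rows_of t].
  apply/existsP; exists (Sub [ffun k => f k] tP); apply/eqP/ffunP=> k.
  by rewrite !ffunE fE.
exists (Sub [ffun k => tnth w k] wP); last first.
  by apply: eq_from_tnth => k; rewrite hE ffunE.
rewrite inE; apply/eqP/val_inj/ffunP=> k; rewrite !ffunE.
by rewrite -{2}(permKV g k) (eqP (wf _)).
Qed.

Lemma tabloid_char_split : exists2 phi : 'CF([set: 'S_n]), phi \is a character & tau = chi + phi.
Proof.
exists (cfRepr (factmod_repr (specht_mxmodule la))); first exact: cfRepr_char.
apply/cfunP=> g; rewrite !cfunE inE !mulr1n.
by rewrite -(mxtrace_sub_fact_mod (specht_mxmodule la)).
Qed.

Lemma tableau_exists : exists t : tableau la, true.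
Proof.
have e : #|cell la| = n := card_cell la.
pose f (k : 'I_n) : cell la := enum_val (cast_ord (esym e) k).
have tP : injectiveb [ffun k => f k].
  by apply/injectiveP=> k k'; rewrite !ffunE => /enum_val_inj/cast_ord_inj.
by exists (Sub [ffun k => f k] tP).
Qed.

(** The tabloid of t has coefficient 1, because a column permutation preserving rows is the
    identity. *)
Lemma polytabloid_neq0 t : polytabloid t != 0.
Proof.
apply/eqP=> /matrixP/(_ 0 (enum_rank (tabloid_of t))).
rewrite mxE summxE (bigD1 1%g) /=; last by apply/forallP=> k; rewrite perm1.
rewrite big1 => [|s /andP[/forallP sC ne]].
  rewrite odd_perm1 expr0 scale1r mxE eqxx /= (inj_eq enum_rank_inj) addr0.
  rewrite (_ : tabl_act t 1 = t) ?eqxx; first by move/eqP; rewrite oner_eq0.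
  by apply/val_inj/ffunP=> k; rewrite tabl_actE invg1 perm1.
rewrite !mxE eqxx /= (inj_eq enum_rank_inj); case: eqP => [e|]; rewrite ?mulr0 //.
case/eqP: ne; apply/permP=> k; rewrite perm1.
have t_inj : injective (val t) by apply/injectiveP/(valP t).
apply: t_inj; apply: cell_eq; last exact/eqP.
have := congr1 (fun f : tabloid la => val f (s k)) e.
by rewrite !ffunE permK.
Qed.

Lemma specht_char_neq0 : chi != 0.
Proof.
have [t _] := tableau_exists.
apply/eqP=> /cfunP/(_ 1%g); rewrite cfRepr1 cfunE => /eqP.
rewrite pnatr_eq0 mxrank_eq0 => /eqP e.
have : (polytabloid t <= specht_mx la)%MS.
  by apply: (sumsmx_sup t) => //; rewrite genmxE.
by rewrite e submx0 (negPf (polytabloid_neq0 t)).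
Qed.

Lemma tableau_act t t' : exists s, t' = tabl_act t s.
Proof.
have t_inj : injective (val t) by apply/injectiveP/(valP t).
have t'_inj : injective (val t') by apply/injectiveP/(valP t').
have [ti tK tiK] : bijective (val t).
  by apply: inj_card_bij => //; rewrite card_cell card_ord.
have f_inj : injective (fun k => ti (val t' k)).
  by move=> k k' /(can_inj tiK)/t'_inj.
exists (perm f_inj)^-1%g; apply/val_inj/ffunP=> k.
by rewrite tabl_actE invgK permE tiK.
Qed.

(* Each constituent of the Specht module meets the sign-isotypic part for the
   column stabiliser, as the polytabloid of t generates the module. *)
Lemma specht_constt t i : '[chi, 'chi_i] != 0 ->
  exists2 m : nat, (0 < m)%N & sign_mult t 'chi_i = m%:R.
Proof.
(* Up to a scalar, P projects onto the isotypic part of 'chi_i. Its trace on the Specht module is n!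
   times '[chi, 'chi_i], so some polytabloid survives P. *)
move=> nz; pose P := \sum_g ('chi_i g)^* *: rG g.
have /existsP[t' nz'] : [exists t' : tableau la, polytabloid t' *m P != 0].
  apply: contraNT nz; rewrite negb_exists => /forallP z.
  have UP : (specht_mx la <= kermx P)%MS.
    apply/sumsmx_subP=> t' _; rewrite genmxE; apply/sub_kermxP/eqP.
    by rewrite -[_ == _]negbK z.
  rewrite cfdotE; apply/eqP; set S := (X in _ * X); suff -> : S = 0 by rewrite mulr0.
  transitivity (\tr (in_submod (specht_mx la) (val_submod 1%:M *m P))).
    rewrite mulmx_sumr !linear_sum; apply: eq_big => [g|g _]; first by rewrite inE.
    by rewrite cfunE inE mulr1n -scalemxAr !linearZ /= mulrC.
  have -> : val_submod 1%:M *m P = 0 :> 'M[algC]_(\rank (specht_mx la), _).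
    by apply/sub_kermxP; apply: submx_trans UP; rewrite val_submod1.
  by rewrite !linear0.
have commP s : rG s *m P = P *m rG s.
  rewrite mulmx_sumr mulmx_suml (reindex_inj (@conjg_inj _ s)).
  apply: eq_bigr => g _; rewrite -scalemxAr -scalemxAl cfunJ ?inE //.
  by rewrite -!repr_mxM ?inE // -conjgC.
have nzt : polytabloid t *m P != 0.
  apply: contraNneq nz' => e; have [s ->] := tableau_act t t'.
  by rewrite -polytabloidM -mulmxA (commP s) mulmxA e mul0mx.
(* The polytabloid is a tabloid times the signed column sum. If all coefficients of the product of
   that sum with P vanished, P would kill the polytabloid. *)
have [h nzh] : exists h, \sum_(s in colstab t) (-1) ^+ s * ('chi_i (s^-1 * h)%g)^* != 0.
  apply/existsP; apply: contraNT nzt; rewrite negb_exists => /forallP z.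
  rewrite /polytabloid (_ : \sum_(s | _) _ = tabloid_vec (tabloid_of t) *m
    \sum_(s in colstab t) (-1) ^+ s *: rG s); last first.
    rewrite mulmx_sumr; apply: eq_big => [s|s _]; first by rewrite inE.
    by rewrite -scalemxAr tabloid_vecM tabloid_of_act.
  rewrite -mulmxA (_ : _ *m P = \sum_h (\sum_(s in colstab t)
     (-1) ^+ s * ('chi_i (s^-1 * h)%g)^* ) *: rG h); last first.
    rewrite mulmx_suml; under [RHS]eq_bigr do rewrite scaler_suml.
    rewrite [RHS]exchange_big; apply: eq_bigr => s _.
    rewrite mulmx_sumr (reindex_inj (mulgI s^-1%g)); apply: eq_bigr => h _.
    by rewrite -scalemxAl -scalemxAr scalerA -repr_mxM ?inE // mulKVg.
  by rewrite big1 ?mulmx0 // => h _; rewrite (eqP (negbNE (z h))) scale0r.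
exists (\rank (sign_mx t 'Chi_i)); last by rewrite -sign_mult_repr irrRepr.
(* The coefficient at h is the signed sum of the traces of Chi_i(h^-1) Chi_i(s), because conjugating
   a character value inverts its argument. *)
apply: (sign_mx_neq0 (A := 'Chi_i h^-1%g)); apply: contraNneq nzh => e.
apply/eqP; rewrite -[RHS]e; apply: eq_bigr => s _; congr (_ * _).
rewrite -repr_mxM ?inE // -char_inv ?irr_char // invMg invgK -irrRepr cfunE inE.
by rewrite mulr1n.
Qed.

Lemma sign_mult_irr t (i : Iirr [set: 'S_n]) : exists m : nat, sign_mult t 'chi_i = m%:R.
Proof. by exists (\rank (sign_mx t 'Chi_i)); rewrite -sign_mult_repr irrRepr. Qed.

Lemma sign_mult_sum t (phi : 'CF([set: 'S_n])) :
  sign_mult t phi = \sum_i '[phi, 'chi_i] * sign_mult t 'chi_i.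
Proof.
rewrite /sign_mult {1}[phi]cfun_sum_cfdot.
under [RHS]eq_bigr do rewrite mulrA; rewrite -big_distrl /=; congr (_ / _).
under [RHS]eq_bigr do rewrite big_distrr.
rewrite [RHS]exchange_big; apply: eq_bigr => s _ /=.
rewrite sum_cfunE big_distrr; apply: eq_bigr => i _.
by rewrite cfunE mulrCA.
Qed.

(** Two class functions of norm 1 that pair to 1 coincide, as their difference has norm 0. *)
Theorem specht_char_psi : chi = psi la.
Proof.
have [t _] := tableau_exists.
have chiC : chi \is a character by apply: cfRepr_char.
pose x (i : Iirr [set: 'S_n]) := '[chi, 'chi_i].
have xN i : x i \in Num.nat by apply: Cnat_cfdot_char_irr.
have MN s i : '[content_char la s, 'chi_i] \in Num.nat.
  by apply: Cnat_cfdot_char_irr => //; apply: word_char_char.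
have le_xa i : x i <= '[content_char la 1, 'chi_i].
  have [phi phiC] := tabloid_char_split; rewrite tabloid_charE => ->.
  by rewrite cfdotDl lerDl natr_ge0 // Cnat_cfdot_char_irr.
have m_ge0 (i : Iirr [set: 'S_n]) : 0 <= sign_mult t 'chi_i by have [m ->] := sign_mult_irr t i.
have m_ge1 (i : Iirr [set: 'S_n]) : x i != 0 -> 1 <= sign_mult t 'chi_i.
  by case/(specht_constt t) => m m0 ->; rewrite ler1n.
have sumM s : \sum_i '[content_char la s, 'chi_i] * sign_mult t 'chi_i = (s == 1%g)%:R.
  by rewrite -sign_mult_sum sign_mult_content.
have term_ge0 s (i : Iirr [set: 'S_n]) : 0 <= '[content_char la s, 'chi_i] * sign_mult t 'chi_i.
  by rewrite mulr_ge0 // natr_ge0.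
have M1 : \sum_i '[content_char la 1, 'chi_i] * sign_mult t 'chi_i = 1 by rewrite sumM eqxx.
have termN s (i : Iirr [set: 'S_n]) : '[content_char la s, 'chi_i] * sign_mult t 'chi_i \in Num.nat.
  by apply: rpredM => //; have [m ->] := sign_mult_irr t i; apply: natr_nat.
(* A sum of natural numbers equal to 1 has a single nonzero term. Every constituent of chi gives a
   nonzero term, so it can only be i0. *)
have [i0 [_ e0] z0] := natr_sum_eq1 (fun (i : Iirr [set: 'S_n]) _ => termN 1%g i) M1.
have a_ge1 (i : Iirr [set: 'S_n]) : x i != 0 -> 1 <= '[content_char la 1, 'chi_i].
  move=> xi; apply: le_trans (le_xa i).
  by have /natrP[m e] := xN i; move: xi; rewrite e pnatr_eq0 ler1n lt0n.
have x_i0 (i : Iirr [set: 'S_n]) : i != i0 -> x i = 0.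
  move=> ne; apply/eqP/negPn/negP=> xi.
  have := mulr_ege1 (a_ge1 i xi) (m_ge1 i xi).
  by rewrite (z0 i ne) // ler10.
have chiE : chi = x i0 *: 'chi_i0.
  rewrite {1}[chi]cfun_sum_cfdot (bigD1 i0) //= big1 ?addr0 // => i ne.
  by rewrite -/(x i) x_i0 // scale0r.
have xi0 : x i0 != 0.
  by apply: contraNneq specht_char_neq0 => e; rewrite chiE e scale0r.
have ai0 : '[content_char la 1, 'chi_i0] = 1.
  apply/eqP; rewrite eq_le a_ge1 // andbT -e0.
  by rewrite ler_peMr ?m_ge1 // (le_trans _ (a_ge1 _ xi0)).
have xi1 : x i0 = 1.
  apply/eqP; rewrite eq_le -{1}ai0 le_xa /=.
  by have /natrP[m e] := xN i0; move: xi0; rewrite e pnatr_eq0 ler1n lt0n.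
rewrite xi1 scale1r in chiE.
(* For s != 1 a sum of nonnegative terms is zero, while the sign multiplicity at i0 is positive. *)
have dot0 s : s != 1%g -> '[content_char la s, chi] = 0.
  move=> ne; have := sumM s; rewrite (negPf ne) => /eqP.
  rewrite psumr_eq0 // => /allP/(_ i0 (mem_index_enum _)) /=.
  rewrite mulf_eq0 chiE => /orP[/eqP //|/eqP m0].
  by have := m_ge1 i0 xi0; rewrite m0 ler10.
have dot1 : '[psi la, chi] = 1.
  rewrite /psi cfdot_suml (bigD1 1%g) //= big1 => [|s ne].
    by rewrite odd_perm1 expr0 scale1r addr0 chiE ai0.
  by rewrite cfdotZl dot0 ?mulr0.
apply/eqP; rewrite -subr_eq0 -cfnorm_eq0 cfnormB.
have -> : '[chi] = 1 by rewrite chiE cfnorm_irr.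
rewrite cfnorm_psi.
have -> : '[chi, psi la] = 1 by rewrite cfdotC dot1 conjC1.
by rewrite conjC1 subrr.
Qed.

End SpechtCharacter.

(** * Moebius inversion and roots of unity *)

Lemma mobiusM p e : prime p -> (0 < e)%N ->
  mobius (p * e) = if (p %| e)%N then 0 else - mobius e.
Proof.
move=> pp e0; have p0 := prime_gt0 pp.
have pe0 : (0 < p * e)%N by rewrite muln_gt0 p0.
have lE q : logn q (p * e) = ((p == q) + logn q e)%N.
  by rewrite lognM // logn_prime // eq_sym.
case: ifPn => [pe|npe].
  rewrite /mobius ifF //; apply/negbTE/allPn; exists p.
    by rewrite mem_primes pp pe0 dvdn_mulr.
  by rewrite lE eqxx eqn_add2l -lt0n logn_gt0 mem_primes pp e0.
have pm : perm_eq (primes (p * e)) (p :: primes e).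
  apply: uniq_perm; first exact: primes_uniq.
    by rewrite /= primes_uniq mem_primes pp e0 npe.
  by move=> q; rewrite primesM // primes_prime // !inE.
rewrite /mobius (perm_all _ pm) (perm_size pm) /= lE eqxx.
rewrite lognE pp e0 (negPf npe) /=.
have -> : all (fun q => logn q (p * e) == 1%N) (primes e) = all (fun q => logn q e == 1%N) (primes e).
  apply: eq_in_all => q; rewrite mem_primes => /and3P[_ _ qe]; rewrite lE.
  by have /negPf-> : p != q by apply: contraNneq npe => ->.
by case: all; rewrite ?oppr0 // exprS mulN1r.
Qed.

Lemma perm_multiples_divisors n h : (0 < n)%N -> (h %| n)%N ->
  perm_eq [seq d <- divisors n | (h %| d)%N] [seq (h * e)%N | e <- divisors (n %/ h)].
Proof.
move=> n0 hn; have h0 : (0 < h)%N by apply: dvdn_gt0 hn.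
have q0 : (0 < n %/ h)%N by rewrite divn_gt0 // dvdn_leq.
apply: uniq_perm; first by rewrite filter_uniq ?divisors_uniq.
  by rewrite map_inj_uniq ?divisors_uniq // => x y /eqP; rewrite eqn_pmul2l // => /eqP.
move=> d; rewrite mem_filter -dvdn_divisors //; apply/andP/mapP => [[hd dn]|[e]].
  exists (d %/ h)%N; last by rewrite mulnC divnK.
  by rewrite -dvdn_divisors // dvdn_divRL // divnK.
rewrite -dvdn_divisors // => en ->; rewrite dvdn_mulr //; split=> //.
by rewrite -(divnK hn) mulnC dvdn_pmul2r.
Qed.

(** For a prime p dividing n, the terms d and p d cancel when p does not divide d; multiples of p^2
    contribute 0. *)
Lemma sum_mobius n : (0 < n)%N -> \sum_(d <- divisors n) mobius d = (n == 1)%N.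
Proof.
move=> n0; case: (ltngtP n 1) => [|n1|->]; [by case: n n0 | | by rewrite big_seq1].
set p := pdiv n; have pp : prime p by apply: pdiv_prime.
have p0 := prime_gt0 pp; have pn : (p %| n)%N by apply: pdiv_dvd.
have q0 : (0 < n %/ p)%N by rewrite divn_gt0 // dvdn_leq.
rewrite (bigID (fun d => p %| d)%N) /= -big_filter.
rewrite (perm_big _ (perm_multiples_divisors n0 pn)) /=.
rewrite big_map (bigID (fun d => p %| d)%N) /= big1_seq ?add0r; last first.
  move=> e /andP[pe]; rewrite -dvdn_divisors // => en.
  by rewrite mobiusM ?pe // (dvdn_gt0 q0 en).
rewrite big_seq_cond (eq_bigr (fun e => - mobius e)) => [|e]; last first.
  rewrite -dvdn_divisors // => /andP[en npe].
  by rewrite mobiusM // ?(negPf npe) // (dvdn_gt0 q0 en).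
rewrite -big_seq_cond sumrN -[X in - X + _]big_filter -[X in _ + X]big_filter.
rewrite (perm_big [seq d <- divisors n | ~~ (p %| d)%N]) ?addNr //=.
apply: uniq_perm; rewrite ?filter_uniq ?divisors_uniq // => d.
rewrite !mem_filter -!dvdn_divisors //; case: (boolP (p %| d)%N) => //= npd.
rewrite -{2}(divnK pn) Gauss_dvdl //.
by rewrite coprime_sym prime_coprime.
Qed.

(* The complementary divisor g %/ t turns the sum into one over divisors of g %/ d. *)
Lemma sum_mobius_codivisor g d : (0 < g)%N ->
  \sum_(t <- divisors g | (d %| t)%N) mobius (g %/ t) = (d == g)%N.
Proof.
move=> g0; have [dg|ndg] := boolP (d %| g)%N; last first.
  rewrite big_seq_cond big_pred0 => [|t]; last first.
    by apply/negP=> /andP[]; rewrite -dvdn_divisors // => tg dt; rewrite (dvdn_trans dt tg) in ndg.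
  by case: eqP ndg => // ->; rewrite dvdnn.
have d0 : (0 < d)%N by apply: dvdn_gt0 dg.
have q0 : (0 < g %/ d)%N by rewrite divn_gt0 // dvdn_leq.
have gg t : (t %| g)%N -> (g %/ (g %/ t) = t)%N.
  by move=> tg; rewrite -{1}(divnK tg) mulKn // divn_gt0 ?(dvdn_gt0 g0 tg) // dvdn_leq.
rewrite -big_filter (perm_big [seq (g %/ e)%N | e <- divisors (g %/ d)]) /=; last first.
  apply: uniq_perm; first by rewrite filter_uniq ?divisors_uniq.
    rewrite map_inj_in_uniq ?divisors_uniq // => x y.
    rewrite -!dvdn_divisors // => xg yg /(congr1 (fun z => g %/ z)%N).
    by rewrite !gg //; apply: dvdn_trans (dvdn_div dg).
  move=> t; rewrite mem_filter -dvdn_divisors //; apply/andP/mapP=> [[dt tg]|[e]].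
    exists (g %/ t)%N; rewrite ?gg // -dvdn_divisors //.
    by rewrite dvdn_divRL // -[X in (_ %| X)%N](divnK tg) dvdn_pmul2l // divn_gt0 ?(dvdn_gt0 g0 tg) // dvdn_leq.
  rewrite -dvdn_divisors // => eg ->; rewrite dvdn_div ?(dvdn_trans eg (dvdn_div dg)) //.
  by split=> //; rewrite dvdn_divRL ?(dvdn_trans eg (dvdn_div dg)) // mulnC -dvdn_divRL.
rewrite big_map big_seq (eq_bigr mobius) => [|e]; last first.
  by rewrite -dvdn_divisors // => eg; rewrite gg // (dvdn_trans eg (dvdn_div dg)).
rewrite -big_seq sum_mobius //; congr (Posz (nat_of_bool _)).
by rewrite -(eqn_pmul2r d0) divnK // mul1n eq_sym.
Qed.

Lemma sum_mobius_divisor g h : (0 < g)%N -> (0 < h)%N ->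
  \sum_(f <- divisors g | (h %| f)%N) mobius (f %/ h) = (h == g)%N.
Proof.
move=> g0 h0; have [hg|nhg] := boolP (h %| g)%N; last first.
  rewrite big_seq_cond big_pred0 => [|t]; last first.
    by apply/negP=> /andP[]; rewrite -dvdn_divisors // => tg ht; rewrite (dvdn_trans ht tg) in nhg.
  by case: eqP nhg => // ->; rewrite dvdnn.
rewrite -big_filter (perm_big _ (perm_multiples_divisors g0 hg)) big_map /=.
under eq_bigr do rewrite mulKn //.
have q0 : (0 < g %/ h)%N by rewrite divn_gt0 // dvdn_leq.
rewrite sum_mobius //; congr (Posz (nat_of_bool _)).
by rewrite -(eqn_pmul2r h0) divnK // mul1n eq_sym.
Qed.

Lemma mobius_inversion (V : zmodType) (B : nat -> V) g : (0 < g)%N ->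
  B g = \sum_(f <- divisors g) \sum_(h <- divisors f) B h *~ mobius (f %/ h).
Proof.
move=> g0; transitivity (\sum_(f <- divisors g) \sum_(h <- divisors g | (h %| f)%N) B h *~ mobius (f %/ h)).
  rewrite (exchange_big_dep predT) //=.
  rewrite (eq_big_seq (fun h => B h *~ (h == g)%N)) => [|h].
    rewrite (bigD1_seq g) ?divisors_uniq ?divisors_id //= eqxx big1 ?addr0 // => h /negPf->.
    exact: mulr0z.
  rewrite -dvdn_divisors // => hg; rewrite -mulrz_sumr; congr (_ *~ _).
  by rewrite sum_mobius_divisor // (dvdn_gt0 g0 hg).
apply: eq_big_seq => f; rewrite -dvdn_divisors // => fg.
have f0 := dvdn_gt0 g0 fg; rewrite -big_filter; apply: perm_big; apply: uniq_perm.
- by rewrite filter_uniq ?divisors_uniq.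
- exact: divisors_uniq.
move=> h; rewrite mem_filter -!dvdn_divisors //; apply/andP/idP => [[]//|hf].
by rewrite hf (dvdn_trans hf fg).
Qed.

(** Summing over t first, the inner sum of mu(g/t) over d | t | g vanishes unless g = d; the
    remaining g is subject to m | g | E. *)
Lemma sum_mu_num d m E : (0 < E)%N ->
  \sum_(t <- divisors E | (d %| t)%N) mu_num t m E = ((m %| d) && (d %| E))%N.
Proof.
move=> E0; rewrite /mu_num (exchange_big_dep (fun g => m %| g)%N) /=; last first.
  by move=> t g _; rewrite dvdn_lcm => /andP[].
rewrite big_seq_cond (eq_bigr (fun g => (d == g)%N : int)); last first.
  move=> g /andP[+ mg]; rewrite -dvdn_divisors // => gE.
  rewrite -sum_mobius_codivisor ?(dvdn_gt0 E0 gE) // -big_filter -[RHS]big_filter.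
  apply: perm_big; apply: uniq_perm; rewrite ?filter_uniq ?divisors_uniq // => t.
  rewrite !mem_filter -!dvdn_divisors ?(dvdn_gt0 E0 gE) // dvdn_lcm mg andbT -andbA.
  by case: (d %| t)%N => //=; apply/andP/idP => [[]//|tg]; rewrite tg (dvdn_trans tg gE).
rewrite -big_seq_cond big_mkcond /=.
have [dE|nd] := boolP (d %| E)%N; last first.
  rewrite andbF big1_seq // => g; rewrite -dvdn_divisors //= => gE.
  by case: ifP => // _; case: eqP nd => // ->; rewrite gE.
rewrite (bigD1_seq d) ?divisors_uniq //= -?dvdn_divisors // eqxx andbT.
rewrite big1 ?addr0; first by case: (m %| d)%N.
by move=> g; rewrite eq_sym => /negPf->; case: ifP.
Qed.

Lemma sum_root_of_unity (F : fieldType) (z : F) n : z ^+ n = 1 ->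
  \sum_(e < n) z ^+ e = if z == 1 then n%:R else 0.
Proof.
move=> zn; case: eqP => [->|/eqP z1].
  by under eq_bigr do rewrite expr1n; rewrite sumr_const card_ord.
apply/eqP; have := subrX1 z n; rewrite zn subrr => /esym/eqP.
by rewrite mulf_eq0 subr_eq0 (negPf z1).
Qed.

Lemma sum_root_of_unity_dvd (F : fieldType) (z : F) n f : (0 < f)%N -> (f %| n)%N ->
  z ^+ n = 1 ->
  \sum_(e < n | (f %| e)%N) z ^+ e = if z ^+ f == 1 then (n %/ f)%:R else 0.
Proof.
move=> f0 /dvdnP[k ->]; rewrite mulnK // mulnC exprM => zn.
rewrite -(sum_root_of_unity zn).
have lt (j : 'I_k) : (f * j < f * k)%N by rewrite ltn_pmul2l.
have lt' (e : 'I_(f * k)) : (e %/ f < k)%N by rewrite ltn_divLR // [(k * f)%N]mulnC.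
rewrite (reindex_onto (fun j => Ordinal (lt j)) (fun e => Ordinal (lt' e))) /=.
  apply: eq_big => [j|j _]; last by rewrite exprM.
  by rewrite dvdn_mulr //=; apply/eqP/val_inj; rewrite /= mulKn.
by move=> e fe; apply: val_inj; rewrite /= mulnC divnK.
Qed.

(* B is expanded as a divisor sum (Moebius inversion), which reduces the
   identity to one between sums of roots of unity. *)
Lemma sum_mu_fourier (V : lmodType algC) (A B : nat -> V) (a m r : nat) (omega zeta : algC) :
  (0 < a)%N -> (0 < m)%N -> (0 < r)%N -> (r <= a)%N ->
  a.-primitive_root omega -> (a * m).-primitive_root zeta ->
  (forall t, (0 < t <= a * m)%N ->
     A t = (a * m)%:R^-1 *: \sum_(e < a * m) zeta^-1 ^+ (e * t) *: B (gcdn e (a * m))) ->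
  \sum_(t <- divisors (r * m)) (mu_num t m (r * m))%:~R *: A t =
  a%:R^-1 *: \sum_(k < a) omega ^+ (r * k) *: B (gcdn k a).
Proof.
move=> a0 m0 r0 ra om zt AE; set n := (a * m)%N.
have n0 : (0 < n)%N by rewrite muln_gt0 a0.
have rm0 : (0 < r * m)%N by rewrite muln_gt0 r0.
(* The Moebius transform of B, so that B g is the sum of [be f] over the divisors f of g. *)
pose be f := \sum_(h <- divisors f) B h *~ mobius (f %/ h).
have BE g : (g %| n)%N -> B g = \sum_(f <- divisors n | (f %| g)%N) be f.
  move=> gn; have g0 := dvdn_gt0 n0 gn; rewrite (mobius_inversion B g0) -[RHS]big_filter.
  apply: perm_big; apply: uniq_perm; rewrite ?filter_uniq ?divisors_uniq // => f.
  rewrite mem_filter -!dvdn_divisors //; apply/idP/andP => [fg|[]//].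
  by rewrite fg (dvdn_trans fg gn).
have zt1 : zeta^-1 ^+ n = 1 by rewrite exprVn (prim_expr_order zt) invr1.
have om1 : omega ^+ a = 1 := prim_expr_order om.
have nz (k : nat) : (0 < k)%N -> k%:R != 0 :> algC by rewrite pnatr_eq0 -lt0n.
(* Both sides reduce to this sum. As n = a m, the two conditions mean f | a and a | r f, that is,
   omega^(r f) = 1. *)
transitivity (\sum_(f <- divisors n) ((m %| n %/ f)%N && (n %/ f %| r * m)%N)%:R / f%:R *: be f).
  have AE' t : t \in divisors (r * m) -> A t = \sum_(f <- divisors n)
     ((n %/ f %| t)%N%:R / f%:R) *: be f.
    rewrite -dvdn_divisors // => trm; have t0 := dvdn_gt0 rm0 trm.
    (* Here r <= a is used: a divisor t of r m satisfies t <= a m. *)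
    rewrite AE; last by rewrite t0 (leq_trans (dvdn_leq rm0 trm)) // leq_mul2r ra orbT.
    rewrite (eq_bigr (fun e : 'I_n => \sum_(f <- divisors n | (f %| e)%N) zeta^-1 ^+ (e * t) *: be f)).
      rewrite (exchange_big_dep predT) //= scaler_sumr; apply: eq_big_seq => f.
      rewrite -dvdn_divisors // => fn; have f0 := dvdn_gt0 n0 fn.
      rewrite -scaler_suml scalerA; congr (_ *: _).
      under eq_bigr do rewrite mulnC exprM.
      rewrite sum_root_of_unity_dvd //; last by rewrite -exprM mulnC exprM zt1 expr1n.
      rewrite -exprM exprVn invr_eq1 -(prim_order_dvd zt).
      rewrite dvdn_divLR // -/n; case: ifP => _; last by rewrite mulr0 mul0r.
      have nf : (n %/ f)%:R * f%:R = n%:R :> algC by rewrite -natrM divnK.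
      apply: (mulIf (nz _ n0)); rewrite mulrAC mulVf ?nz // mul1r -nf mul1r.
      by rewrite mulrCA mulVf ?nz // mulr1.
    move=> e _; rewrite BE ?dvdn_gcdr // scaler_sumr [LHS]big_seq_cond [RHS]big_seq_cond.
    apply: eq_bigl => f; rewrite -dvdn_divisors //; case: (boolP (f %| n)%N) => //= fn.
    by rewrite dvdn_gcd fn andbT.
  transitivity (\sum_(t <- divisors (r * m)) \sum_(f <- divisors n)
      ((mu_num t m (r * m))%:~R * ((n %/ f %| t)%N%:R / f%:R)) *: be f).
    apply: eq_big_seq => t /AE' ->; rewrite scaler_sumr.
    by apply: eq_bigr => f _; rewrite scalerA.
  rewrite exchange_big /=; apply: eq_bigr => f _; rewrite -scaler_suml; congr (_ *: _).
  under eq_bigr do rewrite mulrA; rewrite -big_distrl /=; congr (_ / _).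
  transitivity ((\sum_(t <- divisors (r * m) | (n %/ f %| t)%N) mu_num t m (r * m))%:~R : algC).
    rewrite rmorph_sum [RHS]big_mkcond /=; apply: eq_bigr => t _.
    by case: ifP; rewrite ?mulr1 ?mulr0.
  by rewrite sum_mu_num.
rewrite scaler_sumr.
transitivity (\sum_(k < a) \sum_(f <- divisors n | (f %| gcdn k a)%N)
   (a%:R^-1 * omega ^+ (r * k)) *: be f).
  rewrite (exchange_big_dep predT) //=; apply: eq_big_seq => f.
  rewrite -dvdn_divisors // => fn; have f0 := dvdn_gt0 n0 fn.
  rewrite -scaler_suml; congr (_ *: _).
  have -> : (m %| n %/ f)%N = (f %| a)%N by rewrite dvdn_divRL // mulnC /n dvdn_pmul2r.
  have [fa|nfa] /= := boolP (f %| a)%N; last first.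
    rewrite big_pred0 => [|k]; first by rewrite mul0r.
    by rewrite dvdn_gcd (negPf nfa) andbF.
  under eq_bigl do rewrite dvdn_gcd fa andbT.
  under eq_bigr do rewrite exprM.
  rewrite -big_distrr /= sum_root_of_unity_dvd //; last by rewrite exprAC om1 expr1n.
  rewrite -exprM -(prim_order_dvd om) dvdn_divLR // /n.
  rewrite [(r * m * f)%N]mulnAC dvdn_pmul2r //.
  case: ifP => _; last by rewrite mulr0 mul0r.
  have af : (a %/ f)%:R * f%:R = a%:R :> algC by rewrite -natrM divnK.
  apply: (mulIf (nz _ a0)); rewrite [RHS]mulrAC mulVf ?nz // !mul1r -af.
  by rewrite mulrCA mulVf ?nz // mulr1.
apply: eq_bigr => k _; rewrite BE; last by apply: dvdn_trans (dvdn_gcdr _ _) (dvdn_mulr _ _).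
by rewrite !scaler_sumr; apply: eq_bigr => f _; rewrite scalerA.
Qed.

(** * Major index at a root of unity *)

Definition majw (w : seq nat) : nat := (\sum_(d < size w | asc w d) d)%N.

Section MajorIndex.

Variables (R : comAlgType algC) (l : nat) (x : 'I_l -> R).

Definition weight (w : seq 'I_l) : R := \prod_(i <- w) x i.

Definition power_sum (d : nat) : R := \sum_i x i ^+ d.

Lemma weight_cat u v : weight (u ++ v) = weight u * weight v.
Proof. by rewrite /weight big_cat. Qed.

Lemma weight_perm u v : perm_eq u v -> weight u = weight v.
Proof. by move=> e; apply: perm_big. Qed.

Lemma weight_tuple n (w : n.-tuple 'I_l) : weight w = \prod_k x (tnth w k).
Proof. by rewrite /weight -[X in \prod_(i <- X) _](map_tnth_enum w) big_map big_enum. Qed.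

Section Rotation.
Variable d : nat.
Hypothesis d_gt0 : (0 < d)%N.
Implicit Type w : d.-tuple 'I_l.

(** Position 0 compares the last letter with the first. It adds 0 to the major index, so [majw] is
    also the sum of the cyclic ascents. *)
Let cyc_asc w (j : 'I_d) : bool := (tnth w (ord_pred j) < tnth w j)%N.

Let rotate w : d.-tuple 'I_l := [tuple tnth w (ordS j) | j < d].

Let cyc_asc_rotate w j : cyc_asc (rotate w) j = cyc_asc w (ordS j).
Proof. by rewrite /cyc_asc !tnth_mktuple ordSK ord_predK. Qed.

Let ord_predE (j : 'I_d) : (0 < j)%N -> val (ord_pred j) = j.-1.
Proof.
by move=> j0; rewrite /= -subn1 -addnBAC // subn1 modnDr modn_small // (leq_ltn_trans (leq_pred _)).
Qed.

Let majw_cyc w : majw (map val w) = (\sum_(j | cyc_asc w j) j)%N.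
Proof.
rewrite /majw size_map size_tuple big_mkcond [RHS]big_mkcond /=.
apply: eq_bigr => j _; rewrite /asc size_map size_tuple ltn_ord /=.
have [j0|j0] := posnP j; first by rewrite j0 /= if_same.
by rewrite -(ord_predE j0) !nth_word.
Qed.

Let cdes w := #|cyc_asc w|.

Let cdesE w : cdes w = (\sum_(j | cyc_asc w j) 1)%N.
Proof. by rewrite sum1_card. Qed.

Let cdes_rotate w : cdes (rotate w) = cdes w.
Proof.
rewrite /cdes -!sum1_card [RHS](reindex_inj (@ordS_inj d)) /=.
by apply: eq_bigl => j; apply: cyc_asc_rotate.
Qed.

(** Rotation moves each cyclic ascent down by one modulo d. *)
Let majw_rotate (z : algC) w : z ^+ d = 1 ->
  z ^+ majw (map val (rotate w)) * z ^+ cdes w = z ^+ majw (map val w).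
Proof.
move=> zd; rewrite !majw_cyc -cdes_rotate cdesE -exprD.
rewrite -big_split /= !expr_sum [RHS](reindex_inj (@ordS_inj d)) /=.
apply: eq_big => j; first by rewrite cyc_asc_rotate.
by move=> _; rewrite addn1 (expr_mod _ zd).
Qed.

Let weight_rotate w : weight (rotate w) = weight w.
Proof. by rewrite !weight_tuple [RHS](reindex_inj (@ordS_inj d)); apply: eq_bigr => j _; rewrite tnth_mktuple. Qed.

Let rotate_inj : injective rotate.
Proof.
move=> w w' e; apply: eq_from_tnth => j.
by have := congr1 (fun u => tnth u (ord_pred j)) e; rewrite !tnth_mktuple ord_predK.
Qed.

Let sum_pred (F : 'I_d -> nat) : (\sum_j F (ord_pred j) = \sum_j F j)%N.
Proof. by rewrite [RHS](reindex_inj (@ord_pred_inj d)). Qed.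

(** Letters cannot increase strictly all around a cycle: compare the letter sums of w and of its
    rotation. *)
Let cdes_ltn w : (cdes w < d)%N.
Proof.
rewrite ltn_neqAle -{2}[d]card_ord max_card andbT; apply/eqP=> e.
have all_asc j : cyc_asc w j.
  have /subset_cardP/(_ (subset_predT _)) e' : #|cyc_asc w| = #|'I_d| by rewrite card_ord.
  by have := e' j; rewrite !inE /in_mem /=.
have := sum_pred (fun j => tnth w j); apply/eqP; rewrite ltn_eqF //.
have j0 : 'I_d := Ordinal d_gt0.
rewrite (bigD1 j0) // [X in (_ < X)%N](bigD1 j0) //= -addSn.
apply: leq_add; first exact: all_asc.
by apply: leq_sum => j _; apply/ltnW/all_asc.
Qed.

Let cdes_eq0 w : cdes w = 0%N -> exists i, w = nseq_tuple d i.
Proof.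
move=> /card0_eq e; have le j : (tnth w j <= tnth w (ord_pred j))%N.
  by have := e j; rewrite !inE /in_mem /= /cyc_asc ltnNge => /negbFE.
have eqv j : tnth w (ord_pred j) = tnth w j.
  have [_] := leqif_sum (fun (j : 'I_d) (_ : true) => leqif_eq (le j)).
  by rewrite (sum_pred (fun j => tnth w j)) eqxx => /esym/forallP/(_ j) /eqP/val_inj.
exists (tnth w (Ordinal d_gt0)); apply: eq_from_tnth => j; rewrite tnth_nseq.
have [m] := ubnP (val j); elim: m j => // m IH j jm.
have [j0|j0] := posnP j; first by congr tnth; apply: val_inj.
rewrite -eqv; apply: IH; rewrite ord_predE // -ltnS prednK //.
Qed.

(** Words are grouped by their number c of cyclic ascents. Rotation preserves weights and shows that
    the sum of a group equals z^c times itself, so it is 0 for 0 < c < d; the group c = 0 consists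
    of the constant words. *)
Lemma sum_majw_primitive (z : algC) : d.-primitive_root z ->
  \sum_(w : d.-tuple 'I_l) z ^+ majw (map val w) *: weight w = power_sum d.
Proof.
move=> zp; have zd := prim_expr_order zp.
pose S c := \sum_(w : d.-tuple 'I_l | cdes w == c) z ^+ majw (map val w) *: weight w.
have S0 c : (0 < c < d)%N -> S c = 0.
  move=> /andP[c0 cd]; have zc : z ^+ c != 1.
    by rewrite -(prim_order_dvd zp) gtnNdvd.
  have e : z ^+ c *: S c = S c.
    rewrite {2}/S (eq_bigr (fun w => z ^+ c *: (z ^+ majw (map val (rotate w)) *: weight (rotate w)))).
      rewrite -scaler_sumr; congr (_ *: _); rewrite /S (reindex_inj rotate_inj) /=.
      by apply: eq_bigl => w; rewrite cdes_rotate.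
    by move=> w /eqP <-; rewrite scalerA mulrC majw_rotate // weight_rotate.
  have : (z ^+ c - 1) *: S c = 0 by rewrite scalerBl scale1r e subrr.
  by move/eqP; rewrite scaler_eq0 subr_eq0 (negPf zc) => /eqP.
rewrite (partition_big (fun w => Ordinal (cdes_ltn w)) predT) //=.
rewrite (bigD1 (Ordinal d_gt0)) //= [X in _ + X]big1 ?addr0 => [|c ne]; last first.
  rewrite -[RHS](S0 c) /S; first by apply: eq_bigl => w.
  by rewrite ltn_ord andbT lt0n; apply: contraNneq ne => e; apply/eqP/val_inj.
rewrite (reindex_onto (fun i : 'I_l => nseq_tuple d i) (fun w => tnth w (Ordinal d_gt0))) => [|w /eqP[/cdes_eq0[i ->]]].
  have cn i : cdes (nseq_tuple d i) = 0%N.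
    by apply: eq_card0 => j; rewrite !inE /in_mem /= /cyc_asc !tnth_nseq ltnn.
  apply: eq_big => [i|i _]; first by rewrite tnth_nseq eqxx andbT; apply/eqP/val_inj; rewrite /= cn.
  rewrite weight_tuple (eq_bigr (fun=> x i)) => [|j _]; last by rewrite tnth_nseq.
  rewrite prodr_const card_ord (_ : majw _ = 0%N) ?scale1r // majw_cyc big_pred0 // => j.
  by rewrite /cyc_asc !tnth_nseq ltnn.
by rewrite tnth_nseq.
Qed.

End Rotation.

(* A descent at the border of two blocks, and the shift of the second block, only
   contribute multiples of d. *)
Lemma majw_cat (z : algC) d (u v : seq nat) : size u = d -> z ^+ d = 1 ->
  z ^+ majw (u ++ v) = z ^+ majw u * z ^+ majw v.
Proof.
move=> su zd; rewrite /majw size_cat su !expr_sum.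
rewrite big_mkcond big_split_ord /= [in RHS]big_mkcond [X in _ = _ * X]big_mkcond.
congr (_ * _); apply: eq_bigr => j _.
  rewrite /asc size_cat su ltn_ord ltn_addr // !nth_cat su ltn_ord.
  by rewrite (leq_ltn_trans (leq_pred j)).
rewrite exprD zd mul1r /asc size_cat su ltn_add2l ltn_ord /=.
have [->|j0] := posnP j; first by rewrite !if_same.
by rewrite addn_gt0 j0 orbT -(prednK j0) addnS /= -addnS -su !nth_catD.
Qed.

Lemma sum_majw_blocks (z : algC) d k : (0 < d)%N -> d.-primitive_root z ->
  \sum_(w : (k * d).-tuple 'I_l) z ^+ majw (map val w) *: weight w = power_sum d ^+ k.
Proof.
move=> d0 zp; elim: k => [|k IH].
  rewrite (big_pred1 [tuple]) => [|w]; last by apply/esym/eqP/tuple0.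
  by rewrite /weight /majw /= big_ord0 big_nil scale1r.
rewrite mulSn (big_tuple_cat _ d (k * d) predT (fun w => z ^+ majw (map val w) *: weight w)) /=.
rewrite exprS -IH -(sum_majw_primitive d0 zp) big_distrl; apply: eq_bigr => u _ /=.
rewrite big_distrr; apply: eq_bigr => v _ /=.
rewrite weight_cat map_cat (majw_cat (d := d)) ?size_map ?size_tuple ?(prim_expr_order zp) //.
by rewrite -scalerAl -scalerAr scalerA.
Qed.

(** z^e is a primitive root of order n / gcd(e, n), so words are cut into gcd(e, n) blocks of that
    length. *)
Lemma sum_majw_root (z : algC) n e : (0 < n)%N -> n.-primitive_root z ->
  \sum_(w : n.-tuple 'I_l) z ^+ (e * majw (map val w)) *: weight w =
  power_sum (n %/ gcdn e n) ^+ gcdn e n.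
Proof.
move=> n0 zp; have g0 : (0 < gcdn e n)%N by rewrite gcdn_gt0 n0 orbT.
have gn := dvdn_gcdr e n.
have d0 : (0 < n %/ gcdn e n)%N by rewrite divn_gt0 // dvdn_leq.
under eq_bigr do rewrite exprM.
rewrite -(sum_majw_blocks _ d0 (exp_prim_root zp e)).
have -> : (gcdn e n * (n %/ gcdn e n) = n)%N by rewrite mulnC divnK.
by [].
Qed.

End MajorIndex.

(** * Cycle index of a kernel *)

Section KernelCycles.

Variables (R : comNzRingType) (Om : finType) (K : Om -> Om -> R) (eps : bool).

Definition perm_weight n (s : 'S_n) : R := if eps then (-1) ^+ s else 1.

(** For fixed s the sum over v is the product, over the cycles of s, of the traces of K^m with m the
    cycle length. *)
Definition cyc_sum n : R :=
  \sum_(s : 'S_n) perm_weight s *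
    \sum_(v : {ffun 'I_n -> Om}) \prod_i K (v i) (v (s i)).

Definition ker_comp (J J' : Om -> Om -> R) b c := \sum_d J b d * J' d c.

(** The separate case of exponent 1 makes the first power convertible to K. *)
Fixpoint ker_pow k : Om -> Om -> R :=
  if k is k'.+1 then (if k' is 0 then K else ker_comp K (ker_pow k')) else fun b c => (b == c)%:R.

Definition ker_trace (J : Om -> Om -> R) := \sum_b J b b.

(** The arrow leaving j carries J in place of K; J accumulates the product along the points already
    removed from the cycle of j. *)
Let marked n (j : 'I_n) J (i : 'I_n) := if i == j then J else K.

Let marked_eq n (j : 'I_n) J : marked j J j = J.
Proof. by rewrite /marked eqxx. Qed.

Let marked_neq n (i j : 'I_n) J : i != j -> marked j J i = K.
Proof. by rewrite /marked => /negPf->. Qed.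

Definition marked_sum n (j : 'I_n) J : R :=
  \sum_(s : 'S_n) perm_weight s *
    \sum_(v : {ffun 'I_n -> Om}) \prod_i marked j J i (v i) (v (s i)).

Lemma marked_sum_id n (j : 'I_n) : marked_sum j K = cyc_sum n.
Proof.
apply: eq_bigr => s _; congr (_ * _); apply: eq_bigr => v _; apply: eq_bigr => i _.
by rewrite /marked; case: eqP.
Qed.

Lemma marked_sum_const n (j j' : 'I_n) J : marked_sum j J = marked_sum j' J.
Proof.
rewrite /marked_sum (reindex_inj (@conjg_inj _ (tperm j j'))).
apply: eq_bigr => s _; congr (_ * _); first by rewrite /perm_weight odd_permJ.
pose t := tperm j j'; pose h (v : {ffun 'I_n -> Om}) := [ffun i => v (t i)].
have hK : involutive h by move=> v; apply/ffunP=> i; rewrite !ffunE tpermK.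
rewrite (reindex_inj (inv_inj hK)); apply: eq_bigr => v _.
rewrite (reindex_inj (@perm_inj _ t)) /=; apply: eq_bigr => i _.
rewrite !ffunE tpermK /conjg !permM tpermV tpermK tpermK.
by rewrite /marked -(inj_eq (@perm_inj _ t)) tpermK tpermL.
Qed.

(** Inserts the point 0 into a permutation of the other points, just before x.1 in its cycle, or as
    a fixed point when x.1 = 0. *)
Definition insert0 n (x : 'I_n.+1 * 'S_n) : 'S_n.+1 :=
  (lift_perm ord0 ord0 x.2 * tperm ord0 x.1)%g.

Lemma insert0_0 n x : @insert0 n x ord0 = x.1.
Proof. by rewrite permM lift_perm_id tpermL. Qed.

Lemma insert0_bij n : bijective (@insert0 n).
Proof.
apply: inj_card_bij; last by rewrite card_prod card_ord !card_Sn factS.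
move=> [j s] [j' s'] e.
have ej : j = j' by have := insert0_0 (j, s); rewrite e insert0_0.
congr (_, _) => //; move: e; rewrite /insert0 ej /= => /mulIg e.
apply/permP=> i; apply: (@lift_inj _ ord0).
by rewrite -!(lift_perm_lift ord0 ord0) e.
Qed.

Lemma big_ffunS n (F : {ffun 'I_n.+1 -> Om} -> R) :
  \sum_v F v = \sum_(v : {ffun 'I_n -> Om}) \sum_b F [ffun i => oapp v b (unlift ord0 i)].
Proof.
pose h (x : {ffun 'I_n -> Om} * Om) : {ffun 'I_n.+1 -> Om} :=
  [ffun i => oapp x.1 x.2 (unlift ord0 i)].
rewrite pair_big /= (reindex h) //.
exists (fun v : {ffun 'I_n.+1 -> Om} => ([ffun i : 'I_n => v (lift ord0 i)], v ord0)) => [[v b] _|v _] /=.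
  by congr (_, _); [apply/ffunP=> i; rewrite !ffunE liftK | rewrite ffunE unlift_none].
apply/ffunP=> i; rewrite ffunE; case: unliftP => [i' ->|->] //=.
by rewrite ffunE.
Qed.

(* Removing the point 0 from its cycle: its predecessor becomes the marked point. *)
Lemma marked_sum_rec n J :
  marked_sum (@ord0 n) J = ker_trace J * cyc_sum n +
    (if eps then -1 else 1) * \sum_(i < n) marked_sum i (ker_comp K J).
Proof.
rewrite /marked_sum (reindex _ (onW_bij _ (insert0_bij n))) /=.
rewrite -(pair_big predT predT (fun j s => perm_weight (insert0 (j, s)) *
  \sum_(v : {ffun 'I_n.+1 -> Om}) \prod_i marked ord0 J i (v i) (v (insert0 (j, s) i)))) /=.
(* The first term collects the permutations fixing 0, whose loop contributes the trace of J. *)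
rewrite big_ord_recl; congr (_ + _).
  rewrite mulrC /cyc_sum big_distrl; apply: eq_bigr => s _ /=.
  rewrite -mulrA; congr (_ * _).
    by rewrite /perm_weight /insert0 /= tperm1 mulg1 odd_lift_perm.
  rewrite big_ffunS big_distrl; apply: eq_bigr => v _ /=.
  rewrite /ker_trace big_distrr; apply: eq_bigr => b _ /=.
  rewrite big_ord_recl insert0_0 !ffunE unlift_none /= /marked eqxx mulrC; congr (_ * _).
  apply: eq_bigr => i _; rewrite !ffunE liftK /insert0 /= tperm1 mulg1 lift_perm_lift liftK.
  by [].
rewrite big_distrr /=; under [RHS]eq_bigr do rewrite big_distrr.
rewrite exchange_big [RHS]exchange_big /=; apply: eq_bigr => s _.
(* The image of 0 is written s i, so that i becomes the predecessor of 0; summing over the value b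
   at 0 composes K and J along i, 0, s i. *)
rewrite (reindex_inj (@perm_inj _ s)) /=; apply: eq_bigr => i _.
rewrite mulrA; congr (_ * _).
  rewrite /perm_weight /insert0 /= odd_permM odd_lift_perm odd_tperm neq_lift /=.
  by case: eps; rewrite ?mulr1 // addbT signrN mulN1r.
rewrite big_ffunS; apply: eq_bigr => v _.
rewrite [RHS](bigD1 i) //= marked_eq /ker_comp big_distrl /=; apply: eq_bigr => b _.
rewrite big_ord_recl insert0_0 !ffunE unlift_none liftK marked_eq /=.
rewrite (bigD1 i) //= !ffunE liftK /insert0 /= permM lift_perm_lift tpermR unlift_none.
rewrite marked_neq 1?eq_sym ?neq_lift // [J _ _ * _]mulrCA mulrA; congr (_ * _).
apply: eq_bigr => i' ne.
rewrite !ffunE liftK permM lift_perm_lift tpermD ?neq_lift //; last first.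
  by rewrite (inj_eq lift_inj) (inj_eq perm_inj) eq_sym.
by rewrite liftK /= !marked_neq // eq_sym neq_lift.
Qed.

End KernelCycles.

(** * Partitions as sequences, and the numbers z *)

Definition part_list n : seq (seq nat) := [seq parts la | la <- enum (part n)].

Lemma parts_inj n : injective (@parts n).
Proof. by move=> la mu e; apply/val_inj/val_inj/(inj_map val_inj). Qed.

Lemma part_list_uniq n : uniq (part_list n).
Proof. by rewrite map_inj_uniq ?enum_uniq //; apply: parts_inj. Qed.

Lemma size_le_sumn s : 0%N \notin s -> (size s <= sumn s)%N.
Proof.
elim: s => //= m s IH; rewrite inE negb_or eq_sym -lt0n => /andP[m0 /IH le].
by rewrite -add1n leq_add.
Qed.

Lemma mem_le_sumn s m : m \in s -> (m <= sumn s)%N.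
Proof.
elim: s => //= k s IH; rewrite inE => /orP[/eqP->|/IH le]; first exact: leq_addr.
by apply: leq_trans le (leq_addl _ _).
Qed.

Lemma mem_part_list n s : (s \in part_list n) = is_part n s.
Proof.
apply/mapP/idP=> [[la _ ->]|sP]; first exact: (valP la).
have /and3P[_ s0 /eqP sn] := sP.
have lt m : m \in s -> (m < n.+1)%N by rewrite ltnS -sn; apply: mem_le_sumn.
pose s' : seq 'I_n.+1 := map inord s.
have s'E : map val s' = s.
  by rewrite -map_comp map_id_in // => m /lt mn /=; rewrite inordK.
have sz : (size s' <= n)%N by rewrite size_map -[X in (_ <= X)%N]sn size_le_sumn.
have P : is_part n (map val (Bseq sz)) by rewrite /= s'E.
by exists (exist _ (Bseq sz) P); rewrite ?mem_enum //= /parts /= s'E.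
Qed.

Lemma big_part (V : nmodType) n (F : seq nat -> V) :
  \sum_(la : part n) F (parts la) = \sum_(s <- part_list n) F s.
Proof. by rewrite big_map big_enum. Qed.

Lemma z_partE s m : (sumn s <= m)%N ->
  z_part s = (\prod_(i < m) (i.+1 ^ count_mem i.+1 s * (count_mem i.+1 s)`!))%N.
Proof.
move=> le; rewrite /z_part big_add1 /= big_mkord.
rewrite (big_ord_widen m (fun i => i.+1 ^ count_mem i.+1 s * (count_mem i.+1 s)`!)%N le).
rewrite big_mkcond; apply: eq_bigr => i _; case: ltnP => // si.
by rewrite (count_memPn _) //; apply/negP=> /mem_le_sumn; rewrite ltnNge si.
Qed.

Lemma z_part_cons k s : (0 < k)%N ->
  z_part (k :: s) = (z_part s * (k * (count_mem k s).+1))%N.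
Proof.
case: k => // k _; rewrite (@z_partE (k.+1 :: s) (sumn (k.+1 :: s))) //.
rewrite (@z_partE s (sumn (k.+1 :: s))) ?leq_addl //.
have kn : (k < sumn (k.+1 :: s))%N by rewrite /= leq_addr.
rewrite (bigD1 (Ordinal kn)) //= [in RHS](bigD1 (Ordinal kn)) //= eqxx add1n.
rewrite expnS factS mulnACA -mulnA [LHS]mulnC; congr (_ * _ * _)%N.
apply: eq_bigr => i ne; suff -> : (k.+1 == i.+1) = false by [].
by apply: contraNF ne => /eqP[e]; apply/eqP/val_inj.
Qed.

Lemma z_part_perm s s' : perm_eq s s' -> z_part s = z_part s'.
Proof.
move=> e; rewrite (@z_partE s (sumn s)) // (@z_partE s' (sumn s)) ?(perm_sumn e) //.
by apply: eq_bigr => i _; move/seq.permP: e => ->.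
Qed.

Lemma z_part_gt0 s : (0 < z_part s)%N.
Proof.
rewrite (@z_partE s (sumn s)) // prodn_gt0 // => i.
by rewrite muln_gt0 expn_gt0 fact_gt0.
Qed.

Lemma geq_trans : transitive geq.
Proof. by move=> x y z h1 h2; apply: leq_trans h2 h1. Qed.

Lemma geq_anti : antisymmetric geq.
Proof. by move=> x y; rewrite /geq /= andbC => /anti_leq. Qed.

Lemma geq_total : total geq.
Proof. by move=> x y; rewrite /geq /= leq_total. Qed.

(** Inserting a part k is inverse to removing one copy of k; sorting restores the order of the
    parts. *)
Lemma perm_part_list_insert n k : (0 < k <= n)%N ->
  perm_eq [seq sort geq (k :: s) | s <- part_list (n - k)]
          [seq s <- part_list n | k \in s].
Proof.
move=> /andP[k0 kn]; apply: uniq_perm; last 1 first.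
- move=> s; rewrite mem_filter mem_part_list; apply/mapP/andP=> [[s' + ->]|[ks sP]].
    rewrite mem_part_list mem_sort mem_head => /and3P[_ z0 /eqP e]; split=> //.
    rewrite /is_part (sort_sorted geq_total) mem_sort inE negb_or eq_sym -lt0n k0 z0 /=.
    by rewrite (perm_sumn (permEl (perm_sort _ _))) /= e subnKC.
  have /and3P[ss s0 /eqP sn] := sP.
  have pm := perm_to_rem ks.
  exists (rem k s); last first.
    apply: (sorted_eq geq_trans geq_anti) => //; first exact: (sort_sorted geq_total).
    by rewrite perm_sym perm_sort perm_sym.
  rewrite mem_part_list /is_part (subseq_sorted geq_trans (rem_subseq k s)) //=.
  apply/andP; split; first by apply: contra s0; apply: mem_rem.
  by rewrite -sn (perm_sumn pm) /= addKn.
- rewrite map_inj_in_uniq ?part_list_uniq // => s s'.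
  rewrite !mem_part_list => /and3P[ss _ _] /and3P[ss' _ _] e.
  apply: (sorted_eq geq_trans geq_anti) => //.
  by rewrite -(perm_cons k) -(perm_sort geq) e perm_sort.
- by rewrite filter_uniq ?part_list_uniq.
Qed.

Section CycleIndex.

Variables (R : comAlgType algC) (eps : bool) (t : nat -> R).

Definition part_weight n s : algC :=
  (if eps then (-1) ^+ (n - size s) else 1) / (z_part s)%:R.

Definition cycle_index n : R :=
  \sum_(s <- part_list n) part_weight n s *: \prod_(p <- s) t p.

Let sg : algC := if eps then -1 else 1.

Lemma sum_mult_parts n s : (sumn s <= n)%N ->
  (\sum_(j < n) j.+1 * count_mem j.+1 s)%N = sumn s.
Proof.
elim: s => [|m s IH] /= le; first by rewrite big1 // => j _; rewrite muln0.
under eq_bigr do rewrite mulnDr; rewrite big_split /= IH ?(leq_trans (leq_addl _ _) le) //.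
congr (_ + _)%N; case: m le => [|m] le; first by rewrite big1 // => j _; rewrite muln0.
have mn : (m < n)%N by apply: leq_trans (leq_addr _ _) le.
rewrite (bigD1 (Ordinal mn)) //= eqxx muln1 big1 ?addn0 // => j ne.
suff -> : (m.+1 == j.+1) = false by rewrite muln0.
by apply: contraNF ne => /eqP[e]; apply/eqP/val_inj.
Qed.

(* Counting each partition of n once for every part, with multiplicity the part itself. *)
Lemma cycle_index_rec n :
  n.+1%:R *: cycle_index n.+1 = \sum_(j < n.+1) sg ^+ j *: (t j.+1 * cycle_index (n - j)).
Proof.
transitivity (\sum_(j < n.+1) \sum_(s <- part_list n.+1)
   (j.+1 * count_mem j.+1 s)%:R *: (part_weight n.+1 s *: \prod_(p <- s) t p)).
  rewrite exchange_big scaler_sumr /=; apply: eq_big_seq => s.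
  rewrite mem_part_list => /and3P[_ _ /eqP e].
  by rewrite -scaler_suml -natr_sum sum_mult_parts e.
apply: eq_bigr => j _; rewrite (bigID (fun s => j.+1 \in s)) /=.
rewrite [X in _ + X]big1 ?addr0 => [|s /count_memPn ->]; last by rewrite muln0 scale0r.
have jn : (0 < j.+1 <= n.+1)%N by rewrite /= ltn_ord.
rewrite -big_filter -(perm_big _ (perm_part_list_insert jn)) big_map subSS.
rewrite /cycle_index big_distrr scaler_sumr /=; apply: eq_big_seq => s.
rewrite mem_part_list => /and3P[_ s0 /eqP es].
have pm : perm_eq (sort geq (j.+1 :: s)) (j.+1 :: s) by rewrite perm_sort.
rewrite (perm_big _ pm) /= big_cons -scalerAr !scalerA; congr (_ *: _).
move/seq.permP: (pm) => ->; rewrite /= eqxx add1n /part_weight (z_part_perm pm) z_part_cons //.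
rewrite (perm_size pm) /= subSS.
have jn' : (j <= n)%N by rewrite -ltnS ltn_ord.
have le : (size s <= n - j)%N by rewrite -es size_le_sumn.
have -> : (if eps then (-1) ^+ (n - size s) else 1 : algC) =
   sg ^+ j * (if eps then (-1) ^+ (n - j - size s) else 1).
  rewrite /sg; case: eps; last by rewrite expr1n mulr1.
  by rewrite -exprD addnBA // subnKC.
have zn : (z_part s)%:R != 0 :> algC by rewrite pnatr_eq0 -lt0n z_part_gt0.
have kn : (j.+1 * (count_mem j.+1 s).+1)%:R != 0 :> algC by rewrite pnatr_eq0.
rewrite [in X in _ * (_ / X)]natrM invfM !mulrA; set c := (j.+1 * _)%:R.
by rewrite mulrC !mulrA mulVf // mul1r.
Qed.

Lemma cycle_index0 : cycle_index 0 = 1.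
Proof.
have e : part_list 0 = [:: [::]].
  apply: perm_small_eq => //; apply: uniq_perm; rewrite ?part_list_uniq // => s.
  rewrite mem_part_list inE; apply/and3P/eqP=> [[_ s0 /eqP e]|->]; last by [].
  by apply: size0nil; apply/eqP; rewrite -leqn0 -e size_le_sumn.
rewrite /cycle_index e big_seq1 big_nil /part_weight /z_part /= big_geq //.
by rewrite if_same divr1 scale1r.
Qed.

End CycleIndex.

Section CycleIndexTheorem.

Variables (R : comAlgType algC) (Om : finType) (K : Om -> Om -> R) (eps : bool).

Let Z n : R := (n`!)%:R^-1 *: cyc_sum K eps n.

Let sg : algC := if eps then -1 else 1.

(** Iterated [marked_sum_rec]: the marked cycle closes after absorbing j more points, with sign
    sg^j, and leaves n - j free points. The equal choices of the point to absorb are compensated by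
    the factorial. *)
Let marked_pow n k :
  (n`!)%:R^-1 *: marked_sum K eps (@ord0 n) (ker_pow K k.+1) =
  \sum_(j < n.+1) sg ^+ j *: (ker_trace (ker_pow K (k.+1 + j)) * Z (n - j)).
Proof.
elim: n k => [|n IH] k; rewrite marked_sum_rec [RHS]big_ord_recl.
  rewrite !big_ord0 mulr0 !addr0 subnn addn0 expr0 scale1r.
  by rewrite -scalerAr.
rewrite addn0 subn0 expr0 scale1r scalerDr -scalerAr; congr (_ + _).
under eq_bigr do rewrite (marked_sum_const _ _ _ ord0).
rewrite sumr_const card_ord -[ker_comp _ _]/(ker_pow K k.+2).
have -> : (if eps then -1 else 1 : R) = sg%:A by rewrite /sg; case: eps; rewrite ?scaleN1r ?scale1r.
rewrite mulr_algl -scaler_nat !scalerA.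
have -> : (n.+1`!)%:R^-1 * sg * n.+1%:R = sg * (n`!)%:R^-1 :> algC.
  by rewrite factS natrM invfM mulrC !mulrA mulfV ?mul1r 1?mulrC // pnatr_eq0.
rewrite -scalerA IH scaler_sumr; apply: eq_bigr => j _.
by rewrite scalerA -exprS lift0 subSS addSnnS.
Qed.

Theorem cyc_sum_index n :
  Z n = cycle_index eps (fun k => ker_trace (ker_pow K k)) n.
Proof.
elim/ltn_ind: n => -[|n] IH.
  rewrite cycle_index0 /Z /cyc_sum (big_pred1 1%g) => [|s]; last first.
    by apply/esym/eqP/permP=> -[].
  rewrite (eq_bigr (fun=> 1)) => [|v _]; last by rewrite big_ord0.
  rewrite sumr_const card_ffun card_ord expn0 mulr1 /perm_weight odd_perm1 if_same.
  by rewrite fact0 invr1 scale1r.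
have nz : n.+1%:R != 0 :> algC by rewrite pnatr_eq0.
apply: (scalerI nz); rewrite cycle_index_rec /Z.
rewrite factS natrM invfM scalerA mulrA mulfV // mul1r -(marked_sum_id _ _ ord0).
rewrite (marked_pow n 0); apply: eq_bigr => j _; rewrite add1n IH //.
by rewrite ltnS leq_subr.
Qed.

End CycleIndexTheorem.

(** * The rotation kernel *)

Section Rotation.

Variables (l a : nat).
Hypothesis a_gt0 : (0 < a)%N.
Implicit Type v : a.-tuple 'I_l.

Definition rot_word k v : a.-tuple 'I_l := [tuple tnth v ((cyc a ^+ k)%g j) | j < a].

Lemma rot_wordD k k' v : rot_word k (rot_word k' v) = rot_word (k + k') v.
Proof. by apply: eq_from_tnth => j; rewrite !tnth_mktuple expgD permM. Qed.

Lemma rot_word_eq k k' v : k = k' %[mod a] -> rot_word k v = rot_word k' v.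
Proof.
move=> e; have ek : (cyc a ^+ k = cyc a ^+ k')%g by apply/eqP; rewrite cycX_eq // e.
by rewrite /rot_word ek.
Qed.

Lemma rot_word0 v : rot_word 0 v = v.
Proof. by apply: eq_from_tnth => j; rewrite tnth_mktuple expg0 perm1. Qed.

Lemma rot_word_gcd k v : (rot_word k v == v) = (rot_word (gcdn k a) v == v).
Proof.
apply/eqP/eqP=> e.
  have [k0|k0] := posnP k.
    by rewrite k0 gcd0n (rot_word_eq (k' := 0)) ?rot_word0 // modnn mod0n.
  have iter m : rot_word (m * k) v = v.
    by elim: m => [|m IH]; rewrite ?rot_word0 // mulSn -rot_wordD IH.
  have [km kn e1 _] := egcdnP a k0.
  by rewrite -[RHS](iter km) e1; apply: rot_word_eq; rewrite modnMDl.
have iter m : rot_word (m * gcdn k a) v = v.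
  by elim: m => [|m IH]; rewrite ?rot_word0 // mulSn -rot_wordD IH.
by rewrite -(divnK (dvdn_gcdl k a)) iter.
Qed.

(** A word fixed by the rotation by k has period g = gcd(k, a): its first g letters are free and
    each is repeated a / g times. *)
Lemma sum_rot_fixed (R : comNzRingType) (y : 'I_l -> R) k :
  \sum_(v : a.-tuple 'I_l | rot_word k v == v) \prod_(i <- v) y i =
  (\sum_i y i ^+ (a %/ gcdn k a)) ^+ gcdn k a.
Proof.
under eq_bigl do rewrite rot_word_gcd.
set g := gcdn k a; have ga : (g %| a)%N := dvdn_gcdr k a.
have g0 : (0 < g)%N by rewrite gcdn_gt0 a_gt0 orbT.
have modg j : (j %% g < g)%N by rewrite ltn_mod.
pose h (u : {ffun 'I_g -> 'I_l}) : a.-tuple 'I_l := [tuple u (Ordinal (modg j)) | j < a].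
have lt (i : 'I_g) : (i < a)%N by apply: leq_trans (ltn_ord i) (dvdn_leq _ ga).
pose h' v : {ffun 'I_g -> 'I_l} := [ffun i => tnth v (Ordinal (lt i))].
rewrite -[X in _ = _ ^+ X](card_ord g) -prodr_const bigA_distr_bigA /=.
rewrite (reindex_onto h h') => [|v /eqP vg]; last first.
  apply: eq_from_tnth => j; rewrite tnth_mktuple ffunE /=.
  have [m] := ubnP (val j); elim: m j => // m IH j jm.
  have [jg|gj] := ltnP j g.
    by congr tnth; apply: val_inj; rewrite /= modn_small.
  have lt' : (j - g < a)%N by apply: leq_ltn_trans (leq_subr _ _) (ltn_ord j).
  have e : tnth v j = tnth v (Ordinal lt').
    rewrite -[in RHS]vg tnth_mktuple; congr tnth; apply: val_inj.
    by rewrite [RHS]cycXE /= subnK // modn_small.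
  rewrite e -(IH (Ordinal lt')); last first.
    by rewrite /= -ltnS (leq_trans _ jm) // ltnS ltn_subrL g0 (leq_trans g0 gj).
  by congr tnth; apply: val_inj; rewrite /= -[in LHS](subnK gj) modnDr.
apply: eq_big => [u|u _].
  apply/andP; split; last first.
    apply/eqP/ffunP=> i; rewrite ffunE tnth_mktuple; congr (u _); apply: val_inj.
    by rewrite /= modn_small.
  apply/eqP/eq_from_tnth => j; rewrite !tnth_mktuple; congr (u _); apply: val_inj.
  by rewrite /= cycXE modn_dvdm // modnDr.
rewrite (_ : \prod_(i <- h u) y i = \prod_(j < a) y (u (Ordinal (modg j)))); last first.
  rewrite -[X in \prod_(i <- X) _](map_tnth_enum (h u)) big_map big_enum.
  by apply: eq_bigr => j _; rewrite tnth_mktuple.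
rewrite (partition_big (fun j : 'I_a => Ordinal (modg j)) predT) //=.
apply: eq_bigr => i _; rewrite (eq_bigr (fun=> y (u i))) => [|j /eqP-> //].
rewrite prodr_const; congr (_ ^+ _).
have lt2 (q : 'I_(a %/ g)) : (q * g + i < a)%N.
  have := ltn_ord q; rewrite -(leq_pmul2r g0) (divnK ga) mulSn addnC; apply: leq_trans.
  by rewrite addnC -addSn addnC leq_add2l.
have q_inj : injective (fun q : 'I_(a %/ g) => Ordinal (lt2 q)).
  by move=> q q' [] /eqP; rewrite eqn_add2r eqn_pmul2r // => /eqP/val_inj.
rewrite -[RHS]card_ord -(card_codom q_inj); apply: eq_card => j.
apply/idP/codomP=> [/eqnP /= e|[q ->]]; last first.
  by apply/eqnP; rewrite /= modnMDl modn_small.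
have jq : (j %/ g < a %/ g)%N by rewrite ltn_divRL // (leq_ltn_trans (leq_trunc_div _ _)).
by exists (Ordinal jq); apply: val_inj; rewrite /= -e -divn_eq.
Qed.

Variables (R : comAlgType algC) (x : 'I_l -> R) (omega : algC) (r : nat).
Hypothesis omega_a : omega ^+ a = 1.

Let S v v' : algC := \sum_(k < a | rot_word k v' == v) omega ^+ (r * k).

Definition rot_kernel v v' : R := S v v' *: weight x v.

Lemma weight_rot k v : weight x (rot_word k v) = weight x v.
Proof. by apply: weight_perm; apply/tuple_permP; exists (cyc a ^+ k)%g. Qed.

(** S sums a character of the cyclic group times the action of its elements; such a sum is a times
    an idempotent. *)
Let S_comp v v' : \sum_d S v d * S d v' = a%:R * S v v'.
Proof.
rewrite /S; under eq_bigr do rewrite big_distrr.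
rewrite (exchange_big_dep predT) //= mulr_natl -[X in _ *+ X]card_ord -sumr_const.
apply: eq_bigr => k' _; under eq_bigl do rewrite eq_sym.
rewrite big_pred1_eq big_distrl /= [RHS](reindex_inj (@perm_inj _ (cyc a ^+ k')%g)) /=.
have e k : rot_word ((cyc a ^+ k')%g k) v' = rot_word k (rot_word k' v').
  by rewrite rot_wordD; apply: rot_word_eq; rewrite cycXE modn_mod.
apply: eq_big => [k|k _]; first by rewrite e.
by rewrite cycXE !exprM expr_mod ?exprD // exprAC omega_a expr1n.
Qed.

(** The weight is invariant under rotation, so it factors out of the product and only the power a^m
    S of S is left. *)
Lemma ker_pow_rot m v v' :
  ker_pow rot_kernel m.+1 v v' = (a%:R ^+ m * S v v') *: weight x v ^+ m.+1.
Proof.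
elim: m v v' => [|m IH] v v'; first by rewrite expr0 mul1r expr1.
rewrite -[LHS]/(ker_comp rot_kernel (ker_pow rot_kernel m.+1) v v') /ker_comp.
transitivity (\sum_d (S v d * (a%:R ^+ m * S d v')) *: weight x v ^+ m.+2).
  apply: eq_bigr => d _; rewrite IH /rot_kernel -scalerAl -scalerAr scalerA.
  rewrite ![S v d * _]mulrC -[LHS]scalerA -[RHS]scalerA; congr (_ *: _).
  rewrite /S !scaler_suml; apply: eq_bigr => k /eqP <-; congr (_ *: _).
  by rewrite weight_rot -exprS.
rewrite -scaler_suml; congr (_ *: _).
under eq_bigr do rewrite mulrCA.
by rewrite -big_distrr /= S_comp exprS mulrA [_ * a%:R]mulrC.
Qed.

Lemma ker_trace_rot m : (0 < m)%N ->
  ker_trace (ker_pow rot_kernel m) = a%:R ^+ m.-1 *: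
    \sum_(k < a) omega ^+ (r * k) *: power_sum x (a * m %/ gcdn k a) ^+ gcdn k a.
Proof.
case: m => // m _; rewrite /ker_trace /=.
transitivity (\sum_v a%:R ^+ m *: (S v v *: weight x v ^+ m.+1)).
  by apply: eq_bigr => v _; rewrite scalerA -ker_pow_rot.
rewrite -scaler_sumr; congr (_ *: _).
transitivity (\sum_v \sum_(k < a | rot_word k v == v) omega ^+ (r * k) *: weight x v ^+ m.+1).
  by apply: eq_bigr => v _; rewrite /S scaler_suml.
rewrite (exchange_big_dep predT) //=; apply: eq_bigr => k _.
rewrite -scaler_sumr; congr (_ *: _).
rewrite (eq_bigr (fun v : a.-tuple 'I_l => \prod_(i <- v) (x i ^+ m.+1))) => [|v _].
  rewrite sum_rot_fixed; congr (_ ^+ _); apply: eq_bigr => i _.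
  by rewrite -exprM muln_divA ?dvdn_gcdr // mulnC.
by rewrite /weight prodrXl.
Qed.

End Rotation.

(** * Major index vectors *)

(** [maj_seq] transported to words. Cutting off one block at a time matches the recursion of
    [divseqs]. *)
Fixpoint majs (ka w : seq nat) : seq nat :=
  if ka is k :: ka' then repr1 (majw (take k w)) k :: majs ka' (drop k w) else [::].

Lemma size_majs ka w : size (majs ka w) = size ka.
Proof. by elim: ka w => //= k ka IH w; rewrite IH. Qed.

Lemma nth_majs ka w j : (j < size ka)%N -> nth 0%N (majs ka w) j =
  repr1 (majw (take (nth 0 ka j) (drop (sumn (take j ka)) w)))%N (nth 0%N ka j).
Proof.
elim: ka w j => // k ka IH w [|j] /=; first by rewrite drop0.
by move=> lt; rewrite IH // drop_drop addnC.
Qed.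

Lemma majw_take_drop w m k : (m + k <= size w)%N ->
  majw (take k (drop m w)) = (\sum_(m.+1 <= d < m + k | asc w d) (d - m))%N.
Proof.
move=> le; have sz : size (take k (drop m w)) = k.
  by rewrite size_takel // size_drop leq_subRL // (leq_trans (leq_addr _ _) le).
rewrite /majw sz; case: k le sz => [|k] le sz; first by rewrite big_ord0 big_geq // addn0.
rewrite -(big_mkord (fun d => asc (take k.+1 (drop m w)) d) id) big_mkcond big_nat_recl //.
rewrite -[m.+1]add0n big_addn addnS subSS addKn [RHS]big_mkcond /= add0n.
rewrite !big_nat; apply: eq_bigr => d /andP[_ dk].
have -> : asc (take k.+1 (drop m w)) d.+1 = asc w (d + m.+1).
  have dk' : (d.+1 < k.+1)%N by rewrite ltnS.
  have lt : (d + m.+1 < size w)%N.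
    by apply: leq_trans le; rewrite addnC addSn -addnS ltn_add2l.
  rewrite /asc sz dk' lt addnS /= !nth_take //; last exact: ltnW.
  by rewrite !nth_drop addnS [(m + d)%N]addnC.
by rewrite -addSnnS addnK.
Qed.

Lemma maj_seq_majs n (la : part n) (Q : filling n la) ka : is_syt Q -> sumn ka = n ->
  maj_seq ka Q = majs ka (map val (row_word Q)).
Proof.
move=> Qs kn; have [Qinj _ _] := is_sytP Q Qs; have [Qi h1 h2] := inj_fillingK Qinj.
apply: (@eq_from_nth _ 0%N); first by rewrite size_mkseq size_majs.
rewrite size_mkseq => j js; rewrite nth_mkseq // nth_majs // /maj_block.
rewrite majw_take_drop.
  by congr repr1; apply: eq_bigl => d; apply: des_asc.
rewrite size_map size_tuple -kn -[X in (_ <= sumn X)%N](cat_take_drop j.+1 ka) sumn_cat.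
by rewrite (take_nth 0%N js) -cats1 sumn_cat /= addn0 leq_addr.
Qed.

(** The major index vector depends on the ascent set only, which is what [sum_alt_fits] requires. *)
Lemma majs_ascset n (ka : seq nat) : sumn ka = n ->
  exists f : {set 'I_n} -> seq nat, forall l (w : n.-tuple 'I_l),
    majs ka (map val w) = f (ascset n (map val w)).
Proof.
move=> kn; exists (fun D : {set 'I_n} => mkseq (fun j => repr1
  (\sum_((sumn (take j ka)).+1 <= d < sumn (take j ka) + nth 0%N ka j |
     [exists x in D, val x == d]) (d - sumn (take j ka)))%N (nth 0%N ka j)) (size ka)) => l w.
apply: (@eq_from_nth _ 0%N); first by rewrite size_mkseq size_majs.
rewrite size_majs => j js; rewrite nth_mkseq // nth_majs // majw_take_drop.
  congr repr1; apply: eq_bigl => d; apply/idP/existsP=> [ad|[y /andP[+ /eqP <-]]]; last by rewrite inE.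
  have dn : (d < n)%N by case/and3P: ad => _; rewrite size_map size_tuple.
  by exists (Ordinal dn); rewrite inE /= ad eqxx.
rewrite size_map size_tuple -kn -[X in (_ <= sumn X)%N](cat_take_drop j.+1 ka) sumn_cat.
by rewrite (take_nth 0%N js) -cats1 sumn_cat /= addn0 leq_addr.
Qed.

Lemma maj_count_alt n (la : part n) ka tau : sumn ka = n ->
  (maj_count la ka tau)%:R = \sum_(w : n.-tuple 'I_n | majs ka (map val w) == tau) alt (vla la) w.
Proof.
move=> kn; have [f fE] := majs_ascset kn.
rewrite /maj_count -sum1_card natr_sum.
transitivity (\sum_(Q : filling n la | is_syt Q) (majs ka (map val (row_word Q)) == tau)%:R : algC).
  rewrite big_mkcond [RHS]big_mkcond; apply: eq_bigr => Q _; rewrite inE.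
  by case: (boolP (is_syt Q)) => //= Qs; rewrite (maj_seq_majs Qs kn); case: eqP.
rewrite (sum_syt la (fun w : n.-tuple 'I_n => (majs ka (map val w) == tau)%:R : algC)).
rewrite [RHS]sum_ind.
transitivity (\sum_(w : n.-tuple 'I_n) (f (ascset n (map val w)) == tau)%:R * alt (vla la) w).
  rewrite (sum_alt_fits (fun D => (f D == tau)%:R) (@vla_dec n la)).
  by apply: eq_bigr => w _; rewrite fE.
by apply: eq_bigr => w _; rewrite fE.
Qed.

(** * Words with prescribed major index in each block *)

Section Blocks.

Variables (R : comAlgType algC) (l : nat) (x : 'I_l -> R) (a r : nat) (omega : algC).
Hypotheses (a_gt0 : (0 < a)%N) (r_gt0 : (0 < r)%N) (r_le_a : (r <= a)%N).
Hypothesis omega_prim : a.-primitive_root omega.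

Definition maj_part n tau : R :=
  \sum_(w : n.-tuple 'I_l | repr1 (majw (map val w)) n == tau) weight x w.

Lemma repr1_eq n M t : (0 < t <= n)%N -> (repr1 M n == t) = (M == t %[mod n])%N.
Proof.
move=> /andP[t0 tn]; rewrite /repr1; move: tn; rewrite leq_eqVlt => /orP[/eqP e|tn].
  rewrite e in t0 *; rewrite modnn; case: ifP => [nM|/negbT nM]; first by rewrite eqxx; apply/esym.
  by rewrite [RHS](negbTE nM) ltn_eqF // ltn_mod.
rewrite (modn_small tn); case: ifP => // /eqP->.
by rewrite gtn_eqF // eq_sym gtn_eqF.
Qed.

(** Averaging zeta^(e (maj - t)) over e selects the words with maj = t modulo n; for each e the sum
    over all words is a power of a power sum. *)
Lemma maj_part_fourier n t zeta : (0 < n)%N -> n.-primitive_root zeta -> (0 < t <= n)%N ->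
  maj_part n t = n%:R^-1 *: \sum_(e < n) zeta^-1 ^+ (e * t) *:
    power_sum x (n %/ gcdn e n) ^+ gcdn e n.
Proof.
move=> n0 zp tn; under eq_bigr do rewrite -(sum_majw_root _ _ n0 zp) scaler_sumr.
rewrite exchange_big scaler_sumr /maj_part big_mkcond; apply: eq_bigr => w _ /=.
under eq_bigr do rewrite scalerA mulnC exprM mulnC exprM -exprMn.
rewrite -scaler_suml scalerA sum_root_of_unity; last first.
  by rewrite exprMn -!exprM ![(_ * n)%N]mulnC !exprM exprVn (prim_expr_order zp) invr1 !expr1n mulr1.
have -> : (zeta^-1 ^+ t * zeta ^+ majw (map val w) == 1) = (repr1 (majw (map val w)) n == t).
  rewrite repr1_eq // -(eq_prim_root_expr zp) exprVn mulrC.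
  have z0 : zeta ^+ t != 0.
    rewrite expf_neq0 //; apply: contra_eq_neq (prim_expr_order zp) => ->.
    by rewrite expr0n gtn_eqF // eq_sym oner_eq0.
  by rewrite -(inj_eq (mulIf z0)) divfK // mul1r.
case: ifP => _; last by rewrite mulr0 scale0r.
by rewrite mulVf ?scale1r // pnatr_eq0 -lt0n.
Qed.

Definition block_sum m : R :=
  \sum_(t <- divisors (r * m)) (mu_num t m (r * m))%:~R *: maj_part (a * m) t.

(** The trace carries a^(m-1) and the Fourier identity a factor 1/a, whence a^m. *)
Lemma ker_trace_block m : (0 < m)%N ->
  ker_trace (ker_pow (rot_kernel (a := a) x omega r) m) = a%:R ^+ m *: block_sum m.
Proof.
move=> m0; have n0 : (0 < a * m)%N by rewrite muln_gt0 a_gt0.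
have [zeta zp] := C_prim_root_exists n0.
rewrite (ker_trace_rot a_gt0 x r (prim_expr_order omega_prim) m0).
have H t : (0 < t <= a * m)%N -> maj_part (a * m) t = (a * m)%:R^-1 *:
    \sum_(e < a * m) zeta^-1 ^+ (e * t) *: power_sum x (a * m %/ gcdn e (a * m)) ^+ gcdn e (a * m).
  exact: maj_part_fourier.
rewrite /block_sum (sum_mu_fourier (B := fun g => power_sum x (a * m %/ g) ^+ g)
  a_gt0 m0 r_gt0 r_le_a omega_prim zp H) scalerA; congr (_ *: _).
by rewrite -{2}(prednK m0) exprSr mulfK // pnatr_eq0 -lt0n.
Qed.

Lemma majs_cat k ka (u v : seq nat) : size u = k ->
  majs (k :: ka) (u ++ v) = repr1 (majw u) k :: majs ka v.
Proof. by move=> uk; rewrite /= take_size_cat // drop_size_cat. Qed.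

Lemma prod_block_sum nu :
  \prod_(p <- nu) block_sum p =
  \sum_(tau <- divseqs (star r nu)) (mu_seq tau nu (star r nu))%:~R *:
    \sum_(w : (sumn (star a nu)).-tuple 'I_l | majs (star a nu) (map val w) == tau) weight x w.
Proof.
elim: nu => [|p nu IH].
  rewrite big_nil big_seq1 /mu_seq /= big_ord0 scale1r (big_pred1 [tuple]) => [|w].
    by rewrite /weight big_nil.
  by apply/esym/eqP/tuple0.
rewrite big_cons IH [divseqs _]/= big_allpairs_dep /= /block_sum big_distrl /=.
apply: eq_bigr => t _; rewrite big_distrr /=; apply: eq_bigr => tau _.
rewrite {2}/mu_seq /= big_ord_recl /= -/(mu_seq tau nu (star r nu)).
rewrite -scalerAl -scalerAr scalerA intrM; congr (_ *: _).
rewrite (big_tuple_cat _ (a * p) (sumn (star a nu))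
  (fun w => majs ((a * p)%N :: star a nu) (map val w) == t :: tau) (weight x)).
rewrite /maj_part big_distrl big_mkcond; apply: eq_bigr => u _.
have E (v : seq 'I_l) : (majs ((a * p)%N :: star a nu) (map val (u ++ v)) == t :: tau) =
    (repr1 (majw (map val u)) (a * p) == t) && (majs (star a nu) (map val v) == tau).
  by rewrite map_cat majs_cat ?size_map ?size_tuple // eqseq_cons.
rewrite [RHS](eq_bigl _ _ (fun v : _.-tuple 'I_l => E v)).
case: (repr1 _ _ == t); last by rewrite big_pred0.
by rewrite big_distrr; apply: eq_bigr => v _; rewrite weight_cat.
Qed.

End Blocks.

(** * Multiplicities in the induced representation *)

Section AlternantFunctional.

Variables (n : nat) (v : 'I_n -> nat).

(** Coefficient of x^v in a_rho p. The condition on s drops the terms in which v - s.rho would be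
    negative. *)
Definition alt_fun (p : {mpoly algC[n]}) : algC :=
  \sum_(s : 'S_n | [forall i, rho (s i) <= v i]%N)
    (-1) ^+ s * p@_[multinom (v i - rho (s i))%N | i < n].

Lemma alt_fun_sum (I : Type) (r : seq I) (P : pred I) (F : I -> {mpoly algC[n]}) :
  alt_fun (\sum_(i <- r | P i) F i) = \sum_(i <- r | P i) alt_fun (F i).
Proof.
rewrite /alt_fun exchange_big; apply: eq_bigr => s _ /=.
by rewrite raddf_sum big_distrr.
Qed.

Lemma alt_funZ c p : alt_fun (c *: p) = c * alt_fun p.
Proof.
rewrite /alt_fun big_distrr; apply: eq_bigr => s _ /=.
by rewrite mcoeffZ mulrCA.
Qed.

Lemma alt_fun_weight (w : seq 'I_n) : alt_fun (weight (fun i => 'X_i) w) = alt v w.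
Proof.
have wE : weight (fun i => 'X_i) w = 'X_[ [multinom count_mem i w | i < n] ] :> {mpoly algC[n]}.
  elim: w => [|k w IH].
    have -> : [multinom count_mem i (Nil 'I_n) | i < n] = 0%MM.
      by apply/mnmP=> i; rewrite !mnm0E.
    by rewrite /weight big_nil mpolyX0.
  have -> : [multinom count_mem i (k :: w) | i < n] = (U_(k) + [multinom count_mem i w | i < n])%MM.
    by apply/mnmP=> i; rewrite mnmDE !mnmE.
  by rewrite mpolyXD -IH -cat1s weight_cat /weight big_seq1.
rewrite /alt_fun /alt wE big_mkcond [RHS]big_mkcond; apply: eq_bigr => s _.
rewrite mcoeffX; case: ifPn => [/forallP le|].
  have -> : ([multinom count_mem i w | i < n] == [multinom (v i - rho (s i))%N | i < n]) =
      [forall i, count_mem i w + rho (s i) == v i]%N.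
    apply/eqP/forallP=> [/mnmP h i|h].
      by have := h i; rewrite !mnmE => ->; rewrite subnK.
    by apply/mnmP=> i; rewrite !mnmE -(eqP (h i)) addnK.
  by case: ifP => _; rewrite ?mulr1 ?mulr0.
rewrite negb_forall => /existsP[i]; rewrite -ltnNge => lt.
rewrite ifF //; apply/negbTE/negP=> /forallP/(_ i)/eqP e.
by move: lt; rewrite -e ltnNge leq_addl.
Qed.

End AlternantFunctional.

Lemma cyc_expg_inj a : injective (fun k : 'I_a => cyc a ^+ k)%g.
Proof.
move=> k k' /eqP; rewrite cycX_eq ?(leq_ltn_trans _ (ltn_ord k)) //.
by rewrite !modn_small // => /eqP/val_inj.
Qed.

Lemma cycle_cyc a : (0 < a)%N -> <[cyc a]>%g = [set (cyc a ^+ (k : 'I_a))%g | k : 'I_a].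
Proof.
move=> a_gt0; apply/setP=> h; apply/cycleP/imsetP=> [[k ->]|[k _ ->]]; last by exists k.
exists (Ordinal (ltn_pmod k a_gt0)) => //.
by apply/eqP; rewrite cycX_eq //= modn_mod.
Qed.

Lemma card_in_wreath a b : (0 < a)%N -> #|[set y : wreath a b | in_wreath y]| = (a ^ b * b`!)%N.
Proof.
move=> a_gt0.
have -> : [set y : wreath a b | in_wreath y] =
    setX [set g : {ffun 'I_b -> 'S_a} | g \in ffun_on (mem <[cyc a]>%g)] [set: 'S_b].
  by apply/setP=> -[g s]; rewrite !inE andbT; apply/forallP/ffun_onP.
rewrite cardsX cardsT card_Sn cardsE card_ffun_on card_ord cycle_cyc //.
by rewrite card_imset ?card_ord //; apply: cyc_expg_inj.
Qed.

(** * Words fixed by elements of the wreath product *)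

Section WreathSum.

Variables (a b : nat) (omega : algC) (r : nat) (eps : bool).
Hypotheses (a_gt0 : (0 < a)%N) (omega_a : omega ^+ a = 1).
Variables (R : comAlgType algC) (l : nat) (x : 'I_l -> R).

Let unblock (v : {ffun 'I_b -> a.-tuple 'I_l}) : (a * b).-tuple 'I_l :=
  [tuple tnth (v (blk y)) (off y) | y < a * b].

Let unblock_bij : bijective unblock.
Proof.
exists (fun u => [ffun i => [tuple tnth u (pos i j) | j < a]]) => [v|u].
  apply/ffunP=> i; rewrite ffunE; apply: eq_from_tnth => j.
  by rewrite !tnth_mktuple blk_pos off_pos.
by apply: eq_from_tnth => y; rewrite tnth_mktuple ffunE tnth_mktuple posK.
Qed.

Let weight_unblock v : weight x (unblock v) = \prod_i weight x (v i).
Proof.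
rewrite weight_tuple (partition_big (@blk a b) predT) //=; apply: eq_bigr => i _.
rewrite weight_tuple (reindex_onto (pos i) (@off a b)) => [|y /eqP <-]; last exact: posK.
apply: eq_big => [j|j _]; first by rewrite blk_pos off_pos !eqxx.
by rewrite tnth_mktuple blk_pos off_pos.
Qed.

Let unblock_fix (y : wreath a b) v : word_fix (wr_embed y) (unblock v) =
  [forall i, [tuple tnth (v (y.2 i)) (y.1 (y.2 i) j) | j < a] == v i].
Proof.
apply/forallP/forallP=> h i.
  apply/eqP/eq_from_tnth=> j; rewrite tnth_mktuple; have := h (pos i j).
  by rewrite wr_embedE !tnth_mktuple !blk_pos !off_pos => /eqP.
rewrite -(posK i) wr_embedE !tnth_mktuple !blk_pos !off_pos.
by rewrite -[in X in _ == X](eqP (h (blk i))) tnth_mktuple.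
Qed.

Let rot_kernelE v v' : rot_kernel (a := a) x omega r v v' =
  \sum_(h in <[cyc a]>%g) (cyc_chi omega r h * ([tuple tnth v' (h j) | j < a] == v)%:R) *: weight x v.
Proof.
rewrite /rot_kernel scaler_suml big_mkcond.
rewrite cycle_cyc // big_imset /=; last by move=> k k' _ _; apply: cyc_expg_inj.
apply: eq_bigr => k _; rewrite cyc_chiX // -exprM.
by case: ifP => _; rewrite ?mulr1 // mulr0 scale0r.
Qed.

(** A word of length a b is a family of b words of length a. For a fixed block permutation s,
    fixedness is one condition per block, so the sum over the cyclic components factors into kernel
    values. *)
Lemma wreath_sum :
  \sum_(y : wreath a b | in_wreath y) wr_chi omega r eps y *:
    \sum_(u : (a * b).-tuple 'I_l | word_fix (wr_embed y) u) weight x u =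
  cyc_sum (rot_kernel (a := a) x omega r) eps b.
Proof.
pose F (g : {ffun 'I_b -> 'S_a}) (s : 'S_b) := wr_chi omega r eps (g, s) *:
  \sum_(u : (a * b).-tuple 'I_l | word_fix (wr_embed (g, s)) u) weight x u.
transitivity (\sum_(g : {ffun 'I_b -> 'S_a} | g \in ffun_on (mem <[cyc a]>%g)) \sum_s F g s).
  rewrite (pair_big_dep _ (fun _ => predT)) /=; apply: eq_big => [[g s]|[g s] _] //=.
  by rewrite andbT; apply/forallP/ffun_onP.
rewrite exchange_big; apply: eq_bigr => s _.
pose hit (v : {ffun 'I_b -> a.-tuple 'I_l}) (h : 'S_a) i :=
  [tuple tnth (v (s i)) (h j) | j < a] == v i.
transitivity ((if eps then (-1) ^+ s else 1 : algC) *: \sum_(g : {ffun 'I_b -> 'S_a} | g \in ffun_on (mem <[cyc a]>%g))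
    \sum_v (\prod_i (cyc_chi omega r (g (s i)) * (hit v (g (s i)) i)%:R)) *: \prod_i weight x (v i)).
  rewrite scaler_sumr; apply: eq_bigr => g _; rewrite /F /wr_chi -scalerA; congr (_ *: _).
  rewrite (reindex unblock) /=; last exact: onW_bij.
  rewrite scaler_sumr big_mkcond; apply: eq_bigr => v _.
  rewrite unblock_fix weight_unblock /=; case: ifPn => [/forallP h|].
    congr (_ *: _); rewrite (reindex_inj (@perm_inj _ s)); apply: eq_bigr => i _.
    by rewrite /hit h mulr1.
  rewrite negb_forall => /existsP[i /negbTE h].
  by rewrite (bigD1 i) //= {1}/hit h mulr0 mul0r scale0r.
have -> : perm_weight R eps s = (if eps then (-1) ^+ s else 1 : algC) *: 1.
  by rewrite /perm_weight; case: eps; case: (odd_perm s); rewrite ?expr1 ?expr0 ?scaleN1r ?scale1r.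
rewrite -scalerAl mul1r; congr (_ *: _); rewrite exchange_big; apply: eq_bigr => v _.
(* The condition on block i involves the component of g at s i; reindexing by the image aligns the
   factors with the coordinates of g. *)
rewrite [RHS](reindex_inj (@perm_inj _ s^-1%g)) /=.
under [RHS]eq_bigr do rewrite permKV rot_kernelE.
rewrite [RHS]bigA_distr_big; apply: eq_bigr => g _.
rewrite scaler_prod; congr (_ *: _); last exact: reindex_inj perm_inj.
rewrite [LHS](reindex_inj (@perm_inj _ s^-1%g)); apply: eq_bigr => i _.
by rewrite /hit permKV.
Qed.

End WreathSum.

Section Multiplicity.

Variables (a b r : nat) (eps : bool) (omega : algC).
Hypotheses (a_gt0 : (0 < a)%N) (r_gt0 : (0 < r)%N) (r_le_a : (r <= a)%N).
Hypothesis prim : a.-primitive_root omega.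
Variable la : part (a * b).

(** Frobenius reciprocity, with the Specht character replaced by psi; its values are sums of signs,
    so conjugation disappears. *)
Lemma cfdot_L_char_alt : '[L_char b r eps a_gt0 prim, specht_char la] =
  (a ^ b * b`!)%:R^-1 * \sum_(y : wreath a b | in_wreath y) wr_chi omega r eps y *
    \sum_(w | word_fix (wr_embed y) w) alt (vla la) w.
Proof.
rewrite /L_char -Frobenius_reciprocity cfdotE /= card_imset ?card_in_wreath //; last exact: wr_embed_inj.
congr (_ * _); rewrite big_imset /=; last by move=> ? ? _ _; apply: wr_embed_inj.
apply: eq_big => [y|y]; first by rewrite inE.
rewrite inE => yP; have yG : wr_embed y \in wr_group a b by apply: imset_f; rewrite inE.
rewrite cfunE yG /= wr_mxE // mxtrace_scalar cfResE ?subsetT // specht_char_psi psiE.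
congr (_ * _); rewrite rmorph_sum; apply: eq_bigr => w _.
by rewrite /alt rmorph_sum; apply: eq_bigr => s _; rewrite rmorph_sign.
Qed.

Lemma sumn_star c nu : sumn (star c nu) = (c * sumn nu)%N.
Proof. by elim: nu => [|p nu IH] /=; rewrite ?muln0 // mulnDr IH. Qed.

Lemma alt_fun_prod_block nu : sumn nu = b ->
  alt_fun (vla la) (\prod_(p <- nu) block_sum (fun i => 'X_i) a r p) =
  \sum_(tau <- divseqs (star r nu))
     (mu_seq tau nu (star r nu))%:~R * (maj_count la (star a nu) tau)%:R.
Proof.
move=> nub; have nuab : sumn (star a nu) = (a * b)%N by rewrite sumn_star nub.
rewrite prod_block_sum alt_fun_sum; apply: eq_bigr => tau _.
rewrite alt_funZ (maj_count_alt _ _ nuab); congr (_ * _).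
(* The two word lengths are only propositionally equal, so the length is generalised before
   substitution. *)
move: (sumn _) nuab => m e; subst m.
by rewrite alt_fun_sum; apply: eq_bigr => w _; rewrite alt_fun_weight.
Qed.

Lemma cfdot_L_char : '[L_char b r eps a_gt0 prim, specht_char la] =
  \sum_(nu : part b) part_weight eps b (parts nu) *
    \sum_(tau <- divseqs (star r (parts nu)))
      (mu_seq tau (parts nu) (star r (parts nu)))%:~R * (maj_count la (star a (parts nu)) tau)%:R.
Proof.
rewrite (big_part b (fun nu => part_weight eps b nu * \sum_(tau <- divseqs (star r nu))
  (mu_seq tau nu (star r nu))%:~R * (maj_count la (star a nu) tau)%:R)).
rewrite cfdot_L_char_alt natrM invfM -mulrA.
pose x i : {mpoly algC[a * b]} := 'X_i.
have -> : \sum_(y : wreath a b | in_wreath y) wr_chi omega r eps y *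
    \sum_(w | word_fix (wr_embed y) w) alt (vla la) w =
    alt_fun (vla la) (cyc_sum (rot_kernel (a := a) x omega r) eps b).
  rewrite -wreath_sum ?(prim_expr_order prim) // alt_fun_sum.
  apply: eq_bigr => y _; rewrite alt_funZ alt_fun_sum.
  by congr (_ * _); apply: eq_bigr => w _; rewrite alt_fun_weight.
rewrite -!alt_funZ cyc_sum_index scaler_sumr alt_fun_sum big_seq [RHS]big_seq.
apply: eq_bigr => nu; rewrite mem_part_list => /and3P[_ nu0 /eqP nub].
have -> : \prod_(p <- nu) ker_trace (ker_pow (rot_kernel (a := a) x omega r) p) =
    a%:R ^+ sumn nu *: \prod_(p <- nu) block_sum x a r p.
  elim: nu nu0 {nub} => [|p nu IH]; first by rewrite !big_nil scale1r.
  rewrite inE eq_sym negb_or -lt0n => /andP[p0 nu0] /=.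
  rewrite !big_cons IH // (ker_trace_block _ a_gt0 r_gt0 r_le_a prim p0).
  by rewrite -scalerAl -scalerAr scalerA exprD.
have aR0 : (a%:R : algC) ^+ b != 0 by rewrite expf_neq0 // pnatr_eq0 -lt0n.
(* The factors a^p of the traces multiply to a^b and cancel the order of the base group; b! has been
   absorbed by the cycle index. *)
rewrite nub !scalerA natrX [_^-1 * _]mulrC divfK // alt_funZ; congr (_ * _).
exact: alt_fun_prod_block.
Qed.

End Multiplicity.

Theorem theorem5p11 (a b r : nat) (a_gt0 : (0 < a)%N) (b_gt0 : (0 < b)%N)
    (r_gt0 : (0 < r)%N) (r_le_a : (r <= a)%N)
    (omega : algC) (prim : a.-primitive_root omega) (N : nat) :
  Ch N (L_char b r false a_gt0 prim) =
    \sum_(la : part (a * b))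
       (\sum_(nu : part b)
          (z_part (parts nu))%:R^-1 *
          \sum_(tau <- divseqs (star r (parts nu)))
             (mu_seq tau (parts nu) (star r (parts nu)))%:~R
             * (maj_count la (star a (parts nu)) tau)%:R) *: schur N la
  /\
  Ch N (L_char b r true a_gt0 prim) =
    \sum_(la : part (a * b))
       (\sum_(nu : part b)
          (-1) ^+ (b - size (parts nu)) / (z_part (parts nu))%:R *
          \sum_(tau <- divseqs (star r (parts nu)))
             (mu_seq tau (parts nu) (star r (parts nu)))%:~R
             * (maj_count la (star a (parts nu)) tau)%:R) *: schur N la.
Proof.
(* Both sides are combinations of the same [schur N la], so coefficients are compared one partition
   at a time. *)
split; apply: eq_bigr => la _; rewrite cfdot_L_char //; congr (_ *: _).
by apply: eq_bigr => nu _; rewrite /part_weight mul1r.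
Qed.
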